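(* Let a finite group $G$ act on the free skew-field $\mathbb{R}(\!\langle x_1,\dots,x_n\rangle\!)$ linearly via a complete (real) representation of $G$ on $\mathrm{span}_{\mathbb{R}}\{x_1,\dots,x_n\}$. Then $$\mathbb{R}(\!\langle x_1,\dots,x_n\rangle\!)^{G}\cong \mathbb{R}(\!\langle w_1,\dots,w_{|G|(n-1)+1}\rangle\!)$$ as skew-fields over $\mathbb{R}$.
   Context: For a field $\mathbb{F}$, the free skew-field $\mathbb{F}(\!\langle x_1,\dots,x_n\rangle\!)$ is the universal skew-field of fractions of the free associative algebra $\mathbb{F}\langle x_1,\dots,x_n\rangle$. A group $G$ acts linearly on it via a representation $G\to\mathrm{GL}(V)$, $V=\mathrm{span}_{\mathbb{F}}\{x_1,\dots,x_n\}$, if the action is by the $\mathbb{F}$-algebra automorphisms induced by this representation. A superscript $G$ denotes the fixed sub-skew-field. Complete representation (recursive definition on the order of the group): a complex linear representation $\pi$ of a finite group $G$ is complete if it decomposes as $\pi=\pi_B\oplus\pi_J$ and there is a nontrivial abelian normal subgroup $N\subseteq G$ such that: (1) $\pi_B|_N$ contains exactly the nontrivial linear (degree one) representations of $N$ as direct summands, each with multiplicity $1$; (2) $G=N$, or the representation $$Q\pi=\left[\pi\oplus(\pi_B\otimes\pi_B)\oplus(\pi_B\otimes\pi_J)\oplus(\pi_J\otimes\pi_B)\oplus(\pi_B\otimes\pi\otimes\pi_B)\right]_{N^\tau}$$ is a complete representation of $G/N$. Here, for a representation $\rho$ of $G$, $\rho_{N^\tau}$ denotes the (direct sum of the irreducible)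 summands of $\rho$ which are trivial on $N$, viewed naturally as a representation of $G/N$. A real linear representation of a finite group is complete if its complexification is complete. *)

(* Defs.v *)
From HB Require Import structures.
From mathcomp Require Import all_boot all_order all_algebra all_fingroup.
From mathcomp Require Import all_solvable all_field all_character.
From mathcomp Require Import monalg complex reals.

Set Implicit Arguments.
Unset Strict Implicit.
Unset Printing Implicit Defensive.

Import GroupScope GRing.Theory.
Local Open Scope ring_scope.

(** P. M. Cohn's universal skew fields of fractions.  A skew field is a
    [unitRingType] satisfying [GRing.field_axiom] (which, despite its name, does
    not involve commutativity).  For a ring [A], an [A]-field is a skew field [K]
    with a ring morphism [A -> K].  Subsets are boolean predicates, which
    classically is no restriction. *)

(** The only sub-skew-field of [K] containing the image of [f] is [K]. *)
Definition epic (A : nzRingType) (K : unitRingType) (f : A -> K) : Prop :=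
  forall S : {pred K}, GRing.divring_closed S -> (forall a, f a \in S) ->
  forall x, x \in S.

(** [phi], restricted to the [A]-subring [S] of [U], is a local morphism of
    [A]-rings from [S] to [K]: its non-units are exactly its kernel.  The values
    of [phi] outside [S] are irrelevant. *)
Definition specialization (A : nzRingType) (U K : unitRingType)
    (i : A -> U) (f : A -> K) (S : {pred U}) (phi : U -> K) : Prop :=
  [/\ GRing.subring_closed S /\ (forall a, i a \in S),
      forall a, phi (i a) = f a,
      {in S &, {morph phi : x y / x - y}},
      {in S &, {morph phi : x y / x * y}} &
      {in S, forall x, phi x != 0 -> x \is a GRing.unit /\ x^-1 \in S}].

Definition universal_field_of_fractions (A : nzRingType) (U : unitRingType)
    (i : {rmorphism A -> U}) : Prop :=
  [/\ GRing.field_axiom U, injective i, epic i &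
      forall (K : unitRingType) (f : {rmorphism A -> K}),
        GRing.field_axiom K -> epic f ->
        exists (S : {pred U}) (phi : U -> K), specialization i f S phi].

Definition free_algebra (F : fieldType) (n : nat) : lalgType F :=
  {malg F[{fmonom 'I_n}]}.

Definition free_gen (F : fieldType) (n : nat) (i : 'I_n) : free_algebra F n :=
  << fmu i >>.

Definition free_skew_field (F : fieldType) (n : nat) (D : unitAlgType F)
    (iD : {lrmorphism free_algebra F n -> D}) : Prop :=
  universal_field_of_fractions iD.

(** [a] is a left action of [G] on [D] by algebra endomorphisms (hence
    automorphisms); [rG] is read as a morphism [G -> GL(V)] in the basis
    [x_0, ..., x_(n-1)] of [V], so that [g x_i] is given by the [i]-th column of
    [rG g]. *)
Definition linear_action (F : fieldType) (gT : finGroupType) (G : {group gT})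
    (n : nat) (rG : mx_representation F G n) (D : unitAlgType F)
    (iD : {lrmorphism free_algebra F n -> D})
    (a : gT -> {lrmorphism D -> D}) : Prop :=
  let x j := iD (free_gen F j) in
  [/\ a 1%g =1 id,
      {in G &, forall g h, a (g * h)%g =1 a g \o a h} &
      {in G, forall g i, a g (x i) = \sum_(j < n) rG g j i *: x j}].

Section Complete.

Variable F : fieldType.

(** [rN] is the direct sum of the nontrivial degree one representations of [N],
    each of them (up to isomorphism) occurring exactly once. *)
Definition nontrivial_linear_once (gT : finGroupType) (N : {group gT})
    (d : nat) (rN : mx_representation F N d) : Prop :=
  exists (k : nat) (s : 'I_k -> mx_representation F N 1),
    [/\ mx_rsim rN (\big[dadd_grepr/grepr0]_(i < k) Representation (s i)),
        forall i, ~~ (N \subset rker (s i)) &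
        forall chi : mx_representation F N 1, ~~ (N \subset rker chi) ->
          exists! i, mx_rsim chi (s i)].

Definition tensor (gT : finGroupType) (G : {group gT})
    (r1 r2 : representation F G) : representation F G :=
  Representation (prod_repr r1 r2).

Definition Qsum (gT : finGroupType) (G : {group gT})
    (r rB rJ : representation F G) : representation F G :=
  dadd_grepr r
    (dadd_grepr (tensor rB rB)
    (dadd_grepr (tensor rB rJ)
    (dadd_grepr (tensor rJ rB)
                (tensor (tensor rB r) rB)))).

Definition complete_splitting (gT : finGroupType) (G N : {group gT})
    (nNG : N <| G) (r rB rJ : representation F G) : Prop :=
  [/\ N :!=: 1%g, abelian N, mx_rsim r (dadd_grepr rB rJ) &
      nontrivial_linear_once (subg_repr rB (normal_sub nNG))].

(** In [complete_quo], [s] is a decomposition of [Qsum r rB rJ] into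
    irreducibles; those which are trivial on [N] are kept, and their sum is
    viewed as a representation of [G / N]. *)
Inductive complete : forall (gT : finGroupType) (G : {group gT}),
    representation F G -> Prop :=
| complete_abelian (gT : finGroupType) (G N : {group gT}) (nNG : N <| G)
    (r rB rJ : representation F G) :
    complete_splitting nNG r rB rJ -> G :=: N -> complete r
| complete_quo (gT : finGroupType) (G N : {group gT}) (nNG : N <| G)
    (r rB rJ : representation F G)
    (k : nat) (s : 'I_k -> representation F G)
    (kerN : N \subset
       rker (\big[dadd_grepr/grepr0]_(i < k | N \subset rker (s i)) s i)) :
    complete_splitting nNG r rB rJ ->
    (forall i, mx_irreducible (s i)) ->
    mx_rsim (Qsum r rB rJ) (\big[dadd_grepr/grepr0]_(i < k) s i) ->
    complete (Representation (quo_repr kerN (normal_norm nNG))) ->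
    complete r.

End Complete.

Definition real_complete (R : realType) (gT : finGroupType) (G : {group gT})
    (n : nat) (rG : mx_representation R G n) : Prop :=
  complete (Representation (map_repr (real_complex R) rG)).

(* Main.v *)
(** Of the completeness of the representation [V], only faithfulness and the
    nontriviality of [G] matter.  Let [A] be the free algebra on [V], with universal
    skew field of fractions [D], and [K = D^G].  Choose [x0] in [V] and a linear form
    [lam] with [lam x0 = 1] and [lam (g x0) <> 1] for [g <> 1]; the elements
    [e_g = (g x0 - 1)^-1] of [D] are permuted by [G] and, by reduction at the point
    [lam], they form a right basis of [D] over [K].  Write [1 = sum_g e_g b] and
    [u_j e_1 = sum_g e_g c_(g,j)] for a basis [u_0 = x0, ..., u_(n-1)] of [V]: then
    [c_(g,0)] is [b] or [1 + b], and [b] and the [c_(g,j)] with [j > 0] generate [K].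

    To see that these [|G|(n-1)+1] generators are free, let [E] be the free skew
    field on as many variables and let [rho] be the representation of [A] on
    [E^|G|] given by the same formulas.  Since [E] specializes to [K], every matrix
    over [A] which is invertible over [D] remains invertible under [rho].  On the
    other hand a matrix over [A] singular over [D] is singular over every skew
    field under [A], and it follows that its image under [rho] has a kernel of
    dimension at least [|G|].  Hence [rho] extends to [D]; the action of [K] on the
    [G]-invariant vector [sum_g e_g b] then gives a morphism [K -> E] which is
    inverse to the specialization of [E].

    The statement on kernels is proved first for representations of dimension
    [2^s], by deforming a representation of dimension [2d] into one of dimension
    [d] over a quaternion-like skew field; taking many copies of the given
    representation reduces the general case to this one. *)

From HB Require Import structures.
Require Import Defs.
From mathcomp Require Import boolp classical_sets fsbigop.
From mathcomp Require Import all_boot all_order all_algebra all_fingroup.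
From mathcomp Require Import all_solvable all_field all_character.
From mathcomp Require Import monalg complex reals zify.

Set Implicit Arguments.
Unset Strict Implicit.
Unset Printing Implicit Defensive.

Import Order.TTheory GRing.Theory Num.Theory.
Local Open Scope ring_scope.

(** * Linear algebra over skew fields *)

(** The obstacle is the direction of the specialization, from [E] to [K]: ranks can only drop under
    it. Invertibility therefore lifts from [K] to [E], but relations do not. A relation
    [u N^-1 v = 0] in [D] amounts to the singularity over [D] of a bordered matrix over [A]. To
    deduce the same relation for [rho], one kernel vector of the bordered matrix is not enough: a
    whole block of |G| independent ones is needed, since the part of it facing the border has to be
    an invertible matrix over [E] before it can be cancelled. Singularity, however, speaks only of
    morphisms from [A] to skew fields, and [rho] takes values in matrices. The quaternion-like
    algebras bring [rho] back to that case: 2 x 2 matrices over [E] are the value at X = Y = 1 of a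
    skew field, so halving the dimension s times leads from 2^s to 1. The point 1 is used because at
    X = 0 the relation J^2 = X would degenerate. Inverses of linear elements are taken for the basis
    because they have poles: at the point [lam] only one of the [e_g] has a pole, which makes the
    matrix of their conjugates invertible. *)

Section Injective.

Definition rinj (B : pzRingType) p q (H : 'M[B]_(p, q)) : Prop :=
  forall c : 'cV[B]_q, H *m c = 0 -> c = 0.

Definition minv (B : pzRingType) q (H : 'M[B]_q) : Prop :=
  exists H' : 'M[B]_q, H *m H' = 1%:M /\ H' *m H = 1%:M.

Lemma mulmx_lift (B : pzRingType) p q (H : 'M[B]_(p, q.+1)) (j0 : 'I_q.+1)
    (c : 'cV[B]_q.+1) i :
  (H *m c) i 0 = H i j0 * c j0 0 + \sum_j H i (lift j0 j) * c (lift j0 j) 0.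
Proof. by rewrite mxE (bigD1_ord j0). Qed.

Lemma minv_rinj (B : pzRingType) q (H : 'M[B]_q) : minv H -> rinj H.
Proof.
by case=> H' [_ H'H] c Hc; rewrite -[c]mul1mx -H'H -mulmxA Hc mulmx0.
Qed.

End Injective.

(* [e] plays the role of a place defined on the subring [S] of [P], and [i] of
   an embedding of [P] in a skew field: an invertible residue can be lifted. *)
Section Lifting.

Variables (P : nzRingType) (K F : unitRingType).
Hypotheses (KF : GRing.field_axiom K) (FF : GRing.field_axiom F).
Variables (S : {pred P}) (e : P -> K) (i : {rmorphism P -> F}).
Hypothesis subS : GRing.subring_closed S.
Hypothesis eB : {in S &, {morph e : x y / x - y}}.
Hypothesis eM : {in S &, {morph e : x y / x * y}}.
Hypothesis e_ore : {in S &, forall p h, e p != 0 ->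
  exists a b, [/\ a \in S, b \in S, a * h = b * p & e a != 0]}.
Hypothesis i_neq0 : {in S, forall p, e p != 0 -> i p != 0}.

(** Gaussian elimination without division. Injectivity of the residue matrix provides a pivot with
    nonzero residue, and the Ore relation [a * h = b * p] clears the rest of its column by row
    operations with coefficients in [S]. *)
Lemma rinj_lift p q (H : 'M[P]_(p, q)) :
  (forall j k, H j k \in S) -> rinj (map_mx e H) -> rinj (map_mx i H).
Proof.
elim: q p H => [|q IHq] p H HS eH c Hc; first by apply/matrixP => - [].
have [j0 ej0] : exists j0, e (H j0 0) != 0.
  apply/existsP; apply: contraT; rewrite negb_exists => /forallP e0.
  have: delta_mx 0 0 = 0 :> 'cV[K]_q.+1.
    apply: eH; apply/matrixP => j k; rewrite !mxE big_ord_recl !mxE /=.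
    have /eqP -> := negbNE (e0 j); rewrite mul0r add0r big1 // => l _.
    by rewrite !mxE /= mulr0.
  by move/matrixP/(_ 0 0)/eqP; rewrite !mxE !eqxx oner_eq0.
have /choice [ab abP] : forall j, exists ab : P * P,
    [/\ ab.1 \in S, ab.2 \in S, ab.1 * H j 0 = ab.2 * H j0 0 & e ab.1 != 0].
  move=> j; have [a [b [? ? ? ?]]] := e_ore (HS j0 0) (HS j 0) ej0.
  by exists (a, b).
pose H' := \matrix_(j, k) ((ab j).1 * H j (lift 0 k) - (ab j).2 * H j0 (lift 0 k)).
have [_ SB SM] := subS.
have H'S j k : H' j k \in S.
  by rewrite mxE; case: (abP j) => ? ? _ _; apply: SB; apply: SM.
have Kunit : forall x : K, x != 0 -> x \is a GRing.unit := KF.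
have eH' : rinj (map_mx e H').
  move=> d H'd.
  (* A kernel vector of the reduced matrix is completed to one of [H] by solving the pivot row for
     coordinate 0. *)
  pose t := \sum_k e (H j0 (lift 0 k)) * d k 0.
  pose d1 : 'cV_q.+1 :=
    \col_j oapp (fun k => d k 0) (- ((e (H j0 0))^-1 * t)) (unlift 0 j).
  have d1l k : d1 (lift 0 k) 0 = d k 0 by rewrite mxE liftK.
  suff d10 : d1 = 0.
    by apply/matrixP => k l; rewrite ord1 -d1l d10 !mxE.
  apply: eH; apply/matrixP => j l; rewrite ord1 (mulmx_lift _ 0) [RHS]mxE.
  have -> : d1 0 0 = - ((e (H j0 0))^-1 * t) by rewrite mxE unlift_none.
  have [a1S a2S ab_eq ea] := abP j.
  have eb : e (ab j).2 = e (ab j).1 * e (H j 0) * (e (H j0 0))^-1.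
    by rewrite -eM // ab_eq eM // mulrK // Kunit.
  move/matrixP: H'd => /(_ j 0); rewrite !mxE.
  under eq_bigr => k _.
    rewrite !mxE eB ?SM // !eM // mulrBl -!mulrA; over.
  rewrite sumrB -!mulr_sumr -/t eb -!mulrA -mulrBr => /(congr1 (fun z => (e (ab j).1)^-1 * z)).
  rewrite mulKr ?Kunit // mulr0 => Hz.
  rewrite mulrN addrC -[RHS]Hz; congr (_ - _).
  by apply: eq_bigr => k _; rewrite d1l !mxE.
have Funit : forall x : F, x != 0 -> x \is a GRing.unit := FF.
pose c' := \matrix_(k < q, l < 1) c (lift 0 k) 0.
have row j : i (H j 0) * c 0 0 + \sum_k i (H j (lift 0 k)) * c' k 0 = 0.
  have /matrixP/(_ j 0) := Hc; rewrite [in X in _ = X -> _]mxE (mulmx_lift _ 0) => Hcj.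
  rewrite -[RHS]Hcj mxE; congr (_ + _).
  by apply: eq_bigr => k _; rewrite !mxE.
have c'0 : c' = 0.
  apply: (IHq _ _ H'S eH'); apply/matrixP => j l; rewrite ord1 [LHS]mxE [RHS]mxE.
  have [a1S a2S ab_eq ea] := abP j.
  have := congr1 (fun z => i (ab j).1 * z) (row j).
  have := congr1 (fun z => i (ab j).2 * z) (row j0).
  rewrite !mulr0 !mulrDr !mulrA -!rmorphM ab_eq => h0 h1.
  have {h0 h1} : i (ab j).1 * (\sum_k i (H j (lift 0 k)) * c' k 0)
       - i (ab j).2 * (\sum_k i (H j0 (lift 0 k)) * c' k 0) = 0.
    by apply: (addrI (i ((ab j).2 * H j0 0) * c 0 0)); rewrite addrA h1 addr0 sub0r;
       apply/eqP; rewrite eqr_oppLR -addr_eq0 addrC h0.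
  move=> Hz; rewrite -[RHS]Hz !mulr_sumr -sumrB; apply: eq_bigr => k _.
  by rewrite !mxE rmorphB !rmorphM mulrBl !mulrA.
have c00 : c 0 0 = 0.
  have := row j0; rewrite big1 => [|k _]; last by rewrite c'0 mxE mulr0.
  rewrite addr0 => /(congr1 (fun z => (i (H j0 0))^-1 * z)).
  by rewrite mulr0 mulKr // Funit // i_neq0.
apply/matrixP => k l; rewrite ord1 mxE.
case: (unliftP 0 k) => [k' ->|-> //].
by have /matrixP/(_ k' 0) := c'0; rewrite !mxE.
Qed.

End Lifting.

Section SkewLinearAlgebra.

Variables (K : unitRingType) (KF : GRing.field_axiom K).

Lemma skew_mulVr (x : K) : x != 0 -> x^-1 * x = 1.
Proof. by move=> x0; rewrite mulVr //; apply: KF. Qed.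

Lemma skew_mulrV (x : K) : x != 0 -> x * x^-1 = 1.
Proof. by move=> x0; rewrite mulrV //; apply: KF. Qed.

Lemma skew_mulf_eq0 (x y : K) : x * y = 0 -> x = 0 \/ y = 0.
Proof.
case: (eqVneq x 0) => [->|x0 xy]; first by left.
by right; rewrite -[y]mul1r -(skew_mulVr x0) -mulrA xy mulr0.
Qed.

Lemma wide_kernel p q (H : 'M[K]_(p, q)) : (p < q)%N ->
  exists2 c : 'cV[K]_q, c != 0 & H *m c = 0.
Proof.
elim: p q H => [|p IHp] [//|q] H ltpq.
  exists (const_mx 1); last by apply/matrixP => - [].
  apply/eqP => /matrixP/(_ 0 0)/eqP; rewrite !mxE; exact/negP/oner_neq0.
have [/existsP[j0 Hj0]|] := boolP [exists j, H 0 j != 0]; last first.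
  rewrite negb_exists => /forallP H0.
  have [|c c0 Hc] := IHp q.+1 (\matrix_(i, j) H (lift 0 i) j); first exact: ltnW.
  exists c => //; apply/matrixP => i j; rewrite [RHS]mxE ord1.
  case: (unliftP 0 i) => [i' ->|->].
    have /matrixP/(_ i' 0) := Hc; rewrite !mxE => Hi'; rewrite -[RHS]Hi'.
    by apply: eq_bigr => k _; rewrite mxE.
  by rewrite mxE big1 // => k _; have /negbNE/eqP -> := H0 k; rewrite mul0r.
pose H' := \matrix_(i, j) (H (lift 0 i) (lift j0 j)
                  - H (lift 0 i) j0 * (H 0 j0)^-1 * H 0 (lift j0 j)).
have [c' c'0 Hc'] := IHp q H' ltpq.
pose t := \sum_j H 0 (lift j0 j) * c' j 0.
pose c : 'cV_q.+1 := \col_j oapp (fun k => c' k 0) (- ((H 0 j0)^-1 * t)) (unlift j0 j).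
have cl k : c (lift j0 k) 0 = c' k 0 by rewrite mxE liftK.
exists c.
  apply: contra c'0 => /eqP c0; apply/eqP/matrixP => k l.
  by rewrite ord1 -cl c0 !mxE.
apply/matrixP => i l; rewrite ord1 (mulmx_lift _ j0) [RHS]mxE.
have -> : c j0 0 = - ((H 0 j0)^-1 * t) by rewrite mxE unlift_none.
case: (unliftP 0 i) => [i' ->|->]; last first.
  rewrite mulrN mulrA skew_mulrV // mul1r addrC; apply/eqP; rewrite subr_eq0.
  by apply/eqP; apply: eq_bigr => k _; rewrite cl.
have /matrixP/(_ i' 0) := Hc'; rewrite [RHS]mxE mxE.
under eq_bigr => k _ do rewrite mxE mulrBl -!mulrA.
rewrite sumrB -!mulr_sumr -/t => Hi'; rewrite -[RHS]Hi' mulrN addrC.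
by congr (_ - _); apply: eq_bigr => k _; rewrite cl.
Qed.

(** A kernel vector of the wide matrix [row_mx H (delta_mx j 0)] has a nonzero last coordinate,
    hence solves [H *m c = delta_mx j 0]. The right inverse obtained in this way is two-sided
    because [H] can be cancelled on the left. *)
Lemma rinj_minv q (H : 'M[K]_q) : rinj H -> minv H.
Proof.
move=> injH.
have /choice [f fP] : forall j : 'I_q, exists c : 'cV[K]_q, H *m c = delta_mx j 0.
  move=> j; have [|d d0] := @wide_kernel q (q + 1) (row_mx H (delta_mx j 0)).
    by rewrite addn1.
  rewrite -[d]vsubmxK mul_row_col => Hd.
  set u := usubmx d in Hd; set v := dsubmx d in Hd.
  have v0 : v 0 0 != 0.
    apply: contra d0 => /eqP v00; have v0 : v = 0.
      by apply/matrixP => a b; rewrite !ord1 v00 mxE.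
    rewrite v0 mulmx0 addr0 in Hd.
    by rewrite -[d]vsubmxK -/u -/v v0 (injH _ Hd) col_mx0.
  clearbody u v; exists (u *m (- (v 0 0)^-1)%:M); rewrite mulmxA.
  move/eqP: Hd; rewrite addr_eq0 => /eqP ->.
  apply/matrixP => a b; rewrite !mxE big_ord1 !mxE big_ord1 !ord1 eqxx mulr1n.
  by rewrite mulNr mulrN opprK -mulrA skew_mulrV // mulr1 mxE.
pose H' := \matrix_(i, j) f j i 0.
have HH' : H *m H' = 1%:M.
  apply/matrixP => i j; have /matrixP/(_ i 0) := fP j.
  rewrite !mxE eqxx andbT => <-.
  by apply: eq_bigr => k _; rewrite mxE.
exists H'; split=> //; apply/eqP; rewrite -subr_eq0; apply/eqP.
apply/matrixP => i j; rewrite mxE.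
have : col j (H' *m H - 1%:M) = 0.
  by apply: injH; rewrite colE mulmxA mulmxBr mulmxA HH' mul1mx mulmx1 subrr mul0mx.
by move/matrixP/(_ i 0); rewrite mxE [RHS]mxE mxE => ->; rewrite mxE.
Qed.

(** A dichotomy on the nullity that avoids defining a rank. If [c] is in the kernel and
    [c i 0 != 0], adjoining the row [delta_mx 0 i] lowers the nullity by one, and [c] is independent
    of the kernel that remains. *)
Lemma rinj_col_basis p q (H : 'M[K]_(p, q)) m :
  (exists2 U : 'M[K]_(q, 1 + m), rinj U & H *m U = 0) \/
  (exists B : 'M[K]_(m, q), rinj (col_mx H B)).
Proof.
elim: m p H => [|m IHm] p H.
  have [injH|] := pselect (rinj H).
    right; exists 0 => c; rewrite mul_col_mx => /eqP.
    by rewrite col_mx_eq0 => /andP[/eqP /injH].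
  move=> /existsNP[c /not_implyP [Hc /eqP c0]]; left; exists c => // d cd.
  have [i ci] : exists i, c i 0 != 0.
    apply/existsP; apply: contraT; rewrite negb_exists => /forallP c0'.
    case/eqP: c0; apply/matrixP => i j; rewrite ord1 mxE.
    by apply/eqP/negbNE/c0'.
  apply/matrixP => i' j'; rewrite !ord1 mxE.
  have /matrixP/(_ i 0) := cd; rewrite !mxE big_ord1 => /skew_mulf_eq0[] // ci0.
  by rewrite ci0 eqxx in ci.
have [injH|] := pselect (rinj H).
  right; exists 0 => c; rewrite mul_col_mx => /eqP.
  by rewrite col_mx_eq0 => /andP[/eqP /injH].
move=> /existsNP[c /not_implyP [Hc /eqP c0]].
have [i ci] : exists i, c i 0 != 0.
  apply/existsP; apply: contraT; rewrite negb_exists => /forallP c0'.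
  case/eqP: c0; apply/matrixP => i j; rewrite ord1 mxE.
  by apply/eqP/negbNE/c0'.
have [[U injU HU]|[B injB]] := IHm _ (col_mx H (delta_mx 0 i : 'rV_q)).
  left; exists (row_mx c U : 'M_(q, 1 + (1 + m))); last first.
    move/eqP: HU; rewrite mul_col_mx col_mx_eq0 => /andP[/eqP HU _].
    by rewrite (mul_mx_row H c U) Hc HU row_mx0.
  move/eqP: HU; rewrite mul_col_mx col_mx_eq0 => /andP[_ /eqP iU].
  move=> d; rewrite -[d]vsubmxK mul_row_col.
  set d1 := usubmx _; set d2 := dsubmx _ => dU.
  have d10 : d1 = 0.
    have := congr1 (fun z => (delta_mx 0 i : 'rV_q) *m z) dU.
    rewrite mulmxDr mulmxA [X in _ + X]mulmxA iU mul0mx addr0 mulmx0 -rowE.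
    move/matrixP/(_ 0 0); rewrite !mxE big_ord1 mxE => /skew_mulf_eq0[] ci0.
      by rewrite ci0 eqxx in ci.
    by apply/matrixP => a b; rewrite !ord1 ci0 mxE.
  rewrite d10 mulmx0 add0r in dU.
  by rewrite d10 (injU _ dU) col_mx0.
right; exists (col_mx (delta_mx 0 i : 'rV_q) B : 'M_(1 + m, q)) => d.
rewrite mul_col_mx => /eqP; rewrite col_mx_eq0 => /andP[/eqP h1].
move=> /eqP/(etrans (esym (mul_col_mx (delta_mx 0 i : 'rV_q) B d)))/eqP.
rewrite col_mx_eq0 => /andP[/eqP h2 /eqP h3].
by apply: injB; rewrite !mul_col_mx h1 h2 h3 !col_mx0.
Qed.

End SkewLinearAlgebra.

(** Over a noncommutative ring, transposition reverses products only when passing to the opposite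
    ring [K^c]. *)
Lemma wide_cokernel (K : unitRingType) p q (H : 'M[K]_(q, p)) :
  GRing.field_axiom K -> (p < q)%N ->
  exists2 c : 'rV[K]_q, c != 0 & c *m H = 0.
Proof.
move=> KF ltpq.
have [|//|c c0 Hc] := @wide_kernel K^c _ p q (H^T : 'M[K^c]_(p, q)); first exact: KF.
exists (c^T : 'M[K]_(1, q)).
  by apply: contra c0 => /eqP c0; rewrite -[c]trmxK c0 trmx0.
apply: (can_inj (@trmxK _ _ _)); rewrite trmx0.
by rewrite trmx_mul_rev trmxK.
Qed.

(** * Specialization of polynomials over a skew field at the central point 1 *)

Section PolySpecialization.

Variables (K F : unitRingType).
Hypotheses (KF : GRing.field_axiom K) (FF : GRing.field_axiom F).

Lemma comm_poly1 (p : {poly K}) : comm_poly p 1.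
Proof. by rewrite /comm_poly mulr1 mul1r. Qed.

Lemma poly_ore (p h : {poly K}) : p.[1] != 0 ->
  exists a b : {poly K}, a * h = b * p /\ a.[1] != 0.
Proof.
move=> p1; have p0 : p != 0 by apply: contra p1 => /eqP ->; rewrite horner0.
have polyF (f g : {poly K}) : f * g = 0 -> g != 0 -> f = 0.
  move=> fg g0; apply/eqP; rewrite -lead_coef_eq0; apply/negPn/negP => lf.
  move/eqP: fg; rewrite -lead_coef_eq0; have := lf; rewrite lead_coef_eq0 => f0.
  have := g0; rewrite -lead_coef_eq0 => lg.
  by rewrite lead_coef_proper_mul ?lead_coef_eq0;
    [case/eqP/(skew_mulf_eq0 KF) => /eqP; apply/negP
    |apply/eqP => /(skew_mulf_eq0 KF)[] /eqP; apply/negP].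
pose N := (size p + size h)%N.
(* There are [N + N] unknown coefficients in [a] and [b], while [a * h] and [b * p] have size at
   most [N + N.-1]: the linear system has a nonzero solution. *)
pose H : 'M[K]_(N + N, N + N.-1) := \matrix_(i < N + N, j < N + N.-1)
  match fintype.split i with inl i' => ('X^i' * h)`_j | inr i' => (- ('X^i' * p))`_j end.
have N0 : (0 < N)%N by rewrite addn_gt0 size_poly_gt0 p0.
have [c c0 cH] : exists2 c : 'rV[K]_(N + N), c != 0 & c *m H = 0.
  by apply: wide_cokernel => //; rewrite ltn_add2l prednK.
pose a := \sum_(i < N) (lsubmx c 0 i)%:P * 'X^i.
pose b := \sum_(i < N) (rsubmx c 0 i)%:P * 'X^i.
have coefa (u : 'rV[K]_N) (i : 'I_N) : (\sum_(i < N) (u 0 i)%:P * 'X^i)`_i = u 0 i.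
  rewrite coef_sum (bigD1 i) //= coefCM coefXn eqxx mulr1 big1 ?addr0 // => k ki.
  by rewrite coefCM coefXn eq_sym (inj_eq val_inj) (negPf ki) mulr0.
have sizeu (u : 'rV[K]_N) : (size (\sum_(i < N) (u 0 i)%:P * 'X^i)%R <= N)%N.
  apply: (leq_trans (size_sum _ _ _)); apply/bigmax_leqP => i _.
  by rewrite (leq_trans (size_polyMleq _ _)) // size_polyXn addnS /=
    (leq_trans (leq_add (size_polyC_leq1 _) (leqnn _))).
have N1 : (N + N.-1)%N = (N + N).-1 by case: (N) N0 => // N' _; rewrite addnS.
have ab : a * h = b * p.
  apply/polyP => k.
  have [kN|Nk] := ltnP k (N + N.-1); last first.
    rewrite !nth_default // (leq_trans (size_polyMleq _ _)) // (leq_trans _ Nk) //.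
      by rewrite N1 -!subn1 leq_sub2r // leq_add ?leq_addr ?sizeu // leq_addl.
    by rewrite N1 -!subn1 leq_sub2r // leq_add ?leq_addr ?sizeu // leq_addl.
  have /matrixP/(_ 0 (Ordinal kN)) := cH; rewrite !mxE big_split_ord /= => cHk.
  apply/eqP; rewrite -subr_eq0 -[X in _ == X]cHk; apply/eqP.
  rewrite /a /b !mulr_suml !coef_sum -sumrN; congr (_ + _); apply: eq_bigr => i _.
    rewrite -mulrA coefCM mxE; congr (_ * _).
    by rewrite mxE; case: fintype.splitP => j /= ij; [rewrite ij|
      have := ltn_ord i; rewrite ij ltnNge leq_addr].
  rewrite -mulrA coefCM mxE -mulrN -coefN; congr (_ * _).
  rewrite mxE; case: fintype.splitP => j /= ij; last by have -> : j = i by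
      apply: val_inj; move/eqP: ij; rewrite eqn_add2l => /eqP.
  by have := ltn_ord j; rewrite -ij ltnNge leq_addr.
have a0 : a != 0.
  apply: contra c0 => /eqP a0.
  have b0 : b = 0 by apply: (polyF b p) => //; rewrite -ab a0 mul0r.
  rewrite -[c]hsubmxK; apply/eqP/matrixP => i j; rewrite ord1 [RHS]mxE mxE.
  case: fintype.splitP => k _; first by rewrite -(coefa (lsubmx c)) -/a a0 coef0.
  by rewrite -(coefa (rsubmx c)) -/b b0 coef0.
move: {c c0 cH H coefa sizeu} a b ab a0 => a b.
(* As [p.[1] != 0], a zero of [a] at 1 is also one of [b], and the central factor ['X - 1%:P] can be
   cancelled from both. The size of [a] decreases. *)
have [n] := ubnP (size a); elim: n a b => // n IHn a b sa ab a0.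
have [a1|a1] := eqVneq a.[1] 0; last by exists a, b.
have b1 : b.[1] = 0.
  have := congr1 (fun f => f.[1]) ab.
  rewrite /= (hornerM_comm _ (comm_poly1 _)) (hornerM_comm _ (comm_poly1 _)) a1 mul0r.
  move/esym/(skew_mulf_eq0 KF) => [] // p10; by rewrite p10 eqxx in p1.
have /factor_theorem [a' a'E] : root a 1 by apply/eqP.
have /factor_theorem [b' b'E] : root b 1 by apply/eqP.
have comX (f : {poly K}) : ('X - 1%:P) * f = f * ('X - 1%:P).
  by rewrite mulrBl mulrBr mul1r mulr1 commr_polyX.
have a'0 : a' != 0 by apply: contra a0 => /eqP a'0; rewrite a'E a'0 mul0r.
apply: (IHn a' b') => //.
  rewrite -ltnS (leq_trans _ sa) // a'E size_Mmonic ?monicXsubC //.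
  by rewrite size_XsubC addn2.
apply/eqP; rewrite -subr_eq0; apply/eqP/(polyF _ ('X - 1%:P)).
  by rewrite mulrBl -mulrA -comX mulrA -a'E ab b'E -mulrA comX !mulrA subrr.
by rewrite polyXsubC_eq0.
Qed.

Lemma rinj_poly (i : {rmorphism {poly K} -> F}) p q (H : 'M[{poly K}]_(p, q)) :
  (forall f, f != 0 -> i f != 0) ->
  rinj (map_mx (fun f : {poly K} => f.[1]) H) -> rinj (map_mx i H).
Proof.
move=> inj_i; apply: (@rinj_lift _ _ _ KF FF predT).
- by split.
- by move=> x y _ _; rewrite hornerD hornerN.
- by move=> x y _ _; rewrite hornerM_comm //; apply: comm_poly1.
- by move=> f h _ _ f1; have [a [b [ab a1]]] := poly_ore h f1; exists a, b.
- by move=> f _ f1; apply: inj_i; apply: contra f1 => /eqP ->; rewrite horner0.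
- by [].
Qed.

(* At most [q - rank H(1)] columns can be killed generically, by semicontinuity
   of the rank; [F] is a field of fractions of [{poly K}]. *)
Lemma poly_kernel_special (i : {rmorphism {poly K} -> F}) p q m
    (H : 'M[{poly K}]_(p, q)) (U : 'M[F]_(q, m)) :
  (forall f, f != 0 -> i f != 0) -> rinj U -> map_mx i H *m U = 0 ->
  exists2 U' : 'M[K]_(q, m), rinj U' &
    map_mx (fun f : {poly K} => f.[1]) H *m U' = 0.
Proof.
move=> inj_i; case: m U => [|m] U injU HU.
  exists 0; first by move=> c _; apply/matrixP => - [].
  by apply/matrixP => ? [].
have [//|[B injB]] := rinj_col_basis KF (map_mx (fun f : {poly K} => f.[1]) H) m.
have injB' : rinj (map_mx i (col_mx H (map_mx polyC B))).
  apply: rinj_poly => //; rewrite map_col_mx -map_mx_comp.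
  rewrite (_ : map_mx _ B = B) //; apply/matrixP => j k.
  by rewrite mxE /= hornerC.
(* [U] has one column more than [B] has rows, so a nonzero combination of its columns is killed by
   [B] as well as by [H]. *)
have [//|c c0 Bc] := @wide_kernel F FF _ _ (map_mx i (map_mx polyC B) *m U).
case/eqP: c0; apply: injU; apply: injB'.
by rewrite map_col_mx mul_col_mx !mulmxA HU mul0mx Bc col_mx0.
Qed.

End PolySpecialization.

(** * Laurent series *)

Section ClassicalInverse.

Variable B : nzRingType.

(** Laurent series and quaternions need a [unitRingType] structure before they are known to be skew
    fields; units and inverses are therefore chosen classically in an arbitrary ring. *)
Definition cunit : pred B := fun x => `[< exists y, y * x = 1 /\ x * y = 1 >].

Lemma cunitP x : reflect (exists y, y * x = 1 /\ x * y = 1) (x \in cunit).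
Proof. exact: asboolP. Qed.

Definition cinverse (x : B) : B :=
  if pselect (exists y, y * x = 1 /\ x * y = 1) is left ex then projT1 (cid ex) else x.

Fact cinverse_l : {in cunit, left_inverse 1 cinverse *%R}.
Proof.
move=> x /asboolP ex; rewrite /cinverse; case: pselect => // ex'.
by case: (cid ex') => y [].
Qed.
Fact cinverse_r : {in cunit, right_inverse 1 cinverse *%R}.
Proof.
move=> x /asboolP ex; rewrite /cinverse; case: pselect => // ex'.
by case: (cid ex') => y [].
Qed.
Fact cunit_subproof (x y : B) : y * x = 1 /\ x * y = 1 -> cunit x.
Proof. by move=> xy; apply/asboolP; exists y. Qed.
Fact cinverse_out : {in [predC cunit], cinverse =1 id}.
Proof.
by move=> x /asboolPn Nex; rewrite /cinverse; case: pselect.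
Qed.

End ClassicalInverse.

Section CauchyProduct.

Variable K : nzRingType.
Implicit Types u v w : nat -> K.

Definition cauchy u v (k : nat) : K := \sum_(i < k.+1) u i * v (k - i)%N.

Lemma cauchy_poly u v N k : (k < N)%N ->
  cauchy u v k = (\poly_(i < N) u i * \poly_(i < N) v i)`_k.
Proof.
move=> kN; rewrite coefM; apply: eq_bigr => i _; rewrite !coef_poly.
have := ltn_ord i; rewrite ltnS => ik.
by rewrite (leq_ltn_trans ik kN) (leq_ltn_trans (leq_subr _ _) kN).
Qed.

(** Coefficient [k] depends only on the truncations at [k], so associativity is inherited from
    polynomials. *)
Lemma cauchyA u v w k : cauchy u (cauchy v w) k = cauchy (cauchy u v) w k.
Proof.
pose P f : {poly K} := \poly_(i < k.+1) f i.
have coefP f i : (i <= k)%N -> (P f)`_i = f i by rewrite coef_poly ltnS => ->.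
transitivity ((P u * (P v * P w))`_k).
  rewrite coefM; apply: eq_bigr => i _; rewrite coefP -1?ltnS //.
  by rewrite (@cauchy_poly _ _ k.+1) // ltnS leq_subr.
rewrite mulrA coefM; apply: eq_bigr => i _.
by rewrite (@coefP w) ?leq_subr // (@cauchy_poly _ _ k.+1).
Qed.

End CauchyProduct.

Section LaurentRing.

Variable K : nzRingType.

Definition below (f : int -> K) (n : nat) := forall i : int, i < - n%:Z -> f i = 0.

Record laurent := Laurent {
  lcoef : int -> K;
  lcoef_below : exists n, below lcoef n
}.

HB.instance Definition _ := gen_eqMixin laurent.
HB.instance Definition _ := gen_choiceMixin laurent.

Lemma laurentP (f g : laurent) : lcoef f =1 lcoef g -> f = g.
Proof.
case: f g => f f0 [g g0] /= /funext fg; subst g.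
by congr Laurent; apply: Prop_irrelevance.
Qed.

Lemma below_leq f n m : below f n -> (n <= m)%N -> below f m.
Proof. by move=> fn nm i im; apply: fn; lia. Qed.

(** Multiplication by [t^n], which turns a series bounded below by [- n] into a power series;
    identities on Laurent products are reduced to Cauchy products through it. *)
Definition digits (f : int -> K) (n : nat) (i : nat) : K := f (i%:Z - n%:Z).

Lemma eq_digits (f g : laurent) n : below (lcoef f) n -> below (lcoef g) n ->
  digits (lcoef f) n =1 digits (lcoef g) n -> f = g.
Proof.
move=> fn gn fg; apply: laurentP => i.
have [|ni] := ltP i (- n%:Z); first by move=> h; rewrite fn ?gn.
have [j ->] : exists j : nat, i = j%:Z - n%:Z by exists (absz (i + n%:Z)); lia.
exact: fg.
Qed.

Definition conv (f g : int -> K) (k : int) : K :=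
  \sum_(i \in [set: int]) f i * g (k - i).

Lemma conv_below f g n m : below f n -> below g m -> below (conv f g) (n + m).
Proof.
move=> fn gm k kl; apply: fsbig1 => i _.
have [|ni] := ltP i (- n%:Z); first by move=> /fn ->; rewrite mul0r.
by rewrite gm ?mulr0 //; lia.
Qed.

Lemma conv_digits f g n m : below f n -> below g m ->
  digits (conv f g) (n + m) =1 cauchy (digits f n) (digits g m).
Proof.
move=> fn gm k; rewrite /digits /conv /cauchy.
rewrite (@fsbigE _ _ _ _ _ [seq i%:Z - n%:Z | i <- iota 0 k.+1]) //.
- rewrite -(big_mkord xpredT (fun i => f (i%:Z - n%:Z) * g ((k - i)%N%:Z - m%:Z))).
  rewrite /index_iota subn0 big_map big_seq_cond [RHS]big_seq.
  apply: eq_big => i; first by rewrite classical_sets.in_setT andbT.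
  by rewrite mem_iota => /andP[/andP[_ ik] _]; congr (_ * g _); lia.
- by rewrite map_inj_uniq ?iota_uniq // => i j; lia.
move=> i _ /mapP iN; have [|ni] := ltP i (- n%:Z); first by move=> /fn ->; rewrite mul0r.
rewrite gm ?mulr0 //; rewrite ltNge; apply/negP => ik; case: iN.
by exists (absz (i + n%:Z)); rewrite ?mem_iota; lia.
Qed.

Fact lzero_below : exists n, below (fun=> 0) n.
Proof. by exists 0%N. Qed.
Fact lone_below : exists n, below (fun i => (i == 0)%:R) n.
Proof. by exists 0%N => i i0; case: eqP => // i1; lia. Qed.
Fact lopp_below (f : laurent) : exists n, below (fun i => - lcoef f i) n.
Proof. by have [n fn] := lcoef_below f; exists n => i /fn ->; rewrite oppr0. Qed.
Fact ladd_below (f g : laurent) : exists n, below (fun i => lcoef f i + lcoef g i) n.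
Proof.
have [n fn] := lcoef_below f; have [m gm] := lcoef_below g.
exists (n + m)%N => i iL; rewrite fn ?gm ?addr0 //; lia.
Qed.
Fact lmul_below (f g : laurent) : exists n, below (conv (lcoef f) (lcoef g)) n.
Proof.
have [n fn] := lcoef_below f; have [m gm] := lcoef_below g.
by exists (n + m)%N; apply: conv_below.
Qed.

Definition lzero := Laurent lzero_below.
Definition lone := Laurent lone_below.
Definition lopp f := Laurent (lopp_below f).
Definition ladd f g := Laurent (ladd_below f g).
Definition lmul f g := Laurent (lmul_below f g).

Fact laddA : associative ladd.
Proof. by move=> f g h; apply: laurentP => i /=; rewrite addrA. Qed.
Fact laddC : commutative ladd.
Proof. by move=> f g; apply: laurentP => i /=; rewrite addrC. Qed.
Fact ladd0 : left_id lzero ladd.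
Proof. by move=> f; apply: laurentP => i /=; rewrite add0r. Qed.
Fact laddN : left_inverse lzero lopp ladd.
Proof. by move=> f; apply: laurentP => i /=; rewrite addNr. Qed.

HB.instance Definition _ := GRing.isZmodule.Build laurent laddA laddC ladd0 laddN.

Fact lmulA : associative lmul.
Proof.
move=> f g h; have [n fn] := lcoef_below f.
have [m gm] := lcoef_below g; have [l hl] := lcoef_below h.
have fgh : below (lcoef (lmul (lmul f g) h)) (n + (m + l)).
  by rewrite addnA; apply: conv_below => //; apply: conv_below.
apply: (eq_digits _ fgh) => [|k].
  by apply: conv_below => //; apply: conv_below.
rewrite conv_digits // ?[in RHS]addnA ?conv_digits //; try exact: conv_below.
rewrite -[RHS](_ : cauchy (cauchy (digits (lcoef f) n) (digits (lcoef g) m))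
   (digits (lcoef h) l) k = _); last first.
  by apply: eq_bigr => i _; rewrite conv_digits.
rewrite -cauchyA; apply: eq_bigr => i _; by rewrite conv_digits.
Qed.

Fact lmul1 : left_id lone lmul.
Proof.
move=> f; apply: laurentP => k /=; rewrite /conv.
rewrite (@fsbigE _ _ _ _ _ [:: 0]) //; last first.
  by move=> i _; rewrite inE => /negPf ->; rewrite mul0r.
by rewrite big_cons big_nil classical_sets.in_setT /= ?eqxx /= mul1r subr0 addr0.
Qed.

Fact lmulr1 : right_id lone lmul.
Proof.
move=> f; apply: laurentP => k /=; rewrite /conv.
rewrite (@fsbigE _ _ _ _ _ [:: k]) //; last first.
  move=> i _; rewrite inE => ik; rewrite subr_eq0 eq_sym (negPf ik) mulr0 //.
by rewrite big_cons big_nil classical_sets.in_setT /= subrr ?eqxx /= mulr1 addr0.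
Qed.

Fact lmulDl : left_distributive lmul ladd.
Proof.
move=> f g h; have [n fn] := lcoef_below f.
have [m gm] := lcoef_below g; have [l hl] := lcoef_below h.
have {}fn := below_leq fn (leq_addr m n).
have {}gm := below_leq gm (leq_addl n m).
have fgn : below (lcoef (ladd f g)) (n + m).
  by move=> i im /=; rewrite fn ?gm ?addr0.
have fh := conv_below fn hl; have gh := conv_below gm hl.
apply: (@eq_digits _ _ (n + m + l)) => [||k]; first exact: conv_below.
  by move=> i im /=; rewrite fh ?gh ?addr0.
rewrite conv_digits //= [RHS](_ : _ = digits (conv (lcoef f) (lcoef h)) (n + m + l) k
  + digits (conv (lcoef g) (lcoef h)) (n + m + l) k) //.
rewrite !conv_digits // /cauchy -big_split; apply: eq_bigr => i _.
by rewrite /digits /= mulrDl.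
Qed.

Fact lmulDr : right_distributive lmul ladd.
Proof.
move=> f g h; have [n fn] := lcoef_below f.
have [m gm] := lcoef_below g; have [l hl] := lcoef_below h.
have {}gm := below_leq gm (leq_addr l m).
have {}hl := below_leq hl (leq_addl m l).
have ghm : below (lcoef (ladd g h)) (m + l).
  by move=> i im /=; rewrite gm ?hl ?addr0.
have fg := conv_below fn gm; have fh := conv_below fn hl.
apply: (@eq_digits _ _ (n + (m + l))) => [||k]; first exact: conv_below.
  by move=> i im /=; rewrite fg ?fh ?addr0.
rewrite conv_digits //= [RHS](_ : _ = digits (conv (lcoef f) (lcoef g)) (n + (m + l)) k
  + digits (conv (lcoef f) (lcoef h)) (n + (m + l)) k) //.
rewrite !conv_digits // /cauchy -big_split; apply: eq_bigr => i _.
by rewrite /digits /= mulrDr.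
Qed.

Fact lone_neq0 : lone != lzero.
Proof.
apply/eqP => /(congr1 (fun f => lcoef f 0)) /= /eqP; exact/negP/oner_neq0.
Qed.

HB.instance Definition _ := GRing.Zmodule_isNzRing.Build laurent
  lmulA lmul1 lmulr1 lmulDl lmulDr lone_neq0.

Lemma lcoef1 i : lcoef 1 i = (i == 0)%:R. Proof. by []. Qed.
Lemma lcoefN f i : lcoef (- f) i = - lcoef f i. Proof. by []. Qed.
Lemma lcoefM f g : lcoef (f * g) = conv (lcoef f) (lcoef g). Proof. by []. Qed.

Fact lmono_below (c : K) (n : int) : exists m, below (fun i => c *+ (i == n)) m.
Proof.
exists (absz n) => i iN; rewrite (_ : i == n = false) ?mulr0n //; apply/eqP; lia.
Qed.
(* [c t^n] *)
Definition lmono c n := Laurent (lmono_below c n).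

Lemma lcoef_mono c n i : lcoef (lmono c n) i = c *+ (i == n). Proof. by []. Qed.

Lemma lcoef_monoM c n f k : lcoef (lmono c n * f) k = c * lcoef f (k - n).
Proof.
rewrite lcoefM /conv (@fsbigE _ _ _ _ _ [:: n]) //; last first.
  by move=> i _; rewrite inE lcoef_mono => /negPf ->; rewrite mulr0n mul0r.
by rewrite big_cons big_nil classical_sets.in_setT /= ?lcoef_mono ?eqxx /= addr0.
Qed.

Lemma lcoef_Mmono c n f k : lcoef (f * lmono c n) k = lcoef f (k - n) * c.
Proof.
rewrite lcoefM /conv (@fsbigE _ _ _ _ _ [:: k - n]) //; last first.
  move=> i _; rewrite inE lcoef_mono => ik; rewrite (_ : k - i == n = false) ?mulr0n ?mulr0 //.
  by apply: contraNF ik => /eqP <-; rewrite opprB addrCA subrr addr0.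
by rewrite big_cons big_nil classical_sets.in_setT /= addr0 opprB addrCA subrr addr0 eqxx.
Qed.

Lemma laurent_order (f : laurent) : f != 0 ->
  exists2 n : int, lcoef f n != 0 & forall i, i < n -> lcoef f i = 0.
Proof.
move=> f0; have [m fm] := lcoef_below f.
have [j fj] : exists j, lcoef f (j%:Z - m%:Z) != 0.
  apply: contrapT => /forallNP fj; case/eqP: f0; apply: (eq_digits fm) => // j.
  by apply/eqP/negPn/negP; apply: fj.
case: (ex_minnP (ex_intro (fun j : nat => lcoef f (j%:Z - m%:Z) != 0) j fj)) => k fk mink.
exists (k%:Z - m%:Z) => // i ik.
have [|mi] := ltP i (- m%:Z); first exact: fm.
apply/eqP/negPn/negP => fi; have := mink (absz (i + m%:Z)).
have -> : (absz (i + m%:Z))%:Z - m%:Z = i by lia.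
by move=> /(_ fi); lia.
Qed.

Lemma lcoefM_order (f g : laurent) n m :
  (forall i, i < n -> lcoef f i = 0) -> (forall i, i < m -> lcoef g i = 0) ->
  lcoef (f * g) (n + m) = lcoef f n * lcoef g m /\
  forall i, i < n + m -> lcoef (f * g) i = 0.
Proof.
move=> fn gm; split=> [|k kl]; rewrite lcoefM /conv.
  rewrite (@fsbigE _ _ _ _ _ [:: n]) //; last first.
    move=> i _; rewrite inE => iNn; case: (ltP i n) => [/fn ->|ni].
      by rewrite mul0r.
    by rewrite gm ?mulr0 //; move/eqP: iNn; lia.
  by rewrite big_cons big_nil classical_sets.in_setT /= addr0 addrAC subrr add0r.
apply: fsbig1 => i _; case: (ltP i n) => [/fn ->|ni]; first by rewrite mul0r.
by rewrite gm ?mulr0 //; lia.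
Qed.

End LaurentRing.

HB.instance Definition _ (K : nzRingType) :=
  GRing.NzRing_hasMulInverse.Build (laurent K) (@cinverse_l (laurent K))
    (@cinverse_r _) (@cunit_subproof _) (@cinverse_out _).

Section LaurentField.

Variables (K : unitRingType) (KF : GRing.field_axiom K).

(* Coefficients of the right inverse of a power series with constant term 1. *)
Fixpoint cinv_seq (u : nat -> K) (k : nat) : seq K :=
  if k is k'.+1 then
    let s := cinv_seq u k' in
    rcons s (- \sum_(i < k'.+1) u i.+1 * nth 0 s (k' - i)%N)
  else [:: 1].

Definition cinv u k := nth 0 (cinv_seq u k) k.

Lemma size_cinv_seq u k : size (cinv_seq u k) = k.+1.
Proof. by elim: k => //= k IHk; rewrite size_rcons IHk. Qed.

Lemma nth_cinv_seq u k i : (i <= k)%N -> nth 0 (cinv_seq u k) i = cinv u i.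
Proof.
elim: k => [|k IHk]; first by rewrite leqn0 => /eqP ->.
rewrite leq_eqVlt => /orP[/eqP -> //|]; rewrite ltnS => ik.
by rewrite /= nth_rcons size_cinv_seq ltnS ik IHk.
Qed.

Lemma cauchy_cinv u k : u 0%N = 1 -> cauchy u (cinv u) k = (k == 0%N)%:R.
Proof.
move=> u0; case: k => [|k]; first by rewrite /cauchy big_ord1 u0 mul1r.
rewrite /cauchy big_ord_recl u0 mul1r subn0 {1}/cinv /= nth_rcons size_cinv_seq.
rewrite ltnn eqxx addrC; apply/eqP; rewrite subr_eq0; apply/eqP.
apply: eq_bigr => i _; rewrite nth_cinv_seq ?leq_subr //.
Qed.

Lemma laurent_rinv (f : laurent K) : f != 0 -> exists g, f * g = 1.
Proof.
move=> /laurent_order[n fn f_lt].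
(* Right multiplication by this monomial brings the leading term to 1, the case in which [cinv]
   gives a right inverse. *)
have [g0] : exists g, (f * lmono (lcoef f n)^-1 (- n)) * g = 1.
  set h := f * _.
  have hE i : lcoef h i = lcoef f (i + n) * (lcoef f n)^-1.
    by rewrite lcoef_Mmono opprK.
  have h0 : below (lcoef h) 0 by move=> i i0; rewrite hE f_lt ?mul0r //; lia.
  have gP : exists m,
      below (fun i : int => if i is Posz j then cinv (digits (lcoef h) 0) j else 0) m.
    by exists 0%N => -[].
  exists (Laurent gP); apply: (@eq_digits _ _ _ (0 + 0)).
  - apply: conv_below => //; by move=> [].
  - by move=> i i0; rewrite lcoef1; case: eqP => // i1; lia.
  move=> k; rewrite conv_digits //; last by move=> [].
  rewrite [RHS](_ : _ = (k == 0%N)%:R); last by rewrite /digits subr0.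
  rewrite -(@cauchy_cinv (digits (lcoef h) 0)).
    by apply: eq_bigr => i _; congr (_ * _); rewrite [LHS]/digits subr0.
  by rewrite /digits subr0 hE add0r skew_mulrV.
by rewrite -mulrA; eexists; eassumption.
Qed.

Lemma laurent_field : GRing.field_axiom (laurent K).
Proof.
move=> f f0; apply/cunitP.
have [g fg] := laurent_rinv f0.
have g0 : g != 0.
  by apply/eqP => g0; move: fg; rewrite g0 mulr0 => /eqP; rewrite eq_sym oner_eq0.
have [f' gf'] := laurent_rinv g0; exists g; split=> //.
by rewrite -[f](mulr1) -gf' [f * _]mulrA fg mul1r.
Qed.

End LaurentField.

(** * Quaternion-like skew fields *)

Section LaurentMaps.

Variable K : nzRingType.
Implicit Types (p : {poly K}) (f : laurent K).

Fact lpoly_below p : exists n, below (fun i : int => if i is Posz j then p`_j else 0) n.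
Proof. by exists 0%N => -[]. Qed.

Definition lpoly p : laurent K := Laurent (lpoly_below p).

Fact lpoly_is_zmod_morphism : zmod_morphism lpoly.
Proof.
move=> p q; apply: laurentP => -[k|k] /=; first by rewrite coefB.
by rewrite subr0.
Qed.

HB.instance Definition _ := GRing.isZmodMorphism.Build _ _ lpoly lpoly_is_zmod_morphism.

Fact lpoly_is_monoid_morphism : monoid_morphism lpoly.
Proof.
split=> [|p q]; first by apply: laurentP => -[k|k] /=; rewrite ?coef1.
have b0 r : below (lcoef (lpoly r)) 0 by case.
have b1 : below (lcoef (lpoly p * lpoly q)) (0 + 0) by apply: conv_below.
apply: (eq_digits _ b1) => // k; rewrite conv_digits // /cauchy.
by rewrite [LHS]/digits subr0 /= coefM; apply: eq_bigr => i _; rewrite /digits !subr0.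
Qed.

HB.instance Definition _ := GRing.isMonoidMorphism.Build _ _ lpoly lpoly_is_monoid_morphism.

Lemma lpoly_neq0 p : p != 0 -> lpoly p != 0.
Proof.
apply: contra => /eqP p0; apply/eqP/polyP => i.
by rewrite coef0; have := congr1 (fun f => lcoef f (Posz i)) p0.
Qed.

Lemma lpolyC c : lpoly c%:P = lmono c 0.
Proof.
apply: laurentP => -[k|k] /=; last by rewrite mulr0n.
by rewrite coefC -mulrb; case: k.
Qed.

Lemma lpolyX : lpoly 'X = lmono 1 1.
Proof. by apply: laurentP => -[k|k] //=; rewrite coefX. Qed.

Lemma lmono_central c n f : (forall x, c * x = x * c) ->
  lmono c n * f = f * lmono c n.
Proof. by move=> cC; apply: laurentP => k; rewrite lcoef_monoM lcoef_Mmono. Qed.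

Section Map.
Variable s : {rmorphism K -> K}.

Fact lmap_below f : exists n, below (fun i => s (lcoef f i)) n.
Proof. by have [n fn] := lcoef_below f; exists n => i /fn ->; rewrite rmorph0. Qed.

Definition lmap f := Laurent (lmap_below f).

Fact lmap_is_zmod_morphism : zmod_morphism lmap.
Proof. by move=> f g; apply: laurentP => k /=; rewrite rmorphB. Qed.

HB.instance Definition _ := GRing.isZmodMorphism.Build _ _ lmap lmap_is_zmod_morphism.

Fact lmap_is_monoid_morphism : monoid_morphism lmap.
Proof.
split=> [|f g]; first by apply: laurentP => k /=; rewrite rmorph_nat.
have [n fn] := lcoef_below f; have [m gm] := lcoef_below g.
have sb h l : below (lcoef h) l -> below (lcoef (lmap h)) l.
  by move=> hl i il /=; rewrite hl ?rmorph0.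
apply: (@eq_digits _ _ _ (n + m)) => [||k].
- by apply: sb; apply: conv_below.
- by apply: conv_below; apply: sb.
rewrite conv_digits; try exact: sb.
rewrite [LHS](_ : _ = s (digits (lcoef (f * g)) (n + m) k)) // conv_digits //.
by rewrite rmorph_sum; apply: eq_bigr => i _; rewrite rmorphM.
Qed.

HB.instance Definition _ := GRing.isMonoidMorphism.Build _ _ lmap lmap_is_monoid_morphism.

Lemma lmap_mono c n : lmap (lmono c n) = lmono (s c) n.
Proof. by apply: laurentP => k /=; rewrite rmorphMn. Qed.

Lemma lmap_involutive : involutive s -> involutive lmap.
Proof. by move=> sK f; apply: laurentP => k /=; rewrite sK. Qed.

End Map.

(* the substitution [t -> -t] *)
Definition lsign (k : int) : K := (-1) ^+ (absz k).

Lemma lsignD i j : lsign (i + j) = lsign i * lsign j.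
Proof. by rewrite /lsign -exprD -signr_odd -[RHS]signr_odd; congr (_ ^+ _); lia. Qed.

Lemma lsignC i x : lsign i * x = x * lsign i.
Proof. by apply: commr_sym; apply: commr_sign. Qed.

Fact lflip_below f : exists n, below (fun i => lsign i * lcoef f i) n.
Proof. by have [n fn] := lcoef_below f; exists n => i /fn ->; rewrite mulr0. Qed.

Definition lflip f := Laurent (lflip_below f).

Fact lflip_is_zmod_morphism : zmod_morphism lflip.
Proof. by move=> f g; apply: laurentP => k /=; rewrite mulrBr. Qed.

HB.instance Definition _ := GRing.isZmodMorphism.Build _ _ lflip lflip_is_zmod_morphism.

Fact lflip_is_monoid_morphism : monoid_morphism lflip.
Proof.
split=> [|f g].
  apply: laurentP => k /=.
  by case: eqP => [->|_]; rewrite ?mulr0 // /lsign mul1r.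
have [n fn] := lcoef_below f; have [m gm] := lcoef_below g.
have sb h l : below (lcoef h) l -> below (lcoef (lflip h)) l.
  by move=> hl i il /=; rewrite hl ?mulr0.
apply: (@eq_digits _ _ _ (n + m)) => [||k].
- by apply: sb; apply: conv_below.
- by apply: conv_below; apply: sb.
rewrite conv_digits; try exact: sb.
rewrite [LHS](_ : _ = lsign (k%:Z - (n + m)%:Z) * digits (lcoef (f * g)) (n + m) k) //.
rewrite conv_digits // /cauchy mulr_sumr; apply: eq_bigr => i _.
rewrite /digits [in RHS]/= -!mulrA [X in _ = _ * X]mulrA -[_ * lsign _]lsignC.
rewrite -[X in _ = _ * X]mulrA [RHS]mulrA -lsignD; congr (lsign _ * _).
by have := ltn_ord i; lia.
Qed.

HB.instance Definition _ := GRing.isMonoidMorphism.Build _ _ lflip lflip_is_monoid_morphism.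

Lemma lflip_mono c n : lflip (lmono c n) = lmono (lsign n * c) n.
Proof.
apply: laurentP => k; rewrite [LHS]/= !lcoef_mono.
by case: eqP => [->|]; rewrite ?mulr1n // !mulr0n mulr0.
Qed.

Lemma lflip_involutive : involutive lflip.
Proof.
move=> f; apply: laurentP => k /=; rewrite mulrA -lsignD.
by rewrite /lsign -signr_odd (_ : odd _ = false) ?mul1r //; lia.
Qed.

End LaurentMaps.

(** Parity of the order: [f] and [lmap s f] have the same order, so a nonzero product has even
    order, whereas [t] has order 1. *)
Lemma laurent_norm (K : unitRingType) (s : {rmorphism K -> K}) (f : laurent K) :
  GRing.field_axiom K -> involutive s -> f * lmap s f != lmono 1 1.
Proof.
move=> KF sK; apply/eqP => fsf.
have [f0|f0] := eqVneq f 0.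
  move: fsf; rewrite f0 mul0r => /(congr1 (fun f => lcoef f 1)) /= /eqP.
  by rewrite eq_sym; apply/negP/oner_neq0.
have [n fn f_lt] := laurent_order f0.
have [|fnn _] := @lcoefM_order _ f (lmap s f) n n f_lt.
  by move=> i /f_lt /= ->; rewrite rmorph0.
move: fnn; rewrite fsf lcoef_mono (_ : n + n == 1 = false) ?mulr0n; last by lia.
move/esym/(skew_mulf_eq0 KF) => -[] fn0; first by rewrite fn0 eqxx in fn.
by case/eqP: fn; rewrite -[lcoef f n]sK [s (lcoef f n)]fn0 rmorph0.
Qed.

(* The quaternion-like algebra [F + J F], with [a J = J s(a)] and [J^2 = t]. *)
Record quat_data (F : nzRingType) := QuatData {
  quat_conj : {rmorphism F -> F};
  quat_t : F;
  quat_conjK : involutive quat_conj;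
  quat_tC : forall x, quat_t * x = x * quat_t;
  quat_conj_t : quat_conj quat_t = quat_t
}.

Definition quat (F : nzRingType) (q : quat_data F) : Type := (F * F)%type.

Section Quat.

Variables (F : nzRingType) (q : quat_data F).
Local Notation s := (quat_conj q).
Local Notation t := (quat_t q).
Local Notation L := (quat q).

HB.instance Definition _ := GRing.Zmodule.copy L (F * F)%type.

Definition quat_one : L := (1, 0).
Definition quat_mul (x y : L) : L :=
  (x.1 * y.1 + t * s x.2 * y.2, s x.1 * y.2 + x.2 * y.1).

Fact quat_mulA : associative quat_mul.
Proof.
move=> [a b] [c d] [e f]; rewrite /quat_mul /=; congr pair; rewrite !rmorphD !rmorphM /=.
  rewrite quat_conjK !mulrDr !mulrDl !mulrA -!addrA; congr (_ + _).
  by rewrite -[a * t]quat_tC addrA [RHS]addrC.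
rewrite quat_conj_t quat_conjK !mulrDr !mulrDl !mulrA -!addrA.
congr (_ + _); rewrite addrC -!addrA addrC -!addrA; congr (_ + _); first by rewrite quat_tC.
Qed.

Fact quat_mul1 : left_id quat_one quat_mul.
Proof. by case=> a b; rewrite /quat_mul /= rmorph1 rmorph0 mulr0 !mul0r !mul1r !addr0. Qed.

Fact quat_mulr1 : right_id quat_one quat_mul.
Proof. by case=> a b; rewrite /quat_mul /= !mulr0 !mulr1 addr0 add0r. Qed.

Fact quat_mulDl : left_distributive quat_mul +%R.
Proof.
move=> [a b] [c d] [e f]; rewrite /quat_mul /=; congr pair;
  by rewrite !rmorphD ?mulrDr !mulrDl addrACA.
Qed.

Fact quat_mulDr : right_distributive quat_mul +%R.
Proof.
move=> [a b] [c d] [e f]; rewrite /quat_mul /=; congr pair;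
  by rewrite !mulrDr addrACA.
Qed.

Fact quat_one_neq0 : quat_one != 0.
Proof. by apply/eqP => /(congr1 fst) /= /eqP; apply/negP/oner_neq0. Qed.

HB.instance Definition _ := GRing.Zmodule_isNzRing.Build L
  quat_mulA quat_mul1 quat_mulr1 quat_mulDl quat_mulDr quat_one_neq0.
HB.instance Definition _ := GRing.NzRing_hasMulInverse.Build L
  (@cinverse_l L) (@cinverse_r _) (@cunit_subproof _) (@cinverse_out _).

Lemma quatM (x y : L) :
  x * y = (x.1 * y.1 + t * s x.2 * y.2, s x.1 * y.2 + x.2 * y.1).
Proof. by []. Qed.

End Quat.

Section QuatField.

Variables (F : unitRingType) (FF : GRing.field_axiom F) (q : quat_data F).
Hypothesis normF : forall a, a * quat_conj q a != quat_t q.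
Local Notation s := (quat_conj q).
Local Notation t := (quat_t q).
Local Notation L := (quat q).

(** After normalizing the [J] part to 1, multiplication by a conjugate leaves the norm
    [t - c * s c], which lies in [F] and is nonzero by [normF]. *)
Lemma quat_rinv (x : L) : x != 0 -> exists y, x * y = 1.
Proof.
case: x => a b x0.
have base (c : F) : c != 0 -> exists y : L, ((c, 0) : L) * y = 1.
  move=> c0; exists (c^-1, 0); rewrite quatM /= rmorph0 !mulr0 !mul0r !addr0.
  by rewrite skew_mulrV.
have [b0|b0] := eqVneq b 0.
  subst b; apply: base; apply: contra x0 => /eqP ->; exact/eqP.
have [y y1] : exists y : L, ((a * b^-1, 1) : L) * y = 1.
  set c := a * b^-1.
  have [y y1] : exists y : L, ((t - c * s c, 0) : L) * y = 1.
    by apply: base; rewrite subr_eq0 eq_sym normF.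
  exists (((- s c, 1) : L) * y); rewrite mulrA -y1; congr (_ * _).
  rewrite quatM /= rmorph1 !mulr1 mul1r addrC mulrN; congr pair.
  by rewrite addrN.
exists (((b^-1, 0) : L) * y); rewrite mulrA -y1; congr (_ * _).
by rewrite quatM /= !mulr0 add0r addr0 skew_mulrV.
Qed.

Lemma quat_field : GRing.field_axiom L.
Proof.
move=> f f0; apply/cunitP.
have [g fg] := quat_rinv f0.
have g0 : g != 0.
  by apply/eqP => g0; move: fg; rewrite g0 mulr0 => /eqP; rewrite eq_sym oner_eq0.
have [f' gf'] := quat_rinv g0; exists g; split=> //.
by rewrite -[f](mulr1) -gf' [f * _]mulrA fg mul1r.
Qed.

End QuatField.

(** * The free algebra *)

Section FreeAlgebra.

Variables (F : fieldType) (n : nat).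
Local Notation A := (free_algebra F n).

Lemma free_ind (P : A -> Prop) :
  (forall c, P c%:A) -> (forall i, P (free_gen F i)) ->
  (forall a b, P a -> P b -> P (a + b)) ->
  (forall a b, P a -> P b -> P (a * b)) -> forall a, P a.
Proof.
move=> Pc Px PD PM a; rewrite [a]monalgE.
elim/big_ind: _ => //; first by have := Pc 0; rewrite scale0r.
move=> k _.
have -> : << a@_k *g k >> = (a@_k)%:A * << k >> :> A.
  by rewrite mulr_algl; apply/malgP => l; rewrite mcoeffZ mcoeffU1 mcoeffU mulr_natr.
apply: (PM) => //; case: k => s; elim: s => [|i s IHs].
  have := Pc 1; rewrite scale1r; congr P.
  by apply/malgP => l; rewrite mcoeff1 mcoeffU1 /mone /= fmoneE eq_sym.
have -> : << FMonom (i :: s) >> = free_gen F i * << FMonom s >> :> A.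
  by rewrite /free_gen malgM_def fgmulUU mulr1 /mmul /= fmmulE fmuE.
exact: PM.
Qed.

Lemma free_hom_eq (B : nzRingType) (f g : {rmorphism A -> B}) :
  (forall c, f c%:A = g c%:A) -> (forall i, f (free_gen F i) = g (free_gen F i)) ->
  f =1 g.
Proof.
move=> fgc fgx; apply: free_ind => // a b fa fb.
  by rewrite !rmorphD fa fb.
by rewrite !rmorphM fa fb.
Qed.

Section Hom.

Variables (B : nzRingType) (k : {rmorphism F -> B}) (X : 'I_n -> B).
Hypothesis kC : forall c b, k c * b = b * k c.

Definition word_eval (m : {fmonom 'I_n}) : B := \prod_(i <- (m : seq _)) X i.

Fact word_eval_mmorphism : mmorphism word_eval.
Proof.
split=> [m1 m2|]; rewrite /word_eval; last by rewrite fm1 big_nil.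
by rewrite fmM big_cat.
Qed.

HB.instance Definition _ := isMultiplicative.Build _ _ word_eval word_eval_mmorphism.

Lemma free_hom : exists f : {rmorphism A -> B},
  (forall c, f c%:A = k c) /\ (forall i, f (free_gen F i) = X i).
Proof.
pose f : A -> B := mmap k word_eval.
have fM : monoid_morphism f.
  have comm g m m' : GRing.comm (k (g : A)@_m) (word_eval m') by apply: kC.
  have [fM f1] := commr_mmap_is_multiplicative comm.
  by split; [apply: f1 | apply: fM].
have fB : zmod_morphism f by apply: mmap_is_additive.
pose f' : {rmorphism A -> B} := HB.pack f
  (GRing.isZmodMorphism.Build A B f fB) (GRing.isMonoidMorphism.Build A B f fM).
exists f'; split=> [c|i]; rewrite /f' /= /f; first by rewrite mmapZ mmap1 mulr1.
rewrite (_ : mmap _ _ _ = k 1 * word_eval (fmu i)); last exact: mmapU.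
by rewrite rmorph1 mul1r /word_eval fmuE big_seq1.
Qed.

End Hom.
End FreeAlgebra.

(** * Kernels of singular matrices *)

Lemma scalar_mx_central (B : pzRingType) m (c : B) (X : 'M[B]_m) :
  (forall b, c * b = b * c) -> c%:M *m X = X *m c%:M.
Proof.
move=> cC; apply/matrixP => i j; rewrite mul_scalar_mx !mxE (bigD1 j) //=.
rewrite !mxE eqxx mulr1n big1 ?addr0 // => k kj.
by rewrite !mxE (negPf kj) mulr0n mulr0.
Qed.

Section EvalOne.

Variable K : nzRingType.

Definition eval1 (p : {poly K}) : K := p.[1].

Fact eval1_is_zmod_morphism : zmod_morphism eval1.
Proof. by move=> p q; rewrite /eval1 hornerD hornerN. Qed.
HB.instance Definition _ := GRing.isZmodMorphism.Build _ _ eval1 eval1_is_zmod_morphism.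

Fact eval1_is_monoid_morphism : monoid_morphism eval1.
Proof.
split=> [|p q]; rewrite /eval1 ?hornerC // hornerM_comm //.
by rewrite /comm_poly mulr1 mul1r.
Qed.
HB.instance Definition _ := GRing.isMonoidMorphism.Build _ _ eval1 eval1_is_monoid_morphism.

End EvalOne.

Section SingularKernel.

Variables (F : fieldType) (n r : nat).
Hypothesis two_neq0 : 2%:R != 0 :> F.
Local Notation A := (free_algebra F n).
Variable N : 'M[A]_r.

(* The block matrix [rho N], of size [r (q+1)], has a kernel of dimension at
   least [q+1]. *)
Definition kernel_dim_ge (q : nat) : Prop :=
  forall (E : unitRingType) (k : {rmorphism F -> E})
    (rho : {rmorphism A -> 'M[E]_q.+1}),
  GRing.field_axiom E -> (forall c x, k c * x = x * k c) ->
  (forall c, rho c%:A = (k c)%:M) ->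
  exists U : 'I_r -> 'M[E]_q.+1,
    (forall c : 'cV[E]_q.+1, (forall j, U j *m c = 0) -> c = 0) /\
    (forall i, \sum_j rho (N i j) *m U j = 0).

(* A representation [rho] of dimension [2d] is the specialization at [X = Y = 1]
   of a representation of dimension [d] over the quaternion-like skew field of
   [E((Y))((X))] in which [J Y = - Y J] and [J^2 = X]; a kernel over the latter
   specializes by semicontinuity of the rank. *)
Section Doubling.

Variables (q : nat) (E : unitRingType) (EF : GRing.field_axiom E).
Variable k : {rmorphism F -> E}.
Hypothesis kC : forall c x, k c * x = x * k c.
Variable rho : {rmorphism A -> 'M[E]_((q + q.+1).+1)}.
Hypothesis rho_k : forall c, rho c%:A = (k c)%:M.

Local Notation K1 := (laurent E).
Local Notation K2 := (laurent K1).
Local Notation P2 := {poly {poly E}}.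

Let sgm : {rmorphism K2 -> K2} := lmap (@lflip E).
Let K1F : GRing.field_axiom K1 := laurent_field EF.
Let K2F : GRing.field_axiom K2 := laurent_field K1F.

Fact sgm_mono c i : sgm (lmono c i) = lmono (lflip c) i.
Proof. exact: lmap_mono. Qed.
Fact sgm_involutive : involutive sgm.
Proof. exact/lmap_involutive/lflip_involutive. Qed.
Fact t_central (x : K2) : lmono 1 1 * x = x * lmono 1 1.
Proof. by apply: lmono_central => y; rewrite mul1r mulr1. Qed.
Fact sgm_t : sgm (lmono 1 1) = lmono 1 1.
Proof. by rewrite sgm_mono rmorph1. Qed.

Definition dbl_data : quat_data K2 := QuatData sgm_involutive t_central sgm_t.
Local Notation L := (quat dbl_data).
Local Notation t := (lmono 1 1 : K2).

Fact dbl_field : GRing.field_axiom L.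
Proof.
apply: (quat_field K2F) => a; exact: (laurent_norm a K1F (@lflip_involutive E)).
Qed.

Definition toP : {rmorphism E -> P2} := polyC \o polyC.
Definition toK : {rmorphism P2 -> K2} := @lpoly K1 \o map_poly (@lpoly E).

Definition toL (x : K2) : L := (x, 0).
Fact toL_is_zmod_morphism : zmod_morphism toL.
Proof. by move=> x y; congr pair; rewrite subr0. Qed.
HB.instance Definition _ := GRing.isZmodMorphism.Build _ _ toL toL_is_zmod_morphism.
Fact toL_is_monoid_morphism : monoid_morphism toL.
Proof.
split=> // x y; rewrite quatM /=; congr pair; last by rewrite mulr0 mul0r addr0.
by rewrite mulr0 addr0.
Qed.
HB.instance Definition _ := GRing.isMonoidMorphism.Build _ _ toL toL_is_monoid_morphism.

Lemma toK_const e : toK (toP e) = lmono (lmono e 0) 0.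
Proof. by rewrite /toK /toP /= map_polyC /= lpolyC /= lpolyC. Qed.

Lemma toKX : toK 'X = t.
Proof. by rewrite /toK /= map_polyX lpolyX. Qed.

Lemma toKY : toK ('X%:P) = lmono (lmono 1 1) 0.
Proof. by rewrite /toK /= map_polyC /= lpolyC /= lpolyX. Qed.

Definition kL : {rmorphism F -> L} := toL \o (toK \o (toP \o k)).

Lemma kL_central c (x : L) : kL c * x = x * kL c.
Proof.
have cC y : toK (toP (k c)) * y = y * toK (toP (k c)).
  rewrite toK_const; apply: lmono_central => z; apply: lmono_central => e; exact: kC.
have sc : sgm (toK (toP (k c))) = toK (toP (k c)).
  by rewrite toK_const sgm_mono lflip_mono /lsign expr0 mul1r.
case: x => a b; rewrite !quatM /= rmorph0 !mulr0 !mul0r !addr0 add0r.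
by congr pair; [exact: cC | rewrite [in LHS]sc; exact: cC].
Qed.

Definition fst_mx p (X : 'M[L]_(q.+1, p)) : 'M[K2]_(q.+1, p) := map_mx fst X.
Definition snd_mx p (X : 'M[L]_(q.+1, p)) : 'M[K2]_(q.+1, p) := map_mx snd X.

(* Left multiplication by [a + J b] in the basis [1, J]. *)
Definition split_mx (X : 'M[L]_q.+1) : 'M[K2]_((q + q.+1).+1) :=
  block_mx (fst_mx X) (t *: map_mx sgm (snd_mx X)) (snd_mx X) (map_mx sgm (fst_mx X))
    : 'M_(q.+1 + q.+1).

Definition split_col (c : 'cV[L]_q.+1) : 'cV[K2]_((q + q.+1).+1) :=
  col_mx (fst_mx c) (snd_mx c) : 'cV_(q.+1 + q.+1).

Lemma fst_mxM p (X : 'M[L]_q.+1) (Y : 'M[L]_(q.+1, p)) : fst_mx (X *m Y) =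
  fst_mx X *m fst_mx Y + (t *: map_mx sgm (snd_mx X)) *m snd_mx Y.
Proof.
apply/matrixP => i j; rewrite !mxE (raddf_sum (fst : L -> K2)) -big_split.
by apply: eq_bigr => l _; rewrite !mxE.
Qed.

Lemma snd_mxM p (X : 'M[L]_q.+1) (Y : 'M[L]_(q.+1, p)) : snd_mx (X *m Y) =
  snd_mx X *m fst_mx Y + map_mx sgm (fst_mx X) *m snd_mx Y.
Proof.
apply/matrixP => i j; rewrite !mxE (raddf_sum (snd : L -> K2)) -big_split.
by apply: eq_bigr => l _; rewrite !mxE /= addrC.
Qed.

Lemma split_mx_col X c : split_mx X *m split_col c = split_col (X *m c).
Proof.
apply: (etrans (@mul_block_col _ q.+1 q.+1 q.+1 q.+1 1 _ _ _ _ _ _)).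
by rewrite /split_col fst_mxM snd_mxM.
Qed.

Lemma split_col_surj (c : 'cV[K2]_((q + q.+1).+1)) : exists c', c = split_col c'.
Proof.
exists (\col_i ((usubmx (c : 'cV_(q.+1 + q.+1)) i 0,
                 dsubmx (c : 'cV_(q.+1 + q.+1)) i 0) : L)).
apply: (etrans (esym (@vsubmxK _ q.+1 q.+1 _ c))).
by congr col_mx; apply/matrixP => i j; rewrite !mxE /= ord1.
Qed.

Lemma split_col_eq0 c : split_col c = 0 -> c = 0.
Proof.
move/eqP; rewrite [_ == 0](@col_mx_eq0 _ q.+1 q.+1 1) => /andP[/eqP c1 /eqP c2].
apply/matrixP => i j; move/matrixP/(_ i j): c1; move/matrixP/(_ i j): c2.
by rewrite !mxE; case: (c i j) => a b /= -> ->.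
Qed.

Fact split_mx_is_zmod_morphism : zmod_morphism split_mx.
Proof.
move=> X Y; apply: esym.
apply: (etrans (congr1 (+%R (split_mx X)) (@opp_block_mx _ q.+1 q.+1 q.+1 q.+1 _ _ _ _))).
apply: (etrans (@add_block_mx _ q.+1 q.+1 q.+1 q.+1 _ _ _ _ _ _ _ _)).
congr block_mx; apply/matrixP => i j; rewrite !mxE //=.
  by rewrite rmorphB mulrBr.
by rewrite rmorphB.
Qed.
HB.instance Definition _ := GRing.isZmodMorphism.Build _ _ split_mx split_mx_is_zmod_morphism.

Lemma sgm_mxK u v (X : 'M_(u, v)) : map_mx sgm (map_mx sgm X) = X.
Proof. by apply/matrixP => i j; rewrite !mxE [LHS]sgm_involutive. Qed.

Lemma mulmx_t u v w (X : 'M[K2]_(u, v)) (Y : 'M[K2]_(v, w)) :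
  X *m (t *: Y) = t *: (X *m Y).
Proof.
apply/matrixP => i j; rewrite !mxE mulr_sumr; apply: eq_bigr => l _.
by rewrite !mxE !mulrA t_central.
Qed.

Fact split_mx_is_monoid_morphism : monoid_morphism split_mx.
Proof.
split=> [|X Y].
  apply: (etrans _ (esym (@scalar_mx_block _ q.+1 q.+1 1))).
  congr block_mx; apply/matrixP => i j; rewrite !mxE.
  - by rewrite (raddfMn (fst : L -> K2)).
  - by rewrite (raddfMn (snd : L -> K2)) mul0rn rmorph0 mulr0.
  - by rewrite (raddfMn (snd : L -> K2)) mul0rn.
  - by rewrite (raddfMn (fst : L -> K2)) rmorphMn rmorph1.
apply: (etrans _ (esym (@mulmx_block _ q.+1 q.+1 q.+1 q.+1 q.+1 q.+1 _ _ _ _ _ _ _ _))).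
rewrite /split_mx !fst_mxM !snd_mxM; congr block_mx.
  rewrite !map_mxD !map_mxM sgm_mxK scalerDr addrC -scalemxAl mulmx_t.
  by rewrite [in X in _ + X]/= scalemxAl.
rewrite map_mxD !map_mxM.
have -> : map_mx sgm (t *: map_mx sgm (snd_mx X)) = t *: snd_mx X.
  by rewrite map_mxZ sgm_mxK [sgm _]sgm_t.
by rewrite -scalemxAl mulmx_t addrC.
Qed.
HB.instance Definition _ := GRing.isMonoidMorphism.Build _ _ split_mx split_mx_is_monoid_morphism.

Local Notation v := ('X%:P : P2).
Local Notation half := (k 2%:R^-1).
Definition gen_ul i : 'M[E]_q.+1 := @ulsubmx _ q.+1 q.+1 q.+1 q.+1 (rho (free_gen F i)).
Definition gen_ur i : 'M[E]_q.+1 := @ursubmx _ q.+1 q.+1 q.+1 q.+1 (rho (free_gen F i)).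
Definition gen_dl i : 'M[E]_q.+1 := @dlsubmx _ q.+1 q.+1 q.+1 q.+1 (rho (free_gen F i)).
Definition gen_dr i : 'M[E]_q.+1 := @drsubmx _ q.+1 q.+1 q.+1 q.+1 (rho (free_gen F i)).
(** Linear interpolation with value [X] at [s = 1] and [Y] at [s = -1]. Since the conjugation
    negates the variable Y of the series, an entry and its conjugate specialize to two independent
    blocks of [rho]; this is where 2 has to be invertible. *)
Definition deform (s : P2) (X Y : 'M[E]_q.+1) : 'M[P2]_q.+1 :=
  map_mx toP (half *: (X + Y)) + s *: map_mx toP (half *: (X - Y)).

Lemma deformE s X Y u w : deform s X Y u w =
  toP (half * (X u w + Y u w)) + s * toP (half * (X u w - Y u w)).
Proof. by rewrite !mxE. Qed.

Let scalP c (x : P2) : toP (k c) * x = x * toP (k c).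
Proof.
rewrite /toP /=; apply/polyP => i; rewrite coefCM coefMC.
by apply/polyP => j; rewrite coefCM coefMC kC.
Qed.

Lemma special_exists : exists fP : {rmorphism A -> 'M[P2]_((q + q.+1).+1)},
  (forall c, fP c%:A = (toP (k c))%:M) /\
  forall i, fP (free_gen F i) = block_mx
    (deform v (gen_ul i) (gen_dr i)) ('X *: deform (- v) (gen_dl i) (gen_ur i))
    (deform v (gen_dl i) (gen_ur i)) (deform (- v) (gen_ul i) (gen_dr i))
    :> 'M_(q.+1 + q.+1).
Proof.
pose kM : {rmorphism F -> 'M[P2]_((q + q.+1).+1)} := @scalar_mx _ _ \o (toP \o k).
have [|f [fk fx]] := @free_hom F n _ kM (fun i => block_mx
    (deform v (gen_ul i) (gen_dr i)) ('X *: deform (- v) (gen_dl i) (gen_ur i))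
    (deform v (gen_dl i) (gen_ur i)) (deform (- v) (gen_ul i) (gen_dr i))
    : 'M_(q.+1 + q.+1)).
  by move=> c X; apply: scalar_mx_central => y; apply: scalP.
by exists f.
Qed.

Lemma generic_exists : exists fL : {rmorphism A -> 'M[L]_q.+1},
  (forall c, fL c%:A = (kL c)%:M) /\
  forall i, fL (free_gen F i) = \matrix_(u, w)
    (toK (deform v (gen_ul i) (gen_dr i) u w), toK (deform v (gen_dl i) (gen_ur i) u w)).
Proof.
pose kM : {rmorphism F -> 'M[L]_q.+1} := @scalar_mx _ _ \o kL.
have [|f [fk fx]] := @free_hom F n _ kM (fun i => \matrix_(u, w)
    (toK (deform v (gen_ul i) (gen_dr i) u w), toK (deform v (gen_dl i) (gen_ur i) u w))).
  by move=> c X; apply: scalar_mx_central => y; apply: kL_central.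
by exists f.
Qed.

(** The left multiplications by the skew matrices of [fL] have polynomial entries, given by [fP].
    This allows a kernel found over the skew field to be specialized. *)
Lemma special_generic (fP : {rmorphism A -> 'M[P2]_((q + q.+1).+1)})
    (fL : {rmorphism A -> 'M[L]_q.+1}) :
  (forall c, fP c%:A = (toP (k c))%:M) ->
  (forall i, fP (free_gen F i) = block_mx
    (deform v (gen_ul i) (gen_dr i)) ('X *: deform (- v) (gen_dl i) (gen_ur i))
    (deform v (gen_dl i) (gen_ur i)) (deform (- v) (gen_ul i) (gen_dr i))
    :> 'M_(q.+1 + q.+1)) ->
  (forall c, fL c%:A = (kL c)%:M) ->
  (forall i, fL (free_gen F i) = \matrix_(u, w)
    (toK (deform v (gen_ul i) (gen_dr i) u w), toK (deform v (gen_dl i) (gen_ur i) u w))) ->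
  forall x, map_mx toK (fP x) = split_mx (fL x).
Proof.
move=> fPk fPx fLk fLx.
have sP e : sgm (toK (toP e)) = toK (toP e).
  by rewrite toK_const sgm_mono lflip_mono /lsign expr0 mul1r.
have sv : sgm (toK v) = toK (- v).
  rewrite rmorphN toKY sgm_mono lflip_mono /lsign expr1 mulN1r.
  apply: laurentP => i; rewrite lcoefN !lcoef_mono -mulNrn; congr (_ *+ _).
  by apply: laurentP => j; rewrite lcoefN !lcoef_mono mulNrn.
have sdv X Y u w : sgm (toK (deform v X Y u w)) = toK (deform (- v) X Y u w).
  by rewrite !deformE !(rmorphD toK) !(rmorphM toK) (rmorphD sgm) (rmorphM sgm) !sP sv.
apply: (@free_hom_eq F n _ (map_mx toK \o fP) (split_mx \o fL)) => [c|i].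
  rewrite -[LHS]/(map_mx toK (fP c%:A)) -[RHS]/(split_mx (fL c%:A)).
  rewrite fPk fLk map_scalar_mx /split_mx.
  apply: (etrans (@scalar_mx_block _ q.+1 q.+1 _)).
  congr block_mx; apply/matrixP => a b; rewrite !mxE.
  - by rewrite (raddfMn (fst : L -> K2)).
  - by rewrite (raddfMn (snd : L -> K2)) mul0rn rmorph0 mulr0.
  - by rewrite (raddfMn (snd : L -> K2)) mul0rn.
  - by rewrite (raddfMn (fst : L -> K2)) (rmorphMn sgm) [sgm _]sP.
rewrite -[LHS]/(map_mx toK (fP (free_gen F i))) -[RHS]/(split_mx (fL (free_gen F i))).
rewrite fPx fLx; apply: (etrans (@map_block_mx _ _ _ q.+1 q.+1 q.+1 q.+1 _ _ _ _)).
have fE X Y : fst_mx (\matrix_(u, w) (X u w, Y u w) : 'M[L]_q.+1) = \matrix_(u, w) X u w.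
  by apply/matrixP => a b; rewrite !mxE.
have sE X Y : snd_mx (\matrix_(u, w) (X u w, Y u w) : 'M[L]_q.+1) = \matrix_(u, w) Y u w.
  by apply/matrixP => a b; rewrite !mxE.
rewrite /split_mx fE sE; congr block_mx; apply/matrixP => a b.
- by rewrite mxE [RHS]mxE.
- rewrite mxE [in LHS]mxE (rmorphM toK) toKX -sdv [RHS]mxE; congr (_ * _).
  by rewrite [RHS]mxE; congr (sgm _); rewrite [RHS]mxE.
- by rewrite mxE [RHS]mxE.
by rewrite mxE -sdv [RHS]mxE; congr (sgm _); rewrite [RHS]mxE.
Qed.

Lemma special_rho (fP : {rmorphism A -> 'M[P2]_((q + q.+1).+1)}) :
  (forall c, fP c%:A = (toP (k c))%:M) ->
  (forall i, fP (free_gen F i) = block_mx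
    (deform v (gen_ul i) (gen_dr i)) ('X *: deform (- v) (gen_dl i) (gen_ur i))
    (deform v (gen_dl i) (gen_ur i)) (deform (- v) (gen_ul i) (gen_dr i))
    :> 'M_(q.+1 + q.+1)) ->
  forall x, map_mx (@eval1 E) (map_mx (@eval1 {poly E}) (fP x)) = rho x.
Proof.
move=> fPk fPx.
pose ev2 : {rmorphism P2 -> E} := @eval1 E \o @eval1 {poly E}.
have eP e : ev2 (toP e) = e by rewrite /= /eval1 !hornerC.
have ed s X Y u w : ev2 (deform s X Y u w) =
    half * (X u w + Y u w) + ev2 s * (half * (X u w - Y u w)).
  by rewrite deformE (rmorphD ev2) (rmorphM ev2) !eP.
have ev : ev2 v = 1 by rewrite /= /eval1 hornerC hornerX.
have hh : half + half = 1.
  by rewrite -rmorphD -(rmorph1 k) -mulr2n -[X in X *+ _]mulr1 -mulrnAr mulVf.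
have edp X Y u w : ev2 (deform v X Y u w) = X u w.
  by rewrite ed ev mul1r -mulrDr addrACA subrr addr0 mulrDr -mulrDl hh mul1r.
have edm X Y u w : ev2 (deform (- v) X Y u w) = Y u w.
  rewrite ed (rmorphN ev2) ev mulN1r -mulrBr opprB [X in half * X]addrC addrA subrK.
  by rewrite mulrDr -mulrDl hh mul1r.
apply: (@free_hom_eq F n _ (map_mx (@eval1 E) \o (map_mx (@eval1 {poly E}) \o fP)) rho) => [c|i] /=.
  by rewrite fPk rho_k !map_scalar_mx -[in RHS](eP (k c)).
rewrite fPx; apply: (etrans _ (@submxK _ q.+1 q.+1 q.+1 q.+1 (rho (free_gen F i)))).
apply: (etrans (congr1 (map_mx (@eval1 E)) (@map_block_mx _ _ _ q.+1 q.+1 q.+1 q.+1 _ _ _ _))).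
apply: (etrans (@map_block_mx _ _ _ q.+1 q.+1 q.+1 q.+1 _ _ _ _)).
congr block_mx; apply/matrixP => a b; rewrite mxE mxE.
- exact: edp.
- rewrite -[LHS]/(ev2 _) mxE (rmorphM ev2) [X in X * _ = _](_ : _ = 1) ?mul1r ?edm //.
  by rewrite /= /eval1 hornerX hornerC.
- exact: edp.
exact: edm.
Qed.

Lemma doubling : kernel_dim_ge q -> exists U : 'I_r -> 'M[E]_((q + q.+1).+1),
  (forall c : 'cV[E]_((q + q.+1).+1), (forall j, U j *m c = 0) -> c = 0) /\
  (forall i, \sum_j rho (N i j) *m U j = 0).
Proof.
move=> IH; have [fP [fPk fPx]] := special_exists.
have [fL [fLk fLx]] := generic_exists.
have fPL := special_generic fPk fPx fLk fLx.
have fPE := special_rho fPk fPx.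
have [U [injU NU]] := IH L kL fL dbl_field kL_central fLk.
pose H := \mxblock_(i < r, j < r) fP (N i j).
pose V := \mxcol_(j < r) split_mx (U j).
have injV : rinj V.
  move=> c; rewrite mxcol_mul => Vc.
  have [c' cE] := split_col_surj c; rewrite cE.
  rewrite (injU c') => [|j]; last first.
    apply: split_col_eq0; rewrite -split_mx_col -cE.
    by have := congr1 (fun z => submxcol z j) Vc; rewrite mxcolK submxcol0.
  by apply/eqP; rewrite [_ == 0](@col_mx_eq0 _ q.+1 q.+1 1) /fst_mx /snd_mx !map_mx0 !eqxx.
have HV : map_mx (@lpoly K1) (map_mx (map_poly (@lpoly E)) H) *m V = 0.
  have -> : map_mx (@lpoly K1) (map_mx (map_poly (@lpoly E)) H) =
      \mxblock_(i < r, j < r) split_mx (fL (N i j)).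
    by apply/matrixP => i j; rewrite [RHS]mxE -fPL !mxE.
  rewrite mul_mxblock_mxrow -[RHS](@mxcol0 _ _ (fun=> (q + q.+1).+1)).
  apply: eq_mxcol => i.
  rewrite -[RHS](raddf0 split_mx) -(NU i) raddf_sum; apply: eq_bigr => j _.
  by rewrite -[RHS]/(split_mx (fL (N i j) * U j)) rmorphM.
(* The variable X is set to 1 first, over the coefficient field E((Y)); then Y is set to 1, over
   [E]. *)
have [V1 injV1 HV1] := poly_kernel_special K1F K2F (@lpoly_neq0 K1) injV HV.
have HV2 : map_mx (@lpoly E) (map_mx (@eval1 {poly E}) H) *m V1 = 0.
  rewrite -[RHS]HV1; congr (_ *m _); apply/matrixP => i j; rewrite !mxE.
  by rewrite -(rmorph1 (@lpoly E)) horner_map.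
have [V2 injV2 HV3] := poly_kernel_special EF K1F (@lpoly_neq0 E) injV1 HV2.
have {}HV3 : (\mxblock_(i < r, j < r) rho (N i j)) *m V2 = 0.
  rewrite -[RHS]HV3; congr (_ *m _); apply/matrixP => i j.
  by rewrite [LHS]mxE -fPE !mxE.
exists (submxcol V2); split=> [c Vc|i].
  apply: injV2; apply/mxcolP => j; by rewrite -submxcol_mul Vc submxcol0.
move: HV3; rewrite -[V2]submxcolK mul_mxblock_mxrow => /(congr1 (fun z => submxcol z i)).
rewrite mxcolK submxcol0 => HVi; rewrite -[RHS]HVi; apply: eq_bigr => j _.
by rewrite mxcolK.
Qed.

End Doubling.

Definition singular : Prop :=
  forall (L : unitRingType) (f : {rmorphism A -> L}), GRing.field_axiom L ->
  exists2 c : 'cV[L]_r, c != 0 & map_mx f N *m c = 0.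

Hypothesis singN : singular.

(** A representation of dimension 1 is a morphism to the skew field [E] itself, to which singularity
    applies directly. *)
Lemma kernel_dim_ge1 : kernel_dim_ge 0.
Proof.
move=> E k rho EF kC rho_k.
pose f (a : A) := rho a 0 0.
have fB : zmod_morphism f by move=> a b; rewrite /f rmorphB !mxE.
have fM : monoid_morphism f.
  split=> [|a b]; first by rewrite /f rmorph1 mxE.
  by rewrite /f rmorphM mxE big_ord1.
pose f' : {rmorphism A -> E} := HB.pack f
  (GRing.isZmodMorphism.Build A E f fB) (GRing.isMonoidMorphism.Build A E f fM).
have [c c0 Nc] := singN f' EF.
exists (fun j => (c j 0)%:M); split=> [d cd|i]; last first.
  apply/matrixP => a b; rewrite !ord1 summxE [RHS]mxE.
  have /matrixP/(_ i 0) := Nc; rewrite !mxE => Nci; rewrite -[RHS]Nci.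
  by apply: eq_bigr => j _; rewrite !mxE big_ord1 !mxE.
have /existsP[j cj] : [exists j, c j 0 != 0].
  apply: contraNT c0; rewrite negb_exists => /forallP c0.
  by apply/eqP/matrixP => a b; rewrite ord1 mxE; apply/eqP/negbNE/c0.
apply/matrixP => a b; rewrite !ord1 mxE.
have /matrixP/(_ 0 0) := cd j; rewrite !mxE big_ord1 !mxE mulr1n.
by case/(skew_mulf_eq0 EF) => // cj0; rewrite cj0 eqxx in cj.
Qed.

Lemma kernel_dim_ge_pow2 s q : q.+1 = (2 ^ s)%N -> kernel_dim_ge q.
Proof.
elim: s q => [|s IHs] q qs.
  have -> : q = 0%N by move: qs; rewrite expn0 => -[].
  exact: kernel_dim_ge1.
have [q' q's] : exists q', q'.+1 = (2 ^ s)%N.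
  by exists (2 ^ s).-1; rewrite prednK // expn_gt0.
have -> : q = (q' + q'.+1)%N.
  by apply: succn_inj; rewrite qs expnS -q's mul2n -addnn.
by move=> E k rho EF kC rho_k; apply: (doubling EF kC rho_k); apply: IHs.
Qed.

Lemma kernel_dim_geP q : kernel_dim_ge q.
Proof.
move=> E k rho EF kC rho_k; set m := q.+1.
pose H := \mxblock_(i < r, j < r) rho (N i j).
have [[U injU HU]|[B injB]] := rinj_col_basis EF H q.
  exists (submxcol U); split=> [c Uc|i].
    by apply: injU; apply/mxcolP => j; rewrite -submxcol_mul Uc submxcol0.
  move: HU; rewrite -[U]submxcolK mul_mxblock_mxrow => /(congr1 (fun z => submxcol z i)).
  rewrite mxcolK submxcol0 => HVi; rewrite -[RHS]HVi; apply: eq_bigr => j _.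
  by rewrite mxcolK.
exfalso.
(* This exponent ensures [m * r < 2 ^ s %/ m], that is, more copies of [rho] than the remainder
   coordinates can compensate for. *)
pose s := (m * (m * r).+1)%N.
have [p ps] : exists p, p.+1 = (2 ^ s)%N by exists (2 ^ s).-1; rewrite prednK // expn_gt0.
pose a := (p.+1 %/ m)%N; pose b := (p.+1 %% m)%N.
have ab : p.+1 = (a * m + b)%N by exact: divn_eq.
have ra : (m * r < a)%N.
  by rewrite /a leq_divRL // mulnC ps ltnW // ltn_expl.
have bm : (b < m)%N by rewrite ltn_mod.
(* [sel l] selects the [l]-th copy of [E^m] in [E^(p+1)] *)
pose sel (l : 'I_a) : 'M[E]_(m, p.+1) := \matrix_(u, w) ((w : nat) == l * m + u)%N%:R.
(* The direct sum of [a] copies of [rho], completed by [b] coordinates on which the generators act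
   as 0. *)
have [rho' [rho'k rho'x]] : exists f : {rmorphism A -> 'M[E]_p.+1},
    (forall c, f c%:A = (k c)%:M) /\ forall i, f (free_gen F i) =
      \sum_l (sel l)^T *m rho (free_gen F i) *m sel l.
  pose kM : {rmorphism F -> 'M[E]_p.+1} := @scalar_mx _ _ \o k.
  have [|f [fk fx]] := @free_hom F n _ kM
      (fun i => \sum_l (sel l)^T *m rho (free_gen F i) *m sel l).
    by move=> c X; apply: scalar_mx_central.
  by exists f.
have sel_lt (l : 'I_a) (u : 'I_m) : (l * m + u < p.+1)%N.
  rewrite ab (leq_trans _ (leq_addr _ _)) //.
  rewrite (leq_trans (n := l.+1 * m)) ?leq_mul2r ?ltn_ord ?orbT //.
  by rewrite mulSn addnC ltn_add2r.
have selE l (u : 'I_m) w (X : 'M[E]_(p.+1, w)) y :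
    (sel l *m X) u y = X (Ordinal (sel_lt l u)) y.
  rewrite mxE (bigD1 (Ordinal (sel_lt l u))) //= mxE eqxx mul1r big1 ?addr0 // => z zl.
  rewrite mxE (_ : _ == _ = false) ?mul0r //; apply: contraNF zl => /eqP zE.
  exact/eqP/val_inj.
have selM l l' : sel l *m (sel l')^T = (l == l')%:R%:M.
  apply/matrixP => u u'; rewrite selE !mxE /=.
  have [->|ll'] := eqVneq l l'; first by rewrite eqn_add2l.
  rewrite mul0rn (_ : _ == _ = false) //; apply: contraNF ll' => /eqP.
  move/(congr1 (divn^~ m)); rewrite !divnMDl // !divn_small // !addn0 => ll'.
  exact/eqP/val_inj.
have selrho l x : sel l *m rho' x = rho x *m sel l.
  elim/free_ind: x => [c|i|x y hx hy|x y hx hy].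
  - apply/matrixP => u w; rewrite rho'k rho_k selE mul_scalar_mx !mxE mulr_natr.
    by rewrite -val_eqE eq_sym.
  - rewrite rho'x mulmx_sumr (bigD1 l) //= !mulmxA selM eqxx mul1mx big1 ?addr0 //.
    by move=> l' l'l; rewrite !mulmxA selM eq_sym (negPf l'l) raddf0 !mul0mx.
  - by rewrite !rmorphD mulmxDr mulmxDl hx hy.
  - by rewrite !rmorphM /= mulmxA hx -mulmxA hy mulmxA.
have [U [injU NU]] := kernel_dim_ge_pow2 ps EF kC rho'k.
pose V l := \mxcol_(j < r) (sel l *m U j).
have HV l : H *m V l = 0.
  rewrite mul_mxblock_mxrow -[RHS](@mxcol0 _ _ (fun=> q.+1)).
  apply: eq_mxcol => i; under eq_bigr => j _ do rewrite mulmxA -selrho -mulmxA.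
  by rewrite -mulmx_sumr NU mulmx0.
pose tail : 'M[E]_(b, p.+1) := \matrix_(u, w) ((w : nat) == a * m + u)%N%:R.
(* If [rho N] had nullity at most [m - 1], then [a * (m - 1) + r * b] linear conditions would force
   a vector in the kernel of [rho' N] to vanish. This number is less than the dimension [a * m + b]
   provided by the case of powers of 2, because [r * b <= r * m < a]. *)
have [|c c0 Cc] := @wide_kernel E EF _ p.+1
    (col_mx (\mxcol_(l < a) (B *m V l)) (\mxcol_(j < r) (tail *m U j))).
  rewrite !sum_nat_const !card_ord ab.
  have := leq_mul (leqnn r) (ltnW bm); rewrite [(r * m)%N]mulnC => rb.
  by rewrite /m; move: ra rb; rewrite /m => ra rb; nia.
move/eqP: Cc; rewrite mul_col_mx col_mx_eq0 !mxcol_mul => /andP[/eqP Vc /eqP Tc].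
case/eqP: c0; apply: injU => j; apply/matrixP => w y; rewrite [RHS]mxE.
have [wam|amw] := ltnP w (a * m).
  have wa : (w %/ m < a)%N by rewrite ltn_divLR.
  have wm : (w %% m < m)%N by rewrite ltn_mod.
  have VL0 : V (Ordinal wa) *m c = 0.
    apply: injB; rewrite mul_col_mx !mulmxA HV mul0mx.
    have := congr1 (fun z => submxcol z (Ordinal wa)) Vc; rewrite mxcolK submxcol0 => ->.
    by rewrite col_mx0.
  move: VL0; rewrite mxcol_mul => /(congr1 (fun z => submxcol z j)).
  rewrite mxcolK submxcol0 -mulmxA => /matrixP/(_ (Ordinal wm) y).
  rewrite selE [in RHS]mxE => <-; congr (_ _ y); apply: val_inj => /=.
  exact: divn_eq.
have wb : (w - a * m < b)%N by rewrite ltn_subLR // -ab.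
have := congr1 (fun z => submxcol z j) Tc; rewrite mxcolK submxcol0 -mulmxA.
move=> /matrixP/(_ (Ordinal wb) y); rewrite [in X in _ = X -> _]mxE => <-.
rewrite [RHS]mxE (bigD1 w) //= [tail _ _]mxE /= subnKC // eqxx mul1r big1 ?addr0 // => z zw.
rewrite [tail _ _]mxE /= subnKC // (_ : _ == _ = false) ?mul0r //.
by apply: contraNF zw => /eqP zE; apply/eqP/val_inj.
Qed.

End SingularKernel.

(** * Universal fields of fractions *)

Section SubSkewField.

Variables (K : unitRingType) (S : {pred K}).

(** Carrying the closure proof as an argument lets the algebraic structures on the subtype be
    inferred from the predicate. *)
Definition skew_pred of GRing.divring_closed S : {pred K} := S.

Variable HS : GRing.divring_closed S.

HB.instance Definition _ := GRing.isDivringClosed.Build K (skew_pred HS) HS.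

Record sub_skew := SubSkew { skew_val : K; _ : skew_val \in skew_pred HS }.

HB.instance Definition _ := [isSub for skew_val].
HB.instance Definition _ := [Choice of sub_skew by <:].
HB.instance Definition _ := [SubChoice_isSubUnitRing of sub_skew by <:].

Lemma sub_skew_field : GRing.field_axiom K -> GRing.field_axiom sub_skew.
Proof.
move=> KF x x0.
have vx0 : skew_val x != 0 by apply: contra x0 => /eqP x0; apply/eqP/val_inj.
have [_ _ SV] := HS.
have S1 : (1 : K) \in S by have [] := HS.
have Sx : (skew_val x)^-1 \in skew_pred HS.
  by rewrite -[_^-1]mul1r; apply: SV => //; apply: valP x.
apply/unitrP; exists (SubSkew Sx).
by split; apply: val_inj; rewrite [LHS](rmorphM val) rmorph1 /=;
   [apply: skew_mulVr | apply: skew_mulrV].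
Qed.

End SubSkewField.

Section DivisionClosure.

Variables (T : Type) (K : unitRingType) (f : T -> K).

Definition div_closure : {pred K} := fun x =>
  `[< forall S : {pred K}, GRing.divring_closed S -> (forall a, f a \in S) -> x \in S >].

Lemma div_closure_closed : GRing.divring_closed div_closure.
Proof.
split=> [|x y /asboolP Sx /asboolP Sy|x y /asboolP Sx /asboolP Sy];
  apply/asboolP => S HS Sf; have [S1 SB SV] := HS => //.
  by apply: SB; [apply: Sx | apply: Sy].
by apply: SV; [apply: Sx | apply: Sy].
Qed.

Lemma div_closure_sub a : f a \in div_closure.
Proof. by apply/asboolP. Qed.

End DivisionClosure.

Section Universality.

Variables (A : nzRingType) (U : unitRingType) (i : {rmorphism A -> U}).
Hypothesis univ : universal_field_of_fractions i.

(** The universal property concerns epic morphisms only; it is applied to the sub-skew-field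
    generated by the image of [f]. *)
Lemma universal_specialization (L : unitRingType) (f : {rmorphism A -> L}) :
  GRing.field_axiom L -> exists (S : {pred U}) (phi : U -> L), specialization i f S phi.
Proof.
move=> LF; have HS := @div_closure_closed A L f.
pose g a : sub_skew HS := SubSkew (div_closure_sub f a : f a \in skew_pred HS).
have gB : zmod_morphism g by move=> x y; apply: val_inj; rewrite /= rmorphB.
have gM : monoid_morphism g.
  by split=> [|x y]; apply: val_inj; rewrite /= ?rmorph1 ?rmorphM.
pose g' : {rmorphism A -> sub_skew HS} := HB.pack g
  (GRing.isZmodMorphism.Build A _ g gB) (GRing.isMonoidMorphism.Build A _ g gM).
have [_ _ _ /(_ _ g')] := univ; case.
- exact: sub_skew_field.
- move=> S' HS' S'g x.
  have /asboolP : skew_val x \in div_closure f by apply: valP x.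
  pose T : {pred L} := fun y => `[< exists2 z, z \in S' & skew_val z = y >].
  have [S'1 S'B S'V] := HS'.
  move=> /(_ T) xT.
  have TS : GRing.divring_closed T.
    split=> [|y z /asboolP[y' Sy <-] /asboolP[z' Sz <-]|y z /asboolP[y' Sy <-] /asboolP[z' Sz <-]].
    - by apply/asboolP; exists 1.
    - by apply/asboolP; exists (y' - z'); [apply: S'B | rewrite [LHS](rmorphB val)].
    apply/asboolP; exists (y' / z'); first exact: S'V.
    have [->|z0] := eqVneq z' 0.
      by rewrite invr0 mulr0 (rmorph0 val : skew_val 0 = 0) invr0 mulr0.
    by rewrite [LHS](rmorphM val).
  have Tf a : f a \in T by apply/asboolP; exists (g a) => //; apply: S'g.
  by have /asboolP[z Sz /val_inj <-] := xT TS Tf.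
move=> S [phi [Ssub phi_i phiB phiM phiV]].
exists S, (fun x => skew_val (phi x)); split=> //.
- by move=> a; rewrite phi_i.
- by move=> x y Sx Sy; rewrite /= phiB // [LHS](rmorphB val).
- by move=> x y Sx Sy; rewrite /= phiM // [LHS](rmorphM val).
Qed.

(** In the local ring [S] an element with nonzero residue is a unit, so the Ore condition of
    [rinj_lift] holds with [a = 1] and [b = h * x^-1]. *)
Lemma rinj_specialization (L : unitRingType) (f : {rmorphism A -> L}) S phi
    p q (H : 'M[U]_(p, q)) :
  GRing.field_axiom U -> GRing.field_axiom L -> specialization i f S phi ->
  (forall j l, H j l \in S) -> rinj (map_mx phi H) -> rinj H.
Proof.
move=> UF LF [[Ssub Si] phi_i phiB phiM phiV] HS inj_phi.
have -> : H = map_mx (idfun : {rmorphism U -> U}) H by rewrite map_mx_id.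
have [S1 _ SM] := Ssub.
apply: (rinj_lift LF UF Ssub phiB phiM _ _ HS inj_phi).
  move=> x h Sx Sh phix; have [ux Sx'] := phiV _ Sx phix.
  exists 1, (h * x^-1); split=> //; first by apply: SM.
    by rewrite mul1r mulrVK.
  by rewrite -(rmorph1 i) phi_i rmorph1 oner_eq0.
move=> x Sx phix; have [ux _] := phiV _ Sx phix.
by apply: contraTneq ux => /= ->; rewrite unitr0.
Qed.

End Universality.

Lemma universal_singular (F : fieldType) n (U : unitRingType)
    (i : {rmorphism free_algebra F n -> U}) r (N : 'M[free_algebra F n]_r) :
  universal_field_of_fractions i -> ~ rinj (map_mx i N) -> singular N.
Proof.
move=> univ Ninj L f LF; have [UF _ _ _] := univ.
have [S [phi spec]] := universal_specialization univ f LF.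
have : ~ rinj (map_mx f N).
  apply: contra_not Ninj => Nf.
  have [[_ Si] phi_i _ _ _] := spec.
  apply: (rinj_specialization UF LF spec) => [j l|]; first by rewrite mxE.
  by rewrite (_ : map_mx phi _ = map_mx f N) //; apply/matrixP => j l; rewrite !mxE.
by move=> /existsNP[c /not_implyP[Nc /eqP c0]]; exists c.
Qed.

(* Cohn's description of the elements of [D] as [u N^-1 v], for matrices [N]
   over [A] that become invertible over [D]. *)
Section Localization.

Variables (A : nzRingType) (D : unitRingType) (B : nzRingType).
Variables (i : {rmorphism A -> D}) (rho : {rmorphism A -> B}).
Hypotheses (DF : GRing.field_axiom D) (epi : epic i).
Hypothesis rho_inv : forall r (N : 'M[A]_r), rinj (map_mx i N) -> minv (map_mx rho N).
Hypothesis rho_zero : forall r (N : 'M[A]_r) u v (y : 'cV_r) (Y : 'cV_r),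
  rinj (map_mx i N) -> map_mx i N *m y = map_mx i v ->
  (map_mx i u *m y) = 0 :> 'cV_1 ->
  map_mx rho N *m Y = map_mx rho v -> map_mx rho u *m Y = 0 :> 'cV_1.

Definition loc_rel (d : D) (M : B) : Prop :=
  exists r (N : 'M[A]_r) (u : 'rV[A]_r) (v : 'cV[A]_r) (y : 'cV[D]_r) (Y : 'cV[B]_r),
  [/\ rinj (map_mx i N), map_mx i N *m y = map_mx i v, map_mx i u *m y = d%:M,
      map_mx rho N *m Y = map_mx rho v & map_mx rho u *m Y = M%:M].

Lemma loc_rel_base a : loc_rel (i a) (rho a).
Proof.
exists 1%N, 1%:M, 1%:M, a%:M, (i a)%:M, (rho a)%:M; rewrite !map_mx1 !map_scalar_mx !mul1mx.
by split=> // c; rewrite mul1mx.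
Qed.

Lemma loc_relB d1 M1 d2 M2 : loc_rel d1 M1 -> loc_rel d2 M2 -> loc_rel (d1 - d2) (M1 - M2).
Proof.
move=> [r1 [N1 [u1 [v1 [y1 [Y1 [inj1 Ny1 uy1 NY1 uY1]]]]]]].
move=> [r2 [N2 [u2 [v2 [y2 [Y2 [inj2 Ny2 uy2 NY2 uY2]]]]]]].
exists (r1 + r2)%N, (block_mx N1 0 0 N2), (row_mx u1 (- u2)), (col_mx v1 v2),
  (col_mx y1 y2), (col_mx Y1 Y2).
rewrite !map_block_mx !map_row_mx !map_col_mx !map_mx0 !map_mxN !mul_block_col !mul_row_col.
rewrite !mul0mx !addr0 !add0r !mulNmx Ny1 Ny2 uy1 uy2 NY1 NY2 uY1 uY2 -!raddfB; split=> //.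
move=> c; rewrite -[c]vsubmxK mul_block_col !mul0mx addr0 add0r => /eqP.
by rewrite col_mx_eq0 => /andP[/eqP/inj1 -> /eqP/inj2 ->]; rewrite col_mx0.
Qed.

(** The block triangular system feeds [u2 *m y2 = d2] into the right-hand side of the first system,
    whose solution becomes [y1 d2]. *)
Lemma loc_relM d1 M1 d2 M2 : loc_rel d1 M1 -> loc_rel d2 M2 -> loc_rel (d1 * d2) (M1 * M2).
Proof.
move=> [r1 [N1 [u1 [v1 [y1 [Y1 [inj1 Ny1 uy1 NY1 uY1]]]]]]].
move=> [r2 [N2 [u2 [v2 [y2 [Y2 [inj2 Ny2 uy2 NY2 uY2]]]]]]].
exists (r1 + r2)%N, (block_mx N1 (- (v1 *m u2)) 0 N2), (row_mx u1 0), (col_mx 0 v2),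
  (col_mx (y1 *m d2%:M) y2), (col_mx (Y1 *m M2%:M) Y2).
rewrite !map_block_mx !map_row_mx !map_col_mx !map_mx0 !map_mxN !mul_block_col !mul_row_col.
rewrite !mul0mx !add0r !addr0 !map_mxM !mulNmx -!mulmxA uy2 uY2 !mulmxA Ny1 NY1 !subrr.
rewrite Ny2 NY2 uy1 uY1 -!scalar_mxM; split=> //.
move=> c; rewrite -[c]vsubmxK mul_block_col !mul0mx add0r => /eqP.
rewrite col_mx_eq0 => /andP[Nc /eqP/inj2 c2]; move: Nc.
by rewrite c2 mulmx0 addr0 => /eqP/inj1 ->; rewrite col_mx0.
Qed.

Lemma loc_relV d M : d != 0 -> loc_rel d M -> exists M', loc_rel d^-1 M'.
Proof.
move=> d0 [r [N [u [v [y [Y [injN Ny uy NY uY]]]]]]].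
(* Its Schur complement is [- d], so it is invertible over [D] exactly when [d] is nonzero, and the
   last diagonal entry of its inverse is [- d^-1]. *)
pose N' := block_mx N v u 0 : 'M_(r + 1).
have injN' : rinj (map_mx i N').
  move=> c; rewrite -[c]vsubmxK /N' map_block_mx mul_block_col map_mx0 mul0mx addr0 => /eqP.
  rewrite col_mx_eq0 => /andP[/eqP Nc /eqP uc].
  set c1 := usubmx c in Nc uc *; set c2 := dsubmx c in Nc *.
  have c1E : c1 = - (y *m c2).
    apply/eqP; rewrite -addr_eq0; apply/eqP/injN.
    by rewrite mulmxDr mulmxA Ny.
  have c20 : c2 = 0.
    apply/matrixP => a b; rewrite !ord1 [RHS]mxE.
    move: uc; rewrite c1E mulmxN mulmxA uy => /eqP; rewrite oppr_eq0 => /eqP/matrixP/(_ 0 0).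
    rewrite mul_scalar_mx !mxE => /(skew_mulf_eq0 DF)[] // d00.
    by rewrite d00 eqxx in d0.
  by rewrite c1E c20 mulmx0 oppr0 col_mx0.
have [G [NG _]] := rho_inv injN'.
pose Y' := G *m map_mx rho (col_mx 0 1%:M : 'cV_(r + 1)).
exists (- Y' (rshift r 0) 0); exists (r + 1)%N, N', (row_mx 0 (-1)%:M), (col_mx 0 1%:M).
exists (col_mx (y *m (d^-1)%:M) (- d^-1)%:M), Y'; split=> //.
- rewrite /N' map_block_mx mul_block_col map_mx0 mul0mx addr0 !mulmxA Ny uy.
  rewrite map_col_mx map_mx0 map_mx1 -scalar_mxM skew_mulrV //; congr col_mx.
  by rewrite -mulmxDr -raddfD subrr raddf0 mulmx0.
- rewrite map_row_mx map_mx0 mul_row_col mul0mx add0r map_scalar_mx rmorphN1.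
  by rewrite -scalar_mxM mulN1r opprK.
- by rewrite /Y' mulmxA NG mul1mx.
rewrite map_row_mx map_mx0 -[Y']vsubmxK mul_row_col mul0mx add0r map_scalar_mx rmorphN1.
rewrite col_mxEd; apply/matrixP => a b; rewrite !ord1 mul_scalar_mx !mxE mulN1r mulr1n //.
Qed.

Lemma loc_rel_uniq d M M' : loc_rel d M -> loc_rel d M' -> M = M'.
Proof.
move=> dM dM'; have := loc_relB dM dM'; rewrite subrr.
move=> [r [N [u [v [y [Y [injN Ny uy NY uY]]]]]]].
apply/eqP; rewrite -subr_eq0; apply/eqP.
move: uY; rewrite (rho_zero injN Ny _ NY) ?uy ?raddf0 //.
by move/matrixP/(_ 0 0); rewrite !mxE.
Qed.

Lemma loc_rel_total d : exists M, loc_rel d M.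
Proof.
pose S : {pred D} := fun d => `[< exists M, loc_rel d M >].
suff : d \in S by move/asboolP.
apply: epi => [|a]; last by apply/asboolP; exists (rho a); apply: loc_rel_base.
split=> [|x y /asboolP[M xM] /asboolP[M' yM']|x y /asboolP[M xM] /asboolP[M' yM']]; apply/asboolP.
- by exists 1; have := loc_rel_base 1; rewrite !rmorph1.
- by exists (M - M'); apply: loc_relB.
have [->|y0] := eqVneq y 0.
  by rewrite invr0 mulr0; exists 0; have := loc_rel_base 0; rewrite !rmorph0.
have [M'' yM''] := loc_relV y0 yM'.
by exists (M * M''); apply: loc_relM.
Qed.

Lemma localization : exists Psi : {rmorphism D -> B}, forall a, Psi (i a) = rho a.
Proof.
have /choice[Psi PsiP] := loc_rel_total.
have PB : zmod_morphism Psi.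
  by move=> x y; apply: loc_rel_uniq (PsiP _) (loc_relB (PsiP x) (PsiP y)).
have PM : monoid_morphism Psi.
  split=> [|x y]; last by apply: loc_rel_uniq (PsiP _) (loc_relM (PsiP x) (PsiP y)).
  by have := loc_rel_base 1; rewrite !rmorph1; apply: loc_rel_uniq.
pose P' : {rmorphism D -> B} := HB.pack Psi
  (GRing.isZmodMorphism.Build D B Psi PB) (GRing.isMonoidMorphism.Build D B Psi PM).
by exists P' => a; apply: loc_rel_uniq (PsiP _) (loc_rel_base a).
Qed.

End Localization.

Lemma map_minv (B C : nzRingType) (f : {rmorphism B -> C}) q (H : 'M[B]_q) :
  minv H -> minv (map_mx f H).
Proof.
by move=> [H' [HH' H'H]]; exists (map_mx f H'); rewrite -!map_mxM HH' H'H !map_mx1.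
Qed.

Section Flatten.

Variables (B : nzRingType) (r q : nat).

Definition flat (N : 'M['M[B]_q.+1]_r) : 'M_(\sum_(i < r) q.+1) := \mxblock_(i, j) N i j.

Lemma flat_minv N : minv N <-> minv (flat N).
Proof.
have flatM (M M' : 'M['M[B]_q.+1]_r) : flat (M *m M') = flat M *m flat M'.
  rewrite mul_mxblock; apply: eq_mxblock => i j.
  by rewrite mxE; apply: eq_bigr => l _.
have flatK (M : 'M[B]_(\sum_(i < r) q.+1)) : flat (\matrix_(i, j) submxblock M i j) = M.
  by rewrite -[RHS]submxblockK; apply: eq_mxblock => i j; rewrite mxE.
have flat1 : flat 1%:M = 1%:M.
  by rewrite -[LHS]mulmx1 -[in LHS](flatK 1%:M) -flatM mul1mx flatK.
have flatI : injective flat.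
  move=> M M' MM'; apply/matrixP => i j.
  by rewrite -[LHS](mxblockK (fun i j => M i j)) -/(flat M) MM' mxblockK.
split=> [[M [NM MN]]|[M [NM MN]]].
  by exists (flat M); rewrite -!flatM NM MN flat1.
exists (\matrix_(i, j) submxblock M i j).
by split; apply: flatI; rewrite flatM flatK flat1.
Qed.

End Flatten.

(** [H] remains injective over the sub-skew-field, hence has an inverse there, and inverses are
    unique. *)
Lemma minv_divring (K : unitRingType) (S : {pred K}) q (H H' : 'M[K]_q) :
  GRing.field_axiom K -> GRing.divring_closed S -> (forall i j, H i j \in S) ->
  H *m H' = 1%:M -> H' *m H = 1%:M -> forall i j, H' i j \in S.
Proof.
move=> KF HS SH HH' H'H i j.
pose H0 : 'M[sub_skew HS]_q := \matrix_(i, j) SubSkew (SH i j : H i j \in skew_pred HS).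
have H0E : map_mx val H0 = H by apply/matrixP => l l'; rewrite !mxE.
have [|G [HG _]] := @rinj_minv _ (sub_skew_field KF) q H0.
  move=> c H0c; apply/matrixP => l l'; apply: val_inj; rewrite [in RHS]mxE.
  have : map_mx val c = 0.
    by rewrite -[LHS]mul1mx -H'H -mulmxA -H0E -map_mxM H0c map_mx0 mulmx0.
  by move/matrixP/(_ l l'); rewrite !mxE.
have : map_mx val G = H'.
  by rewrite -[LHS]mul1mx -H'H -H0E -mulmxA -map_mxM HG map_mx1 mulmx1.
by move/matrixP/(_ i j) => <-; rewrite mxE; apply: valP (G i j).
Qed.

Section Intertwine.

Variables (A B : nzRingType) (D : unitRingType) (i : {rmorphism A -> D}).
Hypotheses (DF : GRing.field_axiom D) (epi : epic i).

Lemma epic_intertwine (f g : {rmorphism D -> B}) (c : B) :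
  (forall a, f (i a) * c = c * g (i a)) -> forall d, f d * c = c * g d.
Proof.
move=> fg d; pose S : {pred D} := fun d => f d * c == c * g d.
suff /eqP : d \in S by [].
apply: epi => [|a]; last by apply/eqP/fg.
split=> [|x y /eqP xS /eqP yS|x y /eqP xS /eqP yS]; rewrite /S unfold_in.
- by rewrite !rmorph1 mulr1 mul1r.
- by rewrite !rmorphB mulrBl mulrBr xS yS.
have [->|y0] := eqVneq y 0; first by rewrite invr0 mulr0 !rmorph0 mulr0 mul0r.
rewrite !rmorphM -mulrA (_ : f y^-1 * c = c * g y^-1); first by rewrite mulrA xS mulrA.
rewrite -[LHS]mulr1 -(rmorph1 g) -(skew_mulrV DF y0) rmorphM !mulrA -(mulrA (f _)) -yS.
by rewrite mulrA -rmorphM skew_mulVr // rmorph1 mul1r.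
Qed.

End Intertwine.

(** * Extension of a representation of the free algebra to its skew field of fractions *)

Section Transfer.

Variables (F : fieldType) (n q : nat) (D K E : unitRingType).
Local Notation A := (free_algebra F n).
Hypothesis two_neq0 : 2%:R != 0 :> F.
Variable iD : {rmorphism A -> D}.
Hypothesis univD : universal_field_of_fractions iD.
Hypotheses (KF : GRing.field_axiom K) (EF : GRing.field_axiom E).
Variables (T : {rmorphism D -> 'M[K]_q.+1}) (rho : {rmorphism A -> 'M[E]_q.+1}).
Variable k : {rmorphism F -> E}.
Hypotheses (kC : forall c x, k c * x = x * k c) (rho_k : forall c, rho c%:A = (k c)%:M).
Variables (A' : nzRingType) (i : {rmorphism A' -> E}) (f : {rmorphism A' -> K}).
Variables (S : {pred E}) (phi : E -> K).
Hypothesis spec : specialization i f S phi.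
Hypothesis rhoS : forall u j l, rho u j l \in S.
Hypothesis phi_rho : forall u, map_mx phi (rho u) = T (iD u).

(** The image under [T] of an invertible matrix over [D] is invertible, and it is the specialization
    of the image under [rho]. *)
Lemma transfer_inv r (N : 'M[A]_r) : rinj (map_mx iD N) -> minv (map_mx rho N).
Proof.
have [DF _ _ _] := univD.
move=> /(rinj_minv DF)/(map_minv T)/flat_minv/minv_rinj injT.
apply/flat_minv; apply: (rinj_minv EF).
apply: (rinj_specialization EF KF spec) => [j l|]; first by rewrite !mxE.
suff -> : map_mx phi (flat (map_mx rho N)) = flat (map_mx T (map_mx iD N)) by [].
by apply/matrixP => j l; rewrite !mxE -phi_rho mxE.
Qed.

(** The bordered matrix is singular over [D], so its image under [rho] kills a block column
    [(W1, W2)] of full rank. Invertibility of [rho N] gives [W1 = - Y W2]; hence the square block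
    [W2] is itself injective, and it can be cancelled from [u Y W2 = 0]. *)
Lemma transfer_zero r (N : 'M[A]_r) (u : 'rV_r) (v : 'cV_r) (y : 'cV_r) (Y : 'cV_r) :
  rinj (map_mx iD N) -> map_mx iD N *m y = map_mx iD v ->
  (map_mx iD u *m y) = 0 :> 'cV_1 ->
  map_mx rho N *m Y = map_mx rho v -> map_mx rho u *m Y = 0 :> 'cV_1.
Proof.
move=> injN Ny uy NY; pose N' : 'M_(r + 1) := block_mx N v u 0.
have injN' : ~ rinj (map_mx iD N').
  move=> injN'; have : col_mx y (-1)%:M = 0.
    apply: injN'; rewrite map_block_mx mul_block_col map_mx0 mul0mx addr0 Ny uy.
    by rewrite raddfN mulmxN mulmx1 subrr col_mx0.
  move/(congr1 dsubmx)/matrixP/(_ 0 0); rewrite col_mxKd !mxE mulr1n.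
  by move/eqP; rewrite oppr_eq0 oner_eq0.
have singN' := universal_singular univD injN'.
have [U [injU NU]] := kernel_dim_geP two_neq0 singN' EF kC rho_k.
pose W : 'M['M[E]_q.+1]_(r + 1, 1) := \col_j U j.
have : map_mx rho N' *m W = 0.
  apply/matrixP => j z; rewrite mxE [RHS]mxE -[RHS](NU j).
  by apply: eq_bigr => l _; rewrite !mxE.
rewrite -[W]vsubmxK map_block_mx mul_block_col map_mx0 mul0mx addr0.
set W1 := usubmx W; set W2 := dsubmx W => /eqP.
rewrite col_mx_eq0 => /andP[/eqP NW /eqP uW].
have [G [_ GN]] := transfer_inv injN.
have W1E : W1 = - (Y *m W2).
  apply/eqP; rewrite -addr_eq0; apply/eqP.
  by rewrite -[LHS]mul1mx -GN -mulmxA mulmxDr [map_mx rho N *m (_ *m _)]mulmxA NY NW mulmx0.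
have inj2 : rinj (W2 0 0).
  move=> c c0; apply: injU => j.
  have -> : U j = W j 0 by rewrite mxE.
  rewrite -[W]vsubmxK -/W1 -/W2 W1E; case: (fintype.splitP j) => l jl.
    have -> : j = lshift 1 l by apply: val_inj.
    by rewrite col_mxEu mxE mxE big_ord1 mulNmx -mulmxA c0 mulmx0 oppr0.
  have -> : j = rshift r l by apply: val_inj.
  by rewrite col_mxEd ord1.
have [V [W2V _]] := rinj_minv EF inj2.
move: uW; rewrite W1E mulmxN mulmxA => /eqP; rewrite oppr_eq0 => /eqP/matrixP/(_ 0 0).
rewrite [LHS]mxE big_ord1 [RHS]mxE => uYW; apply/matrixP => z z'; rewrite !ord1 [RHS]mxE.
by rewrite -[LHS]mulmx1 -W2V mulmxA [X in X *m _]uYW mul0mx.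
Qed.

Lemma transfer : exists Psi : {rmorphism D -> 'M[E]_q.+1}, forall u, Psi (iD u) = rho u.
Proof.
have [DF _ epi _] := univD.
exact: (localization DF epi transfer_inv transfer_zero).
Qed.

End Transfer.

(** * Generic points *)

Section GenericPoint.

Variables (F : numFieldType) (n : nat).

Lemma poly_nonroot (p : {poly F}) : p != 0 -> exists s, p.[s] != 0.
Proof.
move=> p0; pose rs : seq F := [seq i%:R | i <- iota 0 (size p)].
have Urs : uniq rs by rewrite map_inj_uniq ?iota_uniq // => i j /eqP; rewrite eqr_nat => /eqP.
have /allPn[s _ ps] : ~~ all (root p) rs.
  by apply/negP => /(max_poly_roots p0)/(_ Urs); rewrite size_map size_iota ltnn.
by exists s.
Qed.

Definition moment_curve (s : F) : 'rV[F]_n := \row_j s ^+ j.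

(** On the moment curve, the equation of each hyperplane becomes a nonzero polynomial in one
    variable, and the product of finitely many of them has a nonroot. *)
Lemma moment_curve_avoid (I : finType) (P : pred I) (v : I -> 'cV[F]_n) :
  (forall i, P i -> v i != 0) ->
  exists s, forall i, P i -> moment_curve s *m v i != 0.
Proof.
move=> v0; pose p i := \poly_(j < n) (if insub j is Some j' then v i j' 0 else 0).
have pE i s : (p i).[s] = (moment_curve s *m v i) 0 0.
  rewrite horner_poly mxE; apply: eq_bigr => j _.
  by rewrite valK mxE mulrC.
have p0 i : P i -> p i != 0.
  move=> /v0; apply: contraNneq => pi0; apply/eqP/matrixP => j k.
  have := congr1 (fun q : {poly F} => q`_j) pi0.
  by rewrite coef_poly ltn_ord valK coef0 !mxE ord1.
have [|s ps] := @poly_nonroot (\prod_(i | P i) p i); first by apply/prodf_neq0.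
exists s => i Pi; apply: contra ps => /eqP si0.
by rewrite horner_prod; apply/prodf_eq0; exists i; rewrite // pE si0 mxE.
Qed.

Lemma generic_point (gT : finGroupType) (G : {group gT}) (rG : mx_representation F G n) :
  (0 < n)%N -> mx_faithful rG ->
  exists (x0 : 'cV[F]_n) (lam : 'rV[F]_n), [/\ forall i : 'I_n, i = 0 :> nat -> x0 i 0 = 1,
    lam *m x0 = 1%:M & {in G, forall g, g != 1%g -> lam *m (rG g *m x0) != 1%:M}].
Proof.
move=> n0 faith; pose i0 := Ordinal n0.
have rG1 g : g \in G -> g != 1%g -> rG g - 1%:M != 0.
  move=> Gg; apply: contraNneq => /eqP; rewrite subr_eq0 => /eqP rg1.
  by rewrite -in_set1 (subsetP faith) // inE Gg mul1mx rg1 eqxx.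
(* First use of the curve: a vector [x0] moved by every nontrivial element of [G], with first
   coordinate [s ^+ 0 = 1]. *)
pose P (ig : 'I_n * gT) := (ig.2 \in G) && (row ig.1 (rG ig.2 - 1%:M) != 0).
have [|s sP] := @moment_curve_avoid _ P (fun ig => (row ig.1 (rG ig.2 - 1%:M))^T).
  by move=> [i g] /andP[_]; rewrite trmx_eq0.
pose x0 := (moment_curve s)^T.
have x01 (i : 'I_n) : i = 0 :> nat -> x0 i 0 = 1 by move=> i0E; rewrite !mxE i0E.
have x00 : x0 != 0.
  by apply: contra_eq_neq (x01 i0 erefl) => ->; rewrite mxE eq_sym oner_eq0.
have gx0 g : g \in G -> g != 1%g -> rG g *m x0 - x0 != 0.
  move=> Gg /(rG1 g Gg) rg; rewrite -[X in _ - X]mul1mx -mulmxBl.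
  have [i ri] : exists i, row i (rG g - 1%:M) != 0.
    apply/existsP; apply: contraR rg; rewrite negb_exists => /forallP ri.
    apply/eqP/row_matrixP => i; rewrite row0; apply/eqP.
    by have := ri i; rewrite negbK.
  have := sP (i, g); rewrite /P /= Gg ri => /(_ isT); apply: contraNneq => /(congr1 (row i)).
  by rewrite row0 row_mul -[moment_curve s]trmxK -trmx_mul => ->; rewrite trmx0.
(* Second use: a form that is nonzero at [x0] and at all differences [g x0 - x0]; dividing it by its
   value at [x0] gives [lam]. *)
have [|t tP] := @moment_curve_avoid gT (fun g => g \in G)
    (fun g => if g == 1%g then x0 else rG g *m x0 - x0).
  by move=> g Gg; have [_ //|g1] := eqVneq g 1%g; exact: gx0 g Gg g1.
have t0 : (moment_curve t *m x0) 0 0 != 0.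
  have := tP 1%g (group1 G); rewrite eqxx; apply: contra => /eqP t0.
  by apply/eqP/matrixP => i j; rewrite !ord1 t0 mxE.
exists x0, (((moment_curve t *m x0) 0 0)^-1 *: moment_curve t); split=> // [|g Gg g1].
  rewrite -scalemxAl; apply/matrixP => i j; rewrite !ord1 [LHS]mxE mulVf //.
  by rewrite mxE.
have := tP g Gg; rewrite (negPf g1); apply: contra => /eqP.
rewrite -scalemxAl => /(congr1 ( *:%R ((moment_curve t *m x0) 0 0))).
rewrite scalerA divff // scale1r mulmxBr => ->.
by rewrite scalemx1 -mx11_scalar subrr.
Qed.

End GenericPoint.

(** * The fixed skew field *)

Section LinearForm.

Variables (F : fieldType) (L : lmodType F) (n : nat) (x : 'I_n -> L).

Definition lin_comb (v : 'cV[F]_n) : L := \sum_j v j 0 *: x j.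

Lemma lin_combD : {morph lin_comb : u v / u + v}.
Proof. by move=> u v; rewrite -big_split; apply: eq_bigr => j _; rewrite !mxE scalerDl. Qed.

Lemma lin_combZ c v : lin_comb (c *: v) = c *: lin_comb v.
Proof. by rewrite scaler_sumr; apply: eq_bigr => j _; rewrite mxE scalerA. Qed.

Lemma lin_comb_delta i : lin_comb (delta_mx i 0) = x i.
Proof.
rewrite /lin_comb (bigD1 i) //= mxE !eqxx scale1r big1 ?addr0 // => j /negPf ji.
by rewrite mxE ji scale0r.
Qed.

End LinearForm.

Section GaloisDescent.

Variables (F : fieldType) (gT : finGroupType) (G : {group gT}) (p q : nat).
Variable rG : mx_representation F G p.+1.
Hypothesis oG : #|G| = q.+1.
Variables (x0 : 'cV[F]_p.+1) (lam : 'rV[F]_p.+1).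
Hypothesis x01 : x0 0 0 = 1.
Hypothesis lam1 : lam *m x0 = 1%:M.
Hypothesis lamG : {in G, forall g, g != 1%g -> lam *m (rG g *m x0) != 1%:M}.

Local Notation A := (free_algebra F p.+1).
Local Notation lin_form := (lin_comb (@free_gen F p.+1)).

Definition grp_elt (i : 'I_q.+1) : gT := enum_val (cast_ord (esym oG) i).
Definition grp_idx (g : gT) : 'I_q.+1 := cast_ord oG (enum_rank_in (group1 G) g).
Local Notation el := grp_elt.
Local Notation idx := grp_idx.
Local Notation one := (idx 1%g).

Lemma grp_eltP i : el i \in G. Proof. exact: enum_valP. Qed.
Lemma grp_eltK : cancel el idx.
Proof. by move=> i; apply: val_inj; rewrite /= enum_valK_in. Qed.
Lemma grp_idxK : {in G, cancel idx el}.
Proof. by move=> g Gg; rewrite /el cast_ordK enum_rankK_in. Qed.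
Local Hint Resolve grp_eltP : core.

Definition shift g l := idx (g * el l)%g.

Lemma el_shift g l : g \in G -> el (shift g l) = (g * el l)%g.
Proof. by move=> Gg; rewrite /shift grp_idxK ?groupM. Qed.

Lemma shiftM g h l : h \in G -> shift g (shift h l) = shift (g * h)%g l.
Proof. by move=> Gh; rewrite {1}/shift el_shift // mulgA. Qed.

Lemma shiftK g : g \in G -> cancel (shift g) (shift g^-1%g).
Proof. by move=> Gg l; rewrite shiftM // mulVg /shift mul1g grp_eltK. Qed.

Lemma shift_inj g : g \in G -> injective (shift g).
Proof. by move=> Gg; apply: can_inj (shiftK Gg). Qed.

(** The standard basis with its first vector replaced by [x0]; the matrix is unitriangular by
    [x01]. *)
Definition basis_mx : 'M[F]_p.+1 := \matrix_(i, j) if j == 0 then x0 i 0 else (i == j)%:R.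

Lemma basis_mx_unit : basis_mx \in unitmx.
Proof.
rewrite unitmxE det_trig; last first.
  apply/is_trig_mxP => i j ij; rewrite !mxE (_ : j == 0 = false); last first.
    by apply/eqP => j0; rewrite j0 in ij.
  by rewrite (_ : i == j = false) //; apply/eqP => E; rewrite E ltnn in ij.
rewrite big1 ?unitr1 // => i _; rewrite mxE eqxx.
by case: eqP => // ->.
Qed.

Definition coord (v : 'cV[F]_p.+1) : 'cV[F]_p.+1 := invmx basis_mx *m v.

Lemma coord_basis j : coord (col j basis_mx) = delta_mx j 0.
Proof. by rewrite /coord colE mulmxA mulVmx ?basis_mx_unit // mul1mx. Qed.

Lemma col0_basis : col 0 basis_mx = x0.
Proof. by apply/matrixP => i j; rewrite ord1 !mxE. Qed.

Section Regular.

Variables (B : nzRingType) (k : {rmorphism F -> B}).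
Hypothesis kC : forall c b, k c * b = b * k c.
Variable c : 'M[B]_(q.+1, p.+1).

Definition reg_coef h v : B := \sum_j k (coord v j 0) * c h j.
(* If [x_j e_1 = sum_h e_h c_(h,j)] in a right module with basis [(e_h)_h] on
   which [G] acts semilinearly by [g e_h = e_(gh)], this is the matrix of the left
   multiplication by the linear form of [v]. *)
Definition reg_mx v : 'M[B]_q.+1 := \matrix_(l, t)
  reg_coef (shift (el t)^-1%g l) (rG (el t)^-1%g *m v).

Lemma reg_mx_sum v : reg_mx v = \sum_j (k (v j 0))%:M *m reg_mx (delta_mx j 0).
Proof.
apply/matrixP => l t; rewrite mxE summxE.
rewrite (eq_bigr (fun j => \sum_i k (v j 0) * (k (coord (rG (el t)^-1%g *m delta_mx j 0) i 0) *
  c (shift (el t)^-1%g l) i))); last first.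
  by move=> j _; rewrite mul_scalar_mx !mxE -mulr_sumr.
rewrite exchange_big; apply: eq_bigr => i _ /=.
transitivity (k (\sum_j v j 0 * coord (rG (el t)^-1%g *m delta_mx j 0) i 0) *
  c (shift (el t)^-1%g l) i).
  congr (k _ * _); rewrite [v in LHS]matrix_sum_delta.
  under eq_bigr => j _ do rewrite big_ord1.
  rewrite mulmx_sumr /coord mulmx_sumr summxE; apply: eq_bigr => j _.
  by rewrite -!scalemxAr mxE.
rewrite rmorph_sum mulr_suml; apply: eq_bigr => j _.
by rewrite rmorphM mulrA.
Qed.

Lemma regular_hom : exists rho : {rmorphism A -> 'M[B]_q.+1},
  (forall a, rho a%:A = (k a)%:M) /\ (forall v, rho (lin_form v) = reg_mx v).
Proof.
pose km : {rmorphism F -> 'M[B]_q.+1} := @scalar_mx _ _ \o k.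
have kmC a (M : 'M[B]_q.+1) : km a * M = M * km a.
  by apply: scalar_mx_central => b; apply: kC.
have [rho [rhok rhox]] := free_hom (fun j => reg_mx (delta_mx j 0)) kmC.
exists rho; split=> // v; rewrite [RHS]reg_mx_sum rmorph_sum; apply: eq_bigr => j _.
by rewrite -mulr_algl rmorphM rhok rhox.
Qed.

End Regular.

(** * A normal basis of [D] over the fixed skew field, and generators of the latter *)

Variables (D : unitAlgType F) (iD : {rmorphism A -> D}) (a : gT -> {lrmorphism D -> D}).
Hypothesis iDk : forall c, iD c%:A = c%:A.
Hypothesis univD : universal_field_of_fractions iD.
Hypothesis a1 : a 1%g =1 id.
Hypothesis aM : {in G &, forall g h, a (g * h)%g =1 a g \o a h}.
Hypothesis act_gen : {in G, forall g i,
  a g (iD (free_gen F i)) = \sum_j rG g j i *: iD (free_gen F j)}.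

Local Notation xD := (lin_comb (fun j => iD (free_gen F j))).

Lemma D_field : GRing.field_axiom D. Proof. by have [] := univD. Qed.
Local Notation DF := D_field.

Lemma lin_formE v : iD (lin_form v) = xD v.
Proof.
by rewrite rmorph_sum; apply: eq_bigr => j _; rewrite -mulr_algl rmorphM iDk mulr_algl.
Qed.

Lemma act_lin g v : g \in G -> a g (xD v) = xD (rG g *m v).
Proof.
move=> Gg; transitivity (\sum_j v j 0 *: a g (iD (free_gen F j))).
  by rewrite [LHS]raddf_sum; apply: eq_bigr => j _; apply: linearZ.
transitivity (\sum_j \sum_i (rG g i j * v j 0) *: iD (free_gen F i)).
  apply: eq_bigr => j _; rewrite act_gen // scaler_sumr.
  by apply: eq_bigr => i _; rewrite scalerA mulrC.
rewrite exchange_big; apply: eq_bigr => i _ /=.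
by rewrite mxE scaler_suml.
Qed.

(* [sigma_inv] plays the role of a normal basis: its values are permuted by [G],
   and form a basis of [D] over the fixed skew field. *)
Definition sigma_shift g : D := xD (rG g *m x0) - 1.
Definition sigma_inv g : D := (sigma_shift g)^-1.
Local Notation y_ := sigma_shift.
Local Notation e_ := sigma_inv.

Lemma eval_point (mu : 'rV[F]_p.+1) : exists f : {rmorphism A -> F},
  forall v, f (lin_form v) = (mu *m v) 0 0.
Proof.
have [//|f [fk fx]] := free_hom (k := idfun : {rmorphism F -> F}) (fun j => mu 0 j).
  by move=> c b; rewrite mulrC.
exists f => v; rewrite rmorph_sum mxE; apply: eq_bigr => j _.
by rewrite -mulr_algl rmorphM fk fx /= mulrC.
Qed.

Lemma sigma_shift_neq0 g : y_ g != 0.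
Proof.
have [_ iD_inj _ _] := univD; rewrite subr_eq0.
apply: contraTneq (oner_neq0 F) => xg; have [f fE] := eval_point 0.
have l1 : lin_form (rG g *m x0) = 1 by apply: iD_inj; rewrite lin_formE xg rmorph1.
by rewrite negbK -(rmorph1 f) -l1 fE mul0mx mxE.
Qed.

Lemma sigma_shift_unit g : y_ g \is a GRing.unit.
Proof. exact/DF/sigma_shift_neq0. Qed.

Lemma act_sigma_shift g h : g \in G -> h \in G -> a g (y_ h) = y_ (g * h)%g.
Proof.
by move=> Gg Gh; rewrite /sigma_shift [LHS]rmorphB rmorph1 /= act_lin // repr_mxM // -mulmxA.
Qed.

Lemma act_sigma_inv g h : g \in G -> h \in G -> a g (e_ h) = e_ (g * h)%g.
Proof. move=> Gg Gh; rewrite /sigma_inv -(act_sigma_shift Gg Gh).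
exact/rmorphV/sigma_shift_unit. Qed.

(* At the point [lam] the first factor vanishes and only [e_ 1] has a pole. *)
Lemma sigma_inv_mx_inj : rinj (\matrix_(h, l) e_ (el h * el l)%g : 'M[D]_q.+1).
Proof.
have [f fE] := eval_point lam.
have FF : GRing.field_axiom F by move=> x; rewrite unitfE.
have [S [phi spec]] := universal_specialization univD f FF.
have [[Ssub Si] phi_i phiB phiM phiV] := spec; have [S1 SB SM] := Ssub.
have yE g : y_ g = iD (lin_form (rG g *m x0) - 1) by rewrite rmorphB rmorph1 lin_formE.
have phi1 : phi 1 = 1 by rewrite -(rmorph1 iD) phi_i rmorph1.
have Sy g : y_ g \in S by rewrite yE.
have phiy g : phi (y_ g) = (lam *m (rG g *m x0)) 0 0 - 1.
  by rewrite yE phi_i rmorphB rmorph1 fE.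
have phiy1 : phi (y_ 1%g) = 0 by rewrite phiy repr_mx1 mul1mx lam1 mxE subrr.
have Se g : g \in G -> g != 1%g -> e_ g \in S.
  move=> Gg g1; have [|//] := phiV (y_ g) (Sy g).
  rewrite phiy subr_eq0; apply: contra (lamG Gg g1) => /eqP lg.
  by apply/eqP; rewrite [LHS]mx11_scalar lg.
(* Inverting the column index brings [e_ 1] to the diagonal, where the factor [y_ 1] turns it into
   1. Off the diagonal [e_] is finite at [lam] and [y_ 1] vanishes there, so [H] specializes to the
   identity. *)
pose H : 'M[D]_q.+1 := \matrix_(h, l) (y_ 1%g * e_ (el h * (el l)^-1)%g).
have neq h l : h != l -> (el h * (el l)^-1 != 1)%g.
  by apply: contra_neq => hl; apply/(can_inj grp_eltK)/(mulIg (el l)^-1%g); rewrite hl mulgV.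
have HS h l : H h l \in S.
  rewrite mxE; have [->|hl] := eqVneq h l.
    by rewrite mulgV /e_ mulrV // sigma_shift_unit.
  by apply: SM => //; apply: Se; [rewrite groupM ?groupV | apply: neq].
have Hinj : rinj H.
  apply: (rinj_specialization DF FF spec HS).
  have -> : map_mx phi H = 1%:M.
    apply/matrixP => h l; rewrite !mxE; have [->|hl] := eqVneq h l.
      by rewrite mulgV /e_ mulrV ?sigma_shift_unit.
    by rewrite phiM ?phiy1 ?mul0r //; apply: Se; [rewrite groupM ?groupV | apply: neq].
  by move=> c; rewrite mul1mx.
move=> c Hc; pose inv l := idx (el l)^-1%g.
have invK : involutive inv by move=> l; rewrite /inv grp_idxK ?groupV // invgK grp_eltK.
suff : row_perm (perm (inv_inj invK)) c = 0.
  move=> c0; apply/matrixP => l z; rewrite -(invK l) [RHS]mxE.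
  by have /matrixP/(_ (inv l) z) := c0; rewrite !mxE permE.
apply: Hinj; apply/matrixP => h z; have /matrixP/(_ h z) := Hc.
rewrite !mxE => Hch; rewrite -[RHS](mulr0 (y_ 1%g)) -[X in _ = _ * X]Hch.
rewrite (reindex_inj (inv_inj invK)) mulr_sumr; apply: eq_bigr => l _ /=.
by rewrite !mxE permE invK mulrA /inv grp_idxK ?groupV // invgK.
Qed.

Definition fixed : {pred D} := fun d => [forall g, (g \in G) ==> (a g d == d)].

Lemma fixedP d : reflect {in G, forall g, a g d = d} (d \in fixed).
Proof.
apply: (iffP forallP) => [fd g Gg|fd g]; first by have /implyP/(_ Gg)/eqP := fd g.
by apply/implyP => Gg; apply/eqP/fd.
Qed.

Lemma fixed_closed : GRing.divring_closed fixed.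
Proof.
split=> [|x y /fixedP fx /fixedP fy|x y /fixedP fx /fixedP fy]; apply/fixedP => g Gg.
- by rewrite rmorph1.
- by rewrite rmorphB /= fx ?fy.
have [->|y0] := eqVneq y 0; first by rewrite invr0 mulr0 rmorph0.
by rewrite rmorphM /= fx // rmorphV /= ?fy //; apply: DF.
Qed.

Local Notation K := (sub_skew fixed_closed).

Lemma fixed_field : GRing.field_axiom K. Proof. exact: sub_skew_field DF. Qed.
Local Notation KF := fixed_field.

Definition sigma_row : 'rV[D]_q.+1 := \row_l e_ (el l).

Lemma act_sigma_row r (X : 'M[D]_(q.+1, r)) h j :
  ((\matrix_(h, l) e_ (el h * el l)%g) *m map_mx (a (el h)) X) h j =
  a (el h) ((sigma_row *m X) 0 j).
Proof.
rewrite !mxE [RHS]rmorph_sum; apply: eq_bigr => l _ /=.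
by rewrite !mxE [RHS]rmorphM /= act_sigma_inv.
Qed.

(** Fixed coordinates satisfy all the conjugates of the equation, and together these form a system
    whose matrix is invertible by [sigma_inv_mx_inj]. *)
Lemma sigma_row_inj r (X X' : 'M[K]_(q.+1, r)) :
  sigma_row *m map_mx val X = sigma_row *m map_mx val X' -> X = X'.
Proof.
move=> XX'; have [M' [_ M'M]] := rinj_minv DF sigma_inv_mx_inj.
have fixX (Y : 'M[K]_(q.+1, r)) h : map_mx (a (el h)) (map_mx val Y) = map_mx val Y.
  by apply/matrixP => l j; rewrite !mxE; have /fixedP-> := valP (Y l j).
have : map_mx val X = map_mx val X'.
  rewrite -[LHS]mul1mx -[RHS]mul1mx -M'M -!mulmxA; congr (_ *m _).
  apply/matrixP => h j.
  by rewrite -(fixX X h) -(fixX X' h) !act_sigma_row XX'.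
move=> XX'v; apply/matrixP => l j; apply: val_inj.
by have /matrixP/(_ l j) := XX'v; rewrite !mxE.
Qed.

(** The system of all the conjugates of the equation has a unique solution over [D]. An element of
    [G] permutes the equations, hence fixes the solution. *)
Lemma sigma_row_span r (d : 'rV[D]_r) :
  exists X : 'M[K]_(q.+1, r), sigma_row *m map_mx val X = d.
Proof.
have [M' [MM' M'M]] := rinj_minv DF sigma_inv_mx_inj.
set M := \matrix_(_, _) _ in MM' M'M.
have Me h l : M h l = e_ (el h * el l)%g by rewrite mxE.
pose Z : 'M[D]_(q.+1, r) := \matrix_(h, j) a (el h) (d 0 j).
pose X0 := M' *m Z; have MX0 : M *m X0 = Z by rewrite mulmxA MM' mul1mx.
have X0fix l j : X0 l j \in skew_pred fixed_closed.
  apply/fixedP => g Gg.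
  have : map_mx (a g) X0 = X0.
    rewrite -[LHS]mul1mx -M'M -mulmxA; congr (_ *m _); apply/matrixP => h j'.
    have [k kE] : exists k, el h = (g * el k)%g.
      by exists (idx (g^-1 * el h)%g); rewrite grp_idxK ?groupM ?groupV // mulKVg.
    have /matrixP/(_ k j')/(congr1 (a g)) := MX0.
    rewrite ![in X in _ = X -> _]mxE -[X in _ = X -> _]/((a g \o a (el k)) _) -aM // -kE.
    move=> ME; rewrite [RHS]mxE -ME !mxE [RHS]rmorph_sum; apply: eq_bigr => l' _ /=.
    by rewrite !Me [X in _ * X]mxE [RHS]rmorphM /= act_sigma_inv ?groupM // mulgA kE.
  by move/matrixP/(_ l j); rewrite mxE.
exists (\matrix_(l, j) SubSkew (X0fix l j)); apply/matrixP => z j; rewrite ord1.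
have /matrixP/(_ one j) := MX0; rewrite [in X in _ = X -> _]mxE grp_idxK // a1 => <-.
rewrite [LHS]mxE [RHS]mxE; apply: eq_bigr => l _.
by rewrite Me grp_idxK // mul1g [sigma_row _ _]mxE [X in _ * X = _]mxE [X in val X]mxE.
Qed.

Definition lmul_mx d : 'M[K]_q.+1 := projT1 (cid (sigma_row_span (d%:M *m sigma_row))).

Lemma lmul_mxE d : sigma_row *m map_mx val (lmul_mx d) = d%:M *m sigma_row.
Proof. by rewrite /lmul_mx; case: cid. Qed.

Fact lmul_mx_is_zmod_morphism : zmod_morphism lmul_mx.
Proof.
move=> x y; apply: sigma_row_inj.
by rewrite raddfB mulmxBr !lmul_mxE raddfB mulmxBl.
Qed.
HB.instance Definition _ := GRing.isZmodMorphism.Build _ _ lmul_mx lmul_mx_is_zmod_morphism.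

Fact lmul_mx_is_monoid_morphism : monoid_morphism lmul_mx.
Proof.
split=> [|x y]; apply: sigma_row_inj; first by rewrite lmul_mxE map_mx1 mulmx1 mul1mx.
by rewrite map_mxM mulmxA !lmul_mxE -mulmxA lmul_mxE mulmxA scalar_mxM.
Qed.
HB.instance Definition _ := GRing.isMonoidMorphism.Build _ _ lmul_mx lmul_mx_is_monoid_morphism.

Lemma fixed_scalar c : c%:A \in skew_pred fixed_closed.
Proof. by apply/fixedP => g Gg; rewrite linearZ /= rmorph1. Qed.

Definition fixed_in_alg c : K := SubSkew (fixed_scalar c).

Fact fixed_in_alg_is_zmod_morphism : zmod_morphism fixed_in_alg.
Proof. by move=> x y; apply: val_inj; rewrite /= scalerBl. Qed.
HB.instance Definition _ :=
  GRing.isZmodMorphism.Build _ _ fixed_in_alg fixed_in_alg_is_zmod_morphism.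

Fact fixed_in_alg_is_monoid_morphism : monoid_morphism fixed_in_alg.
Proof.
by split=> [|x y]; apply: val_inj; rewrite /= ?scale1r // -scalerAl mul1r scalerA.
Qed.
HB.instance Definition _ :=
  GRing.isMonoidMorphism.Build _ _ fixed_in_alg fixed_in_alg_is_monoid_morphism.
Local Notation kK := fixed_in_alg.

Lemma fixed_in_alg_central c x : kK c * x = x * kK c.
Proof.
apply: val_inj; rewrite [LHS](rmorphM val) [RHS](rmorphM val) /=.
by rewrite mulr_algl mulr_algr.
Qed.

Lemma lmul_mx_scalar c : lmul_mx c%:A = (kK c)%:M.
Proof.
apply: sigma_row_inj; rewrite lmul_mxE map_scalar_mx /=.
apply/matrixP => z t; rewrite mul_scalar_mx !mxE ord1 (bigD1 t) //= !mxE eqxx mulr1n.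
rewrite big1 ?addr0 => [|l /negPf lt]; last by rewrite !mxE lt mulr0n mulr0.
by rewrite mulr_algl mulr_algr.
Qed.

Definition unit_col : 'cV[K]_q.+1 := projT1 (cid (sigma_row_span (1%:M : 'rV[D]_1))).
Definition unit_coef : K := unit_col one 0.

(** [G] fixes 1 and permutes the basis transitively, so all the coordinates of 1 are equal. *)
Lemma unit_colE : unit_col = const_mx unit_coef.
Proof.
have ucE : sigma_row *m map_mx val unit_col = 1%:M by rewrite /unit_col; case: cid.
apply/matrixP => h z; rewrite mxE ord1 /unit_coef.
pose X : 'cV[K]_q.+1 := \col_l unit_col (shift (el h) l) 0.
suff XE : X = unit_col by rewrite -[in RHS]XE mxE /shift grp_idxK // mulg1 grp_eltK.
apply: sigma_row_inj; rewrite ucE; apply/matrixP => z1 z2; rewrite !ord1.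
have /matrixP/(_ 0 0)/(congr1 (a (el h)^-1%g)) := ucE.
rewrite ![in X in _ = X -> _]mxE rmorph1 => <-.
rewrite !mxE [RHS]rmorph_sum [RHS](reindex_inj (shift_inj (grp_eltP h))).
apply: eq_bigr => l _ /=; rewrite !mxE [RHS]rmorphM /= el_shift // act_sigma_inv ?groupV ?groupM //.
by rewrite mulKg; have /fixedP->// := valP (unit_col (shift (el h) l) 0); rewrite groupV.
Qed.

Lemma unit_sum : \sum_h e_ (el h) * val unit_coef = 1.
Proof.
have : sigma_row *m map_mx val unit_col = 1%:M by rewrite /unit_col; case: cid.
move/matrixP/(_ 0 0); rewrite [X in _ = X -> _]mxE eqxx mulr1n => <-.
rewrite mxE; apply: eq_bigr => h _.
by rewrite unit_colE !mxE.
Qed.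

Lemma unit_coef_neq0 : unit_coef != 0.
Proof.
apply/eqP => b0; have := unit_sum; rewrite b0 big1 => [/esym/eqP|h _].
  by rewrite oner_eq0.
by rewrite [val _](rmorph0 val) mulr0.
Qed.

Definition fixed_gens : 'M[K]_(q.+1, p.+1) :=
  projT1 (cid (sigma_row_span (\row_j (xD (col j basis_mx) * e_ 1%g)))).

Lemma fixed_gensE :
  sigma_row *m map_mx val fixed_gens = \row_j (xD (col j basis_mx) * e_ 1%g).
Proof. by rewrite /fixed_gens; case: cid. Qed.

(** By definition of [e_], [x0 * e_ 1 = (y_ 1 + 1) * e_ 1 = 1 + e_ 1]. This is why the whole first
    column costs a single generator. *)
Lemma fixed_gens0 h : fixed_gens h 0 = (h == one)%:R + unit_coef.
Proof.
suff : col 0 fixed_gens = \col_h ((h == one)%:R + unit_coef).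
  by move/matrixP/(_ h 0); rewrite !mxE.
apply: sigma_row_inj; apply/matrixP => z z'; rewrite !ord1.
have /matrixP/(_ 0 0) := fixed_gensE; rewrite [X in _ = X -> _]mxE col0_basis.
rewrite -[x0 in X in _ = X]mul1mx -(repr_mx1 rG) -[xD _](subrK 1) mulrDl mul1r.
rewrite mulrV ?sigma_shift_unit //.
move=> E; transitivity (1 + e_ 1%g); first by rewrite -E !mxE; apply: eq_bigr => l _; rewrite !mxE.
rewrite mxE -[in LHS]unit_sum addrC.
have -> : e_ 1%g = \sum_h e_ (el h) * (h == one)%:R.
  rewrite (bigD1 one) //= eqxx mulr1 grp_idxK // big1 ?addr0 // => l /negPf->.
  by rewrite mulr0.
rewrite -big_split; apply: eq_bigr => l _ /=.
rewrite !mxE -mulrDr; congr (_ * _).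
by rewrite [RHS](rmorphD val) [X in _ = X + _](rmorph_nat val).
Qed.

Lemma lin_sigma_inv w :
  xD w * e_ 1%g = \sum_h e_ (el h) * val (reg_coef kK fixed_gens h w).
Proof.
have wE : w = \sum_j coord w j 0 *: col j basis_mx.
  rewrite -[LHS]mul1mx -(mulmxV basis_mx_unit) -mulmxA -/(coord w).
  apply/matrixP => i z; rewrite mxE summxE; apply: eq_bigr => j _.
  by rewrite !mxE ord1 mulrC.
have xDs : xD w = \sum_j coord w j 0 *: xD (col j basis_mx).
  rewrite [in LHS]wE; elim/big_rec2: _ => [|j y1 y2 _ <-].
    by rewrite -[X in lin_comb _ X](scale0r 0) lin_combZ scale0r.
  by rewrite lin_combD lin_combZ.
rewrite xDs mulr_suml.
transitivity (\sum_j \sum_h coord w j 0 *: (e_ (el h) * val (fixed_gens h j))).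
  apply: eq_bigr => j _; rewrite -scalerAl -scaler_sumr; congr (_ *: _).
  have /matrixP/(_ 0 j) := fixed_gensE; rewrite [X in _ = X -> _]mxE => <-.
  by rewrite mxE; apply: eq_bigr => h _; rewrite !mxE.
rewrite exchange_big; apply: eq_bigr => h _ /=.
rewrite /reg_coef [RHS](_ : _ = e_ (el h) * \sum_j coord w j 0 *: val (fixed_gens h j)).
  by rewrite mulr_sumr; apply: eq_bigr => j _; rewrite scalerAr.
congr (_ * _); rewrite [LHS](rmorph_sum val); apply: eq_bigr => j _ /=.
by rewrite mulr_algl.
Qed.

(** The product of [xD v] and [e_ t] is the image under [t] of the product of [xD (t^-1 v)] and
    [e_ 1], whose coordinates are known. *)
Lemma lmul_mx_lin v : lmul_mx (xD v) = reg_mx kK fixed_gens v.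
Proof.
apply: sigma_row_inj; rewrite lmul_mxE; apply/matrixP => z t; rewrite ord1.
transitivity (a (el t) (xD (rG (el t)^-1%g *m v) * e_ 1%g)).
  rewrite rmorphM /= act_lin // act_sigma_inv // mulg1.
  rewrite mulmxA -repr_mxM ?groupV // mulgV repr_mx1 mul1mx.
  by rewrite mul_scalar_mx !mxE.
rewrite lin_sigma_inv rmorph_sum /=.
rewrite (reindex_inj (shift_inj (groupVr (grp_eltP t)))) mxE; apply: eq_bigr => l _ /=.
rewrite rmorphM /= el_shift ?groupV // act_sigma_inv ?groupM ?groupV // mulKVg.
rewrite !mxE; congr (_ * _).
by have /fixedP-> := valP (reg_coef kK fixed_gens (shift (el t)^-1%g l) (rG (el t)^-1%g *m v)).
Qed.

Lemma fixed_generated (S : {pred K}) : GRing.divring_closed S ->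
  (forall c, kK c \in S) -> (forall h j, fixed_gens h j \in S) -> forall x, x \in S.
Proof.
move=> HS Sk Sg x; have [S1 SB SV] := HS.
have S0 : 0 \in S by rewrite -(subrr 1) SB.
have SN y : y \in S -> - y \in S by move=> Sy; rewrite -sub0r SB.
have SD y z : y \in S -> z \in S -> y + z \in S.
  by move=> Sy Sz; rewrite -[z]opprK SB ?SN.
have SM y z : y \in S -> z \in S -> y * z \in S.
  by move=> Sy Sz; rewrite -[z]invrK SV // -[z^-1]mul1r SV.
have Ssum n (f : 'I_n -> K) : (forall j, f j \in S) -> \sum_j f j \in S.
  by move=> Sf; elim/big_rec: _ => // j y _; apply: SD.
have Sb : unit_coef \in S.
  by rewrite -[unit_coef](addKr ((one == one)%:R)) -fixed_gens0 SD ?SN // eqxx.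
pose Sin (M : 'M[K]_q.+1) := forall l t, M l t \in S.
have SinM M M' : Sin M -> Sin M' -> Sin (M *m M').
  by move=> SiM SiM' l t; rewrite mxE; apply: Ssum => j; apply: SM.
have lmulS d : Sin (lmul_mx d).
  pose S' : {pred D} := fun d => `[< Sin (lmul_mx d) >].
  suff /asboolP : d \in S' by [].
  have [_ _ epi _] := univD; apply: epi => [|u]; last first.
    apply/asboolP; elim/free_ind: u => [c|i|u v Su Sv|u v Su Sv].
    - rewrite iDk lmul_mx_scalar => l t.
      by rewrite mxE; case: (l == t); [apply: Sk | apply: S0].
    - rewrite -[iD _]/((fun j => iD (free_gen F j)) i) -lin_comb_delta lmul_mx_lin.
      by move=> l t; rewrite mxE; apply: Ssum => j; apply: SM.
    - by rewrite !rmorphD => l t; rewrite mxE; apply: SD.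
    - by rewrite !rmorphM; apply: SinM.
  split=> [|y z /asboolP Sy /asboolP Sz|y z /asboolP Sy /asboolP Sz]; apply/asboolP.
  - by rewrite rmorph1 => l t; rewrite mxE; case: (l == t); [apply: S1 | apply: S0].
  - by rewrite rmorphB => l t; rewrite !mxE; apply: SB.
  have [->|z0] := eqVneq z 0.
    by rewrite invr0 mulr0 rmorph0 => l t; rewrite mxE.
  rewrite rmorphM; apply: SinM => //.
  apply: (minv_divring KF HS Sz); rewrite -[_ *m _]rmorphM.
    by rewrite skew_mulrV ?rmorph1 //; apply: DF.
  by rewrite skew_mulVr ?rmorph1 //; apply: DF.
(* The matrix of [x], with entries in [S], sends the coordinates of 1 to those of [x], all equal to
   [unit_coef * x]. *)
have bx : unit_coef * x \in S.
  suff <- : (lmul_mx (val x) *m (const_mx unit_coef : 'cV_q.+1)) one 0 = unit_coef * x.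
    by rewrite mxE; apply: Ssum => j; apply: SM; [apply: lmulS | rewrite mxE].
  suff -> : lmul_mx (val x) *m const_mx unit_coef = (\col_h (unit_coef * x) : 'cV_q.+1).
    by rewrite mxE.
  apply: sigma_row_inj; rewrite map_mxM mulmxA lmul_mxE.
  apply/matrixP => z z'; rewrite !ord1 -mulmxA mul_scalar_mx mxE.
  transitivity (val x); rewrite !mxE.
    rewrite -[RHS]mulr1 -unit_sum; congr (_ * _).
    by apply: eq_bigr => h _; rewrite !mxE.
  rewrite -[LHS]mul1r -unit_sum mulr_suml; apply: eq_bigr => h _.
  by rewrite !mxE [val (_ * _)](rmorphM val) mulrA.
rewrite -[x](mulKr (KF unit_coef_neq0)); apply: SM => //.
by rewrite -[_^-1]mul1r SV.
Qed.

(** * Comparison of the fixed skew field with the free skew field *)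

Hypothesis two_neq0 : 2%:R != 0 :> F.
Local Notation N := (q.+1 * p + 1)%N.
Local Notation A' := (free_algebra F N).
Variables (E : unitAlgType F) (iE : {rmorphism A' -> E}).
Hypothesis iEk : forall c, iE c%:A = c%:A.
Hypothesis univE : universal_field_of_fractions iE.

Lemma E_field : GRing.field_axiom E. Proof. by have [] := univE. Qed.
Local Notation EF := E_field.

(** Stated over any ring, so that the structure constants over [K] and their free counterparts over
    [E] come from the same formula. *)
Definition gen_tbl (B : nzRingType) (g : 'rV[B]_N) : 'M[B]_(q.+1, p.+1) :=
  \matrix_(h, j) if unlift ord0 j is Some j' then vec_mx (lsubmx g) h j'
                 else (h == one)%:R + rsubmx g 0 0.

(* [gens_of_tbl] lists the [|G| (n - 1) + 1] free generators of the fixed skew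
   field; the first column of [fixed_gens] is determined by [unit_coef]. *)
Definition gens_of_tbl : 'rV[K]_N :=
  row_mx (mxvec (\matrix_(h, j) fixed_gens h (lift ord0 j))) unit_coef%:M.

Lemma gens_of_tblK : gen_tbl gens_of_tbl = fixed_gens.
Proof.
apply/matrixP => h j; rewrite mxE row_mxKl row_mxKr mxvecK.
case: unliftP => [j' ->|->]; first by rewrite mxE.
by rewrite fixed_gens0 mxE.
Qed.

Definition free_gens : 'rV[E]_N := \row_i iE (free_gen F i).
Definition free_unit : E := rsubmx free_gens 0 0.

Lemma free_unit_neq0 : free_unit != 0.
Proof.
have [_ iE_inj _ _] := univE; rewrite /free_unit !mxE; apply/eqP => w0.
have [//|f [_ fx]] := free_hom (k := idfun : {rmorphism F -> F}) (fun _ : 'I_N => 1).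
  by move=> c b; rewrite mulrC.
have := fx (rshift (q.+1 * p) 0); rewrite (iE_inj (free_gen F (rshift (q.+1 * p) 0)) 0).
  by rewrite rmorph0 => /esym/eqP; rewrite oner_eq0.
by rewrite rmorph0.
Qed.

Local Notation kE := (in_alg E).

Lemma in_alg_central c (x : E) : kE c * x = x * kE c.
Proof. by rewrite mulr_algl mulr_algr. Qed.

Section Specialize.

Variables (f : {rmorphism A' -> K}) (S : {pred E}) (phi : E -> K).
Hypothesis fk : forall c, f c%:A = kK c.
Hypothesis fx : forall i, f (free_gen F i) = gens_of_tbl 0 i.
Hypothesis spec : specialization iE f S phi.
Variable rho : {rmorphism A -> 'M[E]_q.+1}.
Hypothesis rho_k : forall c, rho c%:A = (kE c)%:M.
Hypothesis rho_lin : forall v, rho (lin_form v) = reg_mx kE (gen_tbl free_gens) v.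

(** On linear forms both sides are given by [reg_mx], and [phi] sends the free table to
    [fixed_gens]; the rest follows by induction on [u]. *)
Lemma rho_special u : (forall l t, rho u l t \in S) /\ map_mx phi (rho u) = lmul_mx (iD u).
Proof.
have [[[S1 SB SM] Si] phi_i phiB phiM phiV] := spec.
have S0 : 0 \in S by rewrite -(subrr 1) SB.
have phi0 : phi 0 = 0 by rewrite -(rmorph0 iE) phi_i rmorph0.
have phi1 : phi 1 = 1 by rewrite -(rmorph1 iE) phi_i rmorph1.
have SN x : x \in S -> - x \in S by move=> Sx; rewrite -sub0r SB.
have SD x y : x \in S -> y \in S -> x + y \in S.
  by move=> Sx Sy; rewrite -[y]opprK SB ?SN.
have phiN x : x \in S -> phi (- x) = - phi x.
  by move=> Sx; rewrite -sub0r phiB // phi0 sub0r.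
have phiD x y : x \in S -> y \in S -> phi (x + y) = phi x + phi y.
  by move=> Sx Sy; rewrite -[in LHS](opprK y) phiB ?SN // phiN // opprK.
have phi_sum n (g : 'I_n -> E) : (forall j, g j \in S) ->
    \sum_j g j \in S /\ phi (\sum_j g j) = \sum_j phi (g j).
  move=> Sg; apply: (big_rec2 (fun x y => x \in S /\ phi x = y)) => // j x _ _ [Sx <-].
  by rewrite SD // phiD.
have gE j : free_gens 0 j \in S /\ phi (free_gens 0 j) = gens_of_tbl 0 j.
  by rewrite mxE phi_i fx.
have tblE h j : gen_tbl free_gens h j \in S /\
    phi (gen_tbl free_gens h j) = fixed_gens h j.
  rewrite -gens_of_tblK !mxE; case: unlift => [j'|].
    rewrite !mxE; have [] := gE (lshift 1 (mxvec_index h j')).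
    by rewrite !mxE.
  have [] := gE (rshift (q.+1 * p) 0); rewrite !mxE => Sw phiw.
  have S1' : (h == one)%:R \in S by case: (h == one).
  split; first by apply: SD.
  by rewrite phiD // phiw; case: (h == one); rewrite ?phi1 ?phi0.
have kS c : kE c \in S /\ phi (kE c) = kK c by rewrite -[kE c]iEk phi_i fk.
elim/free_ind: u => [c|i|u v [Su phiu] [Sv phiv]|u v [Su phiu] [Sv phiv]].
- have [Sc phic] := kS c; rewrite rho_k; split=> [l t|].
    by rewrite mxE; case: (l == t); [apply: Sc | apply: S0].
  rewrite iDk lmul_mx_scalar; apply/matrixP => l t; rewrite !mxE.
  by case: (l == t).
- rewrite -lin_comb_delta rho_lin lin_formE lmul_mx_lin; split=> [l t|].
    rewrite mxE; have [] // := phi_sum _ (fun j =>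
      kE (coord (rG (el t)^-1%g *m delta_mx i 0) j 0) *
      gen_tbl free_gens (shift (el t)^-1%g l) j).
    by move=> j; apply: SM; [have [] := kS (coord (rG (el t)^-1%g *m delta_mx i 0) j 0) |
      have [] := tblE (shift (el t)^-1%g l) j].
  apply/matrixP => l t; rewrite !mxE /reg_coef.
  have kS' c : kE c \in S by have [] := kS c.
  have tblS h j : gen_tbl free_gens h j \in S by have [] := tblE h j.
  rewrite (phi_sum _ _ _).2 => [|j]; last by apply: SM; [apply: kS' | apply: tblS].
  apply: eq_bigr => j _; rewrite phiM ?kS' ?tblS //.
  by congr (_ * _); [have [_ ->] := kS (coord (rG (el t)^-1%g *m delta_mx i 0) j 0) |
    have [_ ->] := tblE (shift (el t)^-1%g l) j].
- rewrite (rmorphD rho) (rmorphD iD) (rmorphD lmul_mx) /= -phiu -phiv.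
  split=> [l t|]; first by rewrite mxE; apply: SD.
  by apply/matrixP => l t; rewrite !mxE phiD.
rewrite (rmorphM rho) (rmorphM iD) (rmorphM lmul_mx) /= -phiu -phiv.
have SuvM l t j : rho u l j * rho v j t \in S by apply: SM.
split=> [l t|]; first by rewrite mxE; have [] := phi_sum _ _ (SuvM l t).
apply/matrixP => l t; rewrite !mxE (phi_sum _ _ (SuvM l t)).2.
by apply: eq_bigr => j _; rewrite phiM // !mxE.
Qed.

End Specialize.

Section Descend.

Variable Psi : {rmorphism D -> 'M[E]_q.+1}.
Hypothesis Psi_k : forall c, Psi c%:A = (kE c)%:M.
Hypothesis Psi_lin : forall v, Psi (xD v) = reg_mx kE (gen_tbl free_gens) v.

Definition shift_mx g : 'M[E]_q.+1 := \matrix_(l, t) (l == shift g t)%:R.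

Lemma mul_shift_mx g (X : 'M[E]_q.+1) l t : (X *m shift_mx g) l t = X l (shift g t).
Proof.
rewrite mxE (bigD1 (shift g t)) //= mxE eqxx mulr1 big1 ?addr0 // => j /negPf jt.
by rewrite mxE jt mulr0.
Qed.

Lemma shift_mx_mul g (X : 'M[E]_q.+1) l t : g \in G -> (shift_mx g *m X) (shift g l) t = X l t.
Proof.
move=> Gg; rewrite mxE (bigD1 l) //= mxE eqxx mul1r big1 ?addr0 // => j /negPf jl.
by rewrite mxE (can_eq (shiftK Gg)) eq_sym jl mul0r.
Qed.

(** The matrices [reg_mx] are equivariant by construction, whatever the table, and the identity
    extends from the free algebra to [D] because [iD] is epic. *)
Lemma Psi_act g d : g \in G -> Psi (a g d) * shift_mx g = shift_mx g * Psi d.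
Proof.
move=> Gg; have [_ _ epi _] := univD.
apply: (epic_intertwine DF epi (f := Psi \o a g)) => u /=.
elim/free_ind: u => [c|i|u v IHu IHv|u v IHu IHv].
- rewrite iDk linearZ /= rmorph1 Psi_k.
  by apply: scalar_mx_central => x; apply: in_alg_central.
- rewrite -lin_comb_delta lin_formE act_lin // !Psi_lin; apply/matrixP => l t.
  have [l' ->] : exists l', l = shift g l' 
    by exists (shift g^-1%g l); rewrite shiftM ?groupV // mulgV /shift mul1g grp_eltK.
  rewrite [LHS]mul_shift_mx [RHS]shift_mx_mul // !mxE el_shift // invMg mulmxA.
  by rewrite -repr_mxM ?groupM ?groupV // mulgKV shiftM ?groupM ?groupV // mulgKV.
- by rewrite !rmorphD /= mulrDl mulrDr IHu IHv.
- by rewrite !rmorphM /= -mulrA IHv mulrA IHu mulrA.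
Qed.

(* The vector [sum_h e_h b], with [b] the variable [free_unit], is invariant under
   [G]; the fixed skew field maps it to its multiples. *)
Definition fixed_to_free_fun (x : K) : E := free_unit^-1 * (\sum_t Psi (val x) one t) * free_unit.

Lemma Psi_fixed (x : K) :
  Psi (val x) *m (const_mx free_unit : 'cV_q.+1) = const_mx free_unit *m (fixed_to_free_fun x)%:M.
Proof.
apply/matrixP => l z; rewrite ord1 !mxE big_ord1 !mxE mulr1n /fixed_to_free_fun.
rewrite !mulrA mulrV ?mul1r; last exact/EF/free_unit_neq0.
rewrite mulr_suml -[l in LHS]grp_eltK -[el l]mulg1 -{1}(grp_idxK (group1 G)) -/(shift (el l) one).
rewrite (reindex_inj (shift_inj (grp_eltP l))); apply: eq_bigr => t _.
rewrite mxE; congr (_ * _); have := Psi_act (val x) (grp_eltP l).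
have /fixedP-> // := valP x => /matrixP/(_ (shift (el l) one) t).
by rewrite [LHS]mul_shift_mx => ->; rewrite [LHS]shift_mx_mul.
Qed.

Fact fixed_to_free_is_zmod_morphism : zmod_morphism fixed_to_free_fun.
Proof.
move=> x y; rewrite /fixed_to_free_fun -mulrBl -mulrBr -sumrB [val (x - y)](rmorphB val) rmorphB.
by congr (_ * _ * _); apply: eq_bigr => t _; rewrite !mxE.
Qed.

Lemma const_unitI (x y : E) :
  const_mx free_unit *m x%:M = const_mx free_unit *m y%:M :> 'cV_q.+1 -> x = y.
Proof.
move/matrixP/(_ one 0); rewrite !mxE !big_ord1 !mxE !mulr1n => xy.
by rewrite -[x](mulKr (EF free_unit_neq0)) xy mulKr //; apply/EF/free_unit_neq0.
Qed.

Fact fixed_to_free_is_monoid_morphism : monoid_morphism fixed_to_free_fun.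
Proof.
split=> [|x y]; apply: const_unitI; rewrite -Psi_fixed.
  by rewrite [val 1](rmorph1 val) rmorph1 mul1mx mulmx1.
rewrite [val (x * y)](rmorphM val) (rmorphM Psi) -[LHS]mulmxA Psi_fixed mulmxA Psi_fixed.
by rewrite -mulmxA -scalar_mxM.
Qed.

Lemma fixed_to_free_scalar c : fixed_to_free_fun (kK c) = kE c.
Proof.
apply: const_unitI; rewrite -Psi_fixed /= Psi_k.
by apply/matrixP => l z; rewrite ord1 mul_scalar_mx !mxE big_ord1 !mxE mulr1n -in_alg_central.
Qed.

Lemma free_tbl0 h : gen_tbl free_gens h 0 = (h == one)%:R + free_unit.
Proof. by rewrite mxE unlift_none. Qed.

Lemma reg_mx_delta v h :
  reg_mx kE (gen_tbl free_gens) v *m delta_mx h 0 =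
  \col_l reg_coef kE (gen_tbl free_gens) (shift (el h)^-1%g l) (rG (el h)^-1%g *m v).
Proof. by rewrite -colE; apply/matrixP => l z; rewrite !mxE. Qed.

Lemma reg_coef_basis h j : reg_coef kE (gen_tbl free_gens) h (col j basis_mx) =
  gen_tbl free_gens h j.
Proof.
rewrite /reg_coef coord_basis (bigD1 j) //= [delta_mx _ _ _ _]mxE !eqxx scale1r mul1r.
by rewrite big1 ?addr0 // => i /negPf ij; rewrite [delta_mx _ _ _ _]mxE ij scale0r mul0r.
Qed.

(** The free counterpart of [e_ h * 1 = e_ h]. The first column of the table was chosen so that
    [y_ h] sends basis vector [h] to the invariant vector. *)
Lemma Psi_sigma_inv h : Psi (e_ (el h)) *m const_mx free_unit = delta_mx h 0 :> 'cV_q.+1.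
Proof.
have <- : Psi (y_ (el h)) *m (delta_mx h 0 : 'cV_q.+1) = const_mx free_unit.
  rewrite rmorphB rmorph1 Psi_lin mulmxBl mul1mx reg_mx_delta.
  rewrite mulmxA -repr_mxM ?groupV // mulVg repr_mx1 mul1mx -col0_basis.
  apply/matrixP => l z; rewrite !mxE ord1 eqxx andbT reg_coef_basis free_tbl0.
  rewrite (can2_eq (shiftK (groupVr (grp_eltP h)))) invgK; last first.
    by have := shiftK (grp_eltP h); rewrite -[X in shift X]invgK.
  by rewrite /shift grp_idxK // mulg1 grp_eltK addrAC subrr add0r.
rewrite mulmxA -[Psi _ *m Psi _]/(Psi _ * Psi _) -(rmorphM Psi).
by rewrite mulVr ?sigma_shift_unit // rmorph1 mul1mx.
Qed.

(** Both sides of the relation defining [fixed_gens] are applied through [Psi] to the invariant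
    vector, and coordinate [h] is compared. *)
Lemma fixed_to_free_gens h j : fixed_to_free_fun (fixed_gens h j) = gen_tbl free_gens h j.
Proof.
have Ej : xD (col j basis_mx) * e_ 1%g = \sum_h e_ (el h) * val (fixed_gens h j).
  have /matrixP/(_ 0 j) := fixed_gensE; rewrite [X in _ = X -> _]mxE => <-.
  by rewrite mxE; apply: eq_bigr => l _; rewrite !mxE.
have := congr1 (fun d => (Psi d *m (const_mx free_unit : 'cV_q.+1)) h 0) Ej.
rewrite /= (rmorphM Psi) -[Psi _ * _ *m _]mulmxA -[X in e_ X](grp_idxK (group1 G)).
rewrite Psi_sigma_inv Psi_lin reg_mx_delta grp_idxK // invg1 repr_mx1 mul1mx mxE.
rewrite reg_coef_basis /shift mul1g grp_eltK => ->.
have colE l x : Psi (e_ (el l) * val x) *m const_mx free_unit =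
    delta_mx l 0 *m (fixed_to_free_fun x)%:M :> 'cV_q.+1.
  by rewrite (rmorphM Psi) -[LHS]mulmxA Psi_fixed mulmxA Psi_sigma_inv.
rewrite rmorph_sum mulmx_suml summxE (bigD1 h) //= colE big1 => [|l lh].
  by rewrite addr0 mxE big_ord1 !mxE !eqxx mul1r.
by rewrite colE mxE big_ord1 !mxE eq_sym (negPf lh) mul0r.
Qed.

Lemma fixed_to_free : exists psi : {rmorphism K -> E},
  (forall c, psi (kK c) = kE c) /\
  (forall h j, psi (fixed_gens h j) = gen_tbl free_gens h j).
Proof.
pose psi : {rmorphism K -> E} := HB.pack fixed_to_free_fun
  (GRing.isZmodMorphism.Build K E fixed_to_free_fun fixed_to_free_is_zmod_morphism)
  (GRing.isMonoidMorphism.Build K E fixed_to_free_fun fixed_to_free_is_monoid_morphism).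
by exists psi; split=> [c|h j]; [apply: fixed_to_free_scalar | apply: fixed_to_free_gens].
Qed.

End Descend.

Lemma fixed_field_hom : exists phi : {lrmorphism E -> D},
  injective phi /\ forall y, (exists z, phi z = y) <-> {in G, forall g, a g y = y}.
Proof.
have [f [fk fx]] := free_hom (fun i => gens_of_tbl 0 i) fixed_in_alg_central.
have [S [phi spec]] := universal_specialization univE f KF.
have [rho [rho_k rho_lin]] := regular_hom in_alg_central (gen_tbl free_gens).
have rhoP := rho_special fk fx spec rho_k rho_lin.
have [Psi PsiE] := transfer two_neq0 univD KF EF in_alg_central rho_k spec
  (fun u => (rhoP u).1) (fun u => (rhoP u).2).
have Psi_k c : Psi c%:A = (kE c)%:M by rewrite -iDk PsiE.
have Psi_lin v : Psi (xD v) = reg_mx kE (gen_tbl free_gens) v by rewrite -lin_formE PsiE.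
have [psi [psi_k psi_gens]] := fixed_to_free Psi_k Psi_lin.
have psi_tbl : map_mx psi gens_of_tbl = free_gens.
  rewrite map_row_mx -[RHS]hsubmxK; congr row_mx.
    rewrite map_mxvec -[RHS]vec_mxK; congr mxvec; apply/matrixP => h j.
    by rewrite !mxE psi_gens mxE liftK !mxE.
  have := psi_gens one 0; rewrite fixed_gens0 free_tbl0 rmorphD rmorph_nat.
  by move=> /addrI bw; rewrite map_scalar_mx [RHS]mx11_scalar bw.
have psi_f : psi \o f =1 iE.
  apply: (free_hom_eq (f := psi \o f)) => [c|i] /=; first by rewrite fk iEk psi_k.
  by rewrite fx; have /matrixP/(_ 0 i) := psi_tbl; rewrite mxE [RHS]mxE.
have [[[S1 SB SM] Si] phi_i phiB phiM phiV] := spec.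
(* These elements form a sub-skew-field containing the image of [iE], hence all of [E]: the
   specialization is defined everywhere and [psi] is a left inverse of it. *)
pose S' : {pred E} := fun s => (s \in S) && (psi (phi s) == s).
have S'P s : s \in S /\ psi (phi s) = s.
  suff /andP[Ss /eqP] : s \in S' by [].
  have [_ _ epi _] := univE; apply: epi => [|u]; last first.
    by rewrite unfold_in /S' Si phi_i; apply/eqP/psi_f.
  have phi1 : phi 1 = 1 by rewrite -(rmorph1 iE) phi_i rmorph1.
  split=> [|x y /andP[Sx /eqP xE] /andP[Sy /eqP yE]|x y /andP[Sx /eqP xE] /andP[Sy /eqP yE]].
  - by rewrite unfold_in S1 phi1 rmorph1 /=.
  - by rewrite unfold_in SB //= phiB // rmorphB xE yE.
  have [y0|y0] := eqVneq y 0.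
    by rewrite y0 invr0 mulr0 unfold_in -(rmorph0 iE) Si phi_i; apply/eqP/psi_f.
  (* A nonzero [y = psi (phi y)] has nonzero residue, hence an inverse in the local ring [S]. *)
  have [|uy Sy'] := phiV y Sy; first by apply: contraNneq y0 => py0; rewrite -yE py0 rmorph0.
  rewrite unfold_in SM //= phiM // rmorphM xE; apply/eqP; congr (_ * _).
  by rewrite -[LHS](mulKr uy) -{2}yE -rmorphM -phiM // mulrV // phi1 rmorph1 mulr1.
have PhiB : zmod_morphism phi by move=> x y; rewrite phiB ?(S'P _).1.
have PhiM : monoid_morphism phi.
  split=> [|x y]; first by rewrite -(rmorph1 iE) phi_i rmorph1.
  by rewrite phiM ?(S'P _).1.
pose Phi : {rmorphism E -> K} := HB.pack phi (GRing.isZmodMorphism.Build E K phi PhiB)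
  (GRing.isMonoidMorphism.Build E K phi PhiM).
have PhiP x : psi (Phi x) = x := (S'P x).2.
pose vPhi : {rmorphism E -> D} := val \o Phi.
have PhiZ : scalable vPhi.
  move=> c x; rewrite -[x in LHS]mul1r scalerAl -[c *: 1]iEk rmorphM /=.
  by rewrite phi_i fk /= mulr_algl.
pose Phi' : {lrmorphism E -> D} := HB.pack (GRing.RMorphism.sort vPhi)
  vPhi (GRing.isScalable.Build F E D *:%R vPhi PhiZ).
exists Phi'; split=> [x y /val_inj xy|y]; first by rewrite -(PhiP x) -(PhiP y) /Phi xy.
split=> [[z <-]|/fixedP yfix]; first exact/fixedP/(valP (Phi z)).
pose y' : K := SubSkew (yfix : y \in skew_pred fixed_closed).
pose T : {pred K} := fun x => `[< exists z, Phi z = x >].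
suff /asboolP[z zy] : y' \in T by exists z; rewrite [LHS]/(val (Phi z)) zy.
apply: fixed_generated => [|c|h j].
- split=> [|x z /asboolP[x' <-] /asboolP[z' <-]|x z /asboolP[x' <-] /asboolP[z' <-]];
    apply/asboolP.
  + by exists 1; rewrite rmorph1.
  + by exists (x' - z'); rewrite rmorphB.
  have [->|z0] := eqVneq z' 0; first by exists 0; rewrite !rmorph0 invr0 mulr0.
  by exists (x' / z'); rewrite rmorphM rmorphV //; apply: EF.
- by apply/asboolP; exists (iE c%:A); rewrite [LHS]phi_i fk.
rewrite -gens_of_tblK.
have fT u : f u \in T by apply/asboolP; exists (iE u); rewrite [LHS]phi_i.
rewrite mxE; case: unlift => [j'|]; first by rewrite [vec_mx _ _ _]mxE [lsubmx _ _ _]mxE -fx.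
rewrite [rsubmx _ _ _]mxE -fx (_ : _ + _ = f ((h == one)%:R + free_gen F (rshift (q.+1 * p) 0))) //.
by rewrite rmorphD rmorph_nat.
Qed.

End GaloisDescent.

(** * Complete representations *)

(** A simple submodule of the image of [z - 1] in the regular representation is a line. If [z] fixed
    a generator [u = w (z - 1)] of it, then [w z^k = w + k u] for all [k]; taking for [k] the order
    of [z] gives [u = 0] in characteristic 0. *)
Lemma linear_char_separates (C : numClosedFieldType) (gT : finGroupType) (N : {group gT}) z :
  abelian N -> z \in N -> z != 1%g ->
  exists chi : mx_representation C N 1, chi z != 1%:M.
Proof.
move=> cNN Nz z1; pose aN := regular_repr C N.
have aNz : aN z - 1%:M != 0.
  rewrite subr_eq0; apply: contra z1 => /eqP az.
  rewrite -in_set1 (subsetP (regular_mx_faithful C N)) //.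
  by apply/rkerP.
have modU : mxmodule aN (aN z - 1%:M).
  apply/mxmoduleP => x Nx; rewrite mulmxBl mul1mx -repr_mxM // -(centsP cNN x Nx z Nz).
  by rewrite repr_mxM // -[X in _ - X]mulmx1 -mulmxBr submxMl.
have fixed u w : u = w *m (aN z - 1%:M) -> u *m aN z = u -> u = 0 :> 'rV_#|N|.
  move=> uE uz; have wz k : w *m aN (z ^+ k)%g = w + k%:R *: u.
    elim: k => [|k IHk]; first by rewrite expg0 repr_mx1 mulmx1 scale0r addr0.
    rewrite expgSr repr_mxM ?groupX // mulmxA IHk mulmxDl -scalemxAl uz.
    have -> : w *m aN z = w + u by rewrite uE mulmxBr mulmx1 addrC subrK.
    by rewrite -addrA -{1}[u]scale1r -scalerDl -nat1r.
  have := wz #[z]%g; rewrite expg_order repr_mx1 mulmx1 -[LHS]addr0 => /addrI/esym/eqP.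
  by rewrite scaler_eq0 pnatr_eq0 -leqn0 leqNgt order_gt0 => /eqP.
have [M simM MU] : exists2 M, mxsimple aN M & (M <= aN z - 1%:M)%MS.
  apply: contrapT => nex; have [] // : false.
  by apply: (mxsimple_exists modU aNz) => exM; case: nex.
have splitN : group_splitting_field C N by apply: group_closure_closed_field.
have modM := mxsimple_module simM.
have [u [c Mu uc]] := mxmodule_eigenvector modM (mxsimple_abelian_linear splitN cNN simM).
have u0 : u != 0 by rewrite -(eqmx_eq0 Mu); case: simM.
have scaleI x y : x *: u = y *: u -> x = y.
  move/eqP; rewrite -subr_eq0 -scalerBl scaler_eq0 (negPf u0) orbF subr_eq0.
  by move/eqP.
have chi_repr : mx_repr N (fun x => (c x)%:M : 'M[C]_1).
  split=> [|x y Nx Ny].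
    by congr _%:M; apply: scaleI; rewrite -uc // repr_mx1 mulmx1 scale1r.
  rewrite -scalar_mxM; congr _%:M; apply: scaleI.
  by rewrite -uc ?groupM // repr_mxM // mulmxA uc // -scalemxAl uc // scalerA.
exists (MxRepresentation chi_repr); apply: contra u0 => /eqP/matrixP/(_ 0 0).
rewrite !mxE !mulr1n => cz1; apply/eqP.
have /submxP[w uE] : (u <= aN z - 1%:M)%MS by rewrite -Mu.
by apply: fixed uE _; rewrite uc // cz1 scale1r.
Qed.

Section Complete.

Variable C : numClosedFieldType.

Lemma rker_dadd (gT : finGroupType) (G : {group gT}) (r1 r2 : representation C G) z :
  (z \in rker (dadd_grepr r1 r2)) = (z \in rker r1) && (z \in rker r2).
Proof.
apply/idP/andP => [/rkerP[Gz]|[/rkerP[Gz z1] /rkerP[_ z2]]].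
  rewrite /= scalar_mx_block => /eq_block_mx[z1 _ _ z2].
  by split; apply/rkerP.
by apply/rkerP; rewrite /= z1 z2 -scalar_mx_block.
Qed.

Lemma rker_bigdadd (gT : finGroupType) (G : {group gT}) (I : eqType) (e : seq I)
    (P : pred I) (s : I -> representation C G) z : z \in G ->
  (z \in rker (\big[dadd_grepr/grepr0]_(i <- e | P i) s i)) =
  all (fun i => P i ==> (z \in rker (s i))) e.
Proof.
move=> Gz; elim: e => [|i e IHe].
  by rewrite big_nil; apply/rkerP; split.
by rewrite big_cons [RHS]/=; case: (P i) => //; rewrite rker_dadd IHe.
Qed.

Lemma rker_tensor (gT : finGroupType) (G : {group gT}) (r1 r2 : representation C G) z :
  z \in rker r1 -> z \in rker r2 -> z \in rker (tensor r1 r2).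
Proof.
move=> /rkerP[Gz z1] /rkerP[_ z2]; apply/rkerP; split=> //.
by rewrite /= z1 z2 tprod1.
Qed.

(** [rB] restricted to [N] contains every nontrivial linear character of [N], and these separate the
    elements of the abelian group [N] from 1. *)
Lemma complete_splitting_faithful (gT : finGroupType) (G N : {group gT}) (nNG : (N <| G)%g)
    (r rB rJ : representation C G) z :
  complete_splitting nNG r rB rJ -> z \in N -> z \in rker r -> z = 1%g.
Proof.
move=> [_ cNN rBJ [k [s [rBs _ sP]]]] Nz; rewrite (rker_mx_rsim rBJ) rker_dadd => /andP[zB _].
apply/eqP; apply: contraT => z1.
have [chi chiz] := linear_char_separates C cNN Nz z1.
have chiN : ~~ (N \subset rker chi).
  by apply: contra chiz => /subsetP/(_ z Nz)/rkerP[_ ->].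
have [i [chis _]] := sP chi chiN.
suff : z \in rker (s i) by rewrite -(rker_mx_rsim chis) => /rkerP[_ zE]; rewrite zE eqxx in chiz.
have : z \in rker (subg_repr rB (normal_sub nNG)) by rewrite rker_subg inE Nz.
rewrite (rker_mx_rsim rBs) rker_bigdadd // => /allP/(_ i).
by rewrite mem_index_enum => /(_ isT).
Qed.

(** The kernel of [r] acts trivially on [Qsum], hence on the representation of [G / N]. By induction
    it lies in [N], where the splitting makes it trivial. *)
Lemma complete_faithful (gT : finGroupType) (G : {group gT}) (r : representation C G) :
  complete r -> mx_faithful r /\ G :!=: 1%g.
Proof.
elim=> {gT G r} [gT G N nNG r rB rJ spl GN|gT G N nNG r rB rJ k s kerN spl _ Qs _ [IH _]].
  split; last by rewrite GN; case: spl.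
  apply/subsetP => z zr; rewrite inE; apply/eqP.
  by apply: (complete_splitting_faithful spl) => //; rewrite -GN; case/rkerP: zr.
have [N1 _ rBJ _] := spl; split; last first.
  by apply: contra N1 => /eqP G1; rewrite -subG1 -G1 normal_sub.
apply/subsetP => z zr; rewrite inE; apply/eqP.
apply: (complete_splitting_faithful spl) => //.
have := zr; rewrite (rker_mx_rsim rBJ) rker_dadd => /andP[zB zJ].
have Gz : z \in G by case/rkerP: zr.
have : z \in rker (Qsum r rB rJ) by rewrite !rker_dadd zr !rker_tensor.
rewrite (rker_mx_rsim Qs) rker_bigdadd // => /allP zs.
apply: coset_idr; first by apply: subsetP (normal_norm nNG) z Gz.
apply/set1P; apply: (subsetP IH); rewrite rker_quo mem_quotient //.
by rewrite rker_bigdadd //; apply/allP => i ie; apply/implyP => _; apply: zs i ie.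
Qed.

End Complete.

Lemma real_complete_faithful (R : realType) (gT : finGroupType) (G : {group gT}) (n : nat)
    (rG : mx_representation R G n) : real_complete rG -> mx_faithful rG /\ G :!=: 1%g.
Proof.
move=> /complete_faithful[faith G1]; split=> //.
by rewrite /mx_faithful -(rker_map (real_complex R)).
Qed.

Lemma fixed_field_free (F : numFieldType) (gT : finGroupType) (G : {group gT}) (n N : nat)
    (rG : mx_representation F G n)
    (D : unitAlgType F) (iD : {lrmorphism free_algebra F n -> D})
    (a : gT -> {lrmorphism D -> D})
    (E : unitAlgType F) (iE : {lrmorphism free_algebra F N -> E}) :
  (0 < n)%N -> N = (#|G| * (n - 1) + 1)%N -> mx_faithful rG ->
  free_skew_field iD -> linear_action rG iD a -> free_skew_field iE ->
  exists phi : {lrmorphism E -> D},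
    injective phi /\
    (forall y : D, (exists z : E, phi z = y) <-> {in G, forall g, a g y = y}).
Proof.
case: n rG iD => [//|p] rG iD _ NE faith univD [a1 aM act_gen] univE.
have [x0 [lam [x01 lam1 lamG]]] := generic_point (ltn0Sn p) faith.
have [q oG] : exists q, #|G| = q.+1 by exists #|G|.-1; rewrite prednK ?cardG_gt0.
rewrite oG subn1 /= in NE; case: _ / (esym NE) iE univE => iE univE.
apply: (@fixed_field_hom F gT G p q rG oG x0 lam _ lam1 lamG D iD a _ univD a1 aM _ _ E iE).
- exact: x01.
- exact: (rmorph_alg iD).
- by move=> g Gg i; apply: act_gen.
- by rewrite pnatr_eq0.
- exact: (rmorph_alg iE).
exact: univE.
Qed.

Theorem theorem3p7 (R : realType) (gT : finGroupType) (G : {group gT}) (n : nat)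
    (rG : mx_representation R G n)
    (D : unitAlgType R) (iD : {lrmorphism free_algebra R n -> D})
    (a : gT -> {lrmorphism D -> D})
    (E : unitAlgType R)
    (iE : {lrmorphism free_algebra R (#|G| * (n - 1) + 1)%N -> E}) :
  real_complete rG ->
  free_skew_field iD ->
  linear_action rG iD a ->
  free_skew_field iE ->
  exists phi : {lrmorphism E -> D},
    injective phi /\
    (forall y : D, (exists z : E, phi z = y) <-> {in G, forall g, a g y = y}).
Proof.
move=> /real_complete_faithful[faith G1].
(* In dimension 0 faithfulness would force [G] to be trivial, so the natural subtraction [n - 1]
   does not truncate. *)
apply: fixed_field_free => //; case: n rG faith {iD iE} => // rG /subsetP faith.
case/eqP: G1; apply/trivgP/subsetP => g Gg; apply: faith.
by apply/rkerP; split=> //; rewrite [LHS]flatmx0 [RHS]flatmx0.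
Qed.
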